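(* Let $(\mu,\sigma)$ be a non explosive SDE on an open set $M\subseteq\mathbb{R}^n$, and let $V_1=(Y_1,C_1,\tau_1,H_1),\dots,V_r=(Y_r,C_r,\tau_r,H_r)$ be infinitesimal symmetries of $(\mu,\sigma)$ generating (as a real vector space) a solvable Lie algebra, such that $Y_1,\dots,Y_r$ are regular vector fields on $M$. Then, for any $x_0\in M$, there exist an open neighborhood $U$ of $x_0$ and a stochastic transformation $T=(\Phi,B,\eta,h)$ defined on $U$ such that the transformed SDE $E_T(\mu,\sigma)$ is in triangular form with respect to the variables $(x^{r+1},\dots,x^n)$.
   Context: Let $M\subseteq\mathbb{R}^n$ be open and let $\mu:M\to\mathbb{R}^n$, $\sigma:M\to\mathrm{Mat}(n,m)$ be smooth. The SDE $(\mu,\sigma)$ is $dX_t=\mu(X_t)dt+\sigma(X_t)dW_t$, $W$ an $m$-dimensional Brownian motion; it is non explosive if every (weak) solution is defined for all $t\ge0$. Its generator is $L=\frac12(\sigma\sigma^T)^{ij}\partial_i\partial_j+\mu^i\partial_i$ (summation convention), acting componentwise on vector-valued functions. A stochastic transformation is a quadruple $T=(\Phi,B,\eta,h)$ with $\Phi$ a diffeomorphism between open subsets of $\mathbb{R}^n$ and $B,\eta,h$ smooth functions on the domain of $\Phi$ with values in $SO(m)$, $\mathbb{R}_+$ (strictly positive reals), $\mathbb{R}^m$. Composition: $T_2\circ T_1=(\Phi_2\circ\Phi_1,(B_2\circ\Phi_1)B_1,(\eta_2\circ\Phi_1)\eta_1,\sqrt{\eta_1}B_1^{-1}(h_2\circ\Phi_1)+h_1)$.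 The transformed SDE $E_T(\mu,\sigma)=(E_T(\mu),E_T(\sigma))$ is $$E_T(\mu)=\Big(\tfrac1\eta[L(\Phi)+\nabla\Phi\cdot\sigma\cdot h]\Big)\circ\Phi^{-1},\qquad E_T(\sigma)=\Big(\tfrac{1}{\sqrt\eta}\nabla\Phi\cdot\sigma\cdot B^{-1}\Big)\circ\Phi^{-1}.$$ An infinitesimal stochastic transformation is a quadruple $V=(Y,C,\tau,H)$ with $Y$ a smooth vector field on $M$ and $C:M\to\mathfrak{so}(m)$, $\tau:M\to\mathbb{R}$, $H:M\to\mathbb{R}^m$ smooth. It is an infinitesimal symmetry of $(\mu,\sigma)$ if and only if it is the derivative at $a=0$ of a one parameter group $T_a$, $a\in\mathbb{R}$, of stochastic transformations of $M$, and $$Y(\mu)-L(Y)-\sigma H+\tau\mu=0,\qquad [Y,\sigma]+\tfrac12\tau\sigma+\sigma C=0,$$ where $[Y,\sigma]^k_\alpha=Y^i\partial_i\sigma^k_\alpha-\sigma^i_\alpha\partial_iY^k$. (This is the known equivalent form of the requirement that each $T_a$ maps solution processes of the SDE to solution processes of the same SDE; it may be taken as the definition.) The Lie bracket is $$[V_1,V_2]=\Big([Y_1,Y_2],\ Y_1(C_2)-Y_2(C_1)-\{C_1,C_2\},\ Y_1(\tau_2)-Y_2(\tau_1),\ Y_1(H_2)-Y_2(H_1)-\big(-\tfrac{\tau_1}{2}+C_1\big)H_2+\big(-\tfrac{\tau_2}{2}+C_2\big)H_1\Big),$$ with $\{C_1,C_2\}=C_1C_2-C_2C_1$. Vector fields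 $Y_1,\dots,Y_r$ are regular on $M$ if $Y_1(x),\dots,Y_r(x)$ are linearly independent for every $x\in M$. An SDE $(\mu,\sigma)$ is triangular with respect to $(x^{r+1},\dots,x^n)$ if (i) for $j=r+1,\dots,n$ and all $\alpha=1,\dots,m$, $\mu^j$ and $\sigma^j_\alpha$ depend only on $(x^{r+1},\dots,x^n)$ (a void condition if $r=n$), and (ii) for $j\le r$ and all $\alpha$, $\mu^j$ and $\sigma^j_\alpha$ depend only on $(x^{j+1},\dots,x^n)$. *)

(* Defs.v *)
(* R^n is 'cV[R]_n.  A map given only on an open subset D of R^n is a total
   function on 'cV[R]_n, and every condition on it is restricted to D.
   Coordinates are indexed from 0: the informal x^j is coordinate j - 1. *)
From HB Require Import structures.
From mathcomp Require Import all_boot all_order all_algebra.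
From mathcomp Require Import all_classical all_reals all_analysis.
Set Implicit Arguments.
Unset Strict Implicit.
Unset Printing Implicit Defensive.
Import Order.TTheory GRing.Theory Num.Theory.
Import numFieldNormedType.Exports.

Local Open Scope classical_set_scope.
Local Open Scope ring_scope.

Section Calculus.
Context {R : realType} {n : nat}.
Implicit Types (D : set 'cV[R]_n) (f : 'cV[R]_n -> R).

Definition partial (k : 'I_n) f (x : 'cV[R]_n) : R :=
  'D_(delta_mx k ord0 : 'cV[R]_n) f x.

Fixpoint Ck (k : nat) D f : Prop :=
  (forall x, D x -> {for x, continuous f}) /\
  match k with
  | 0 => True
  | k'.+1 => forall i : 'I_n,
      (forall x, D x -> derivable f x (delta_mx i ord0)) /\
      Ck k' D (partial i f)
  end.

Definition smooth D f : Prop := forall k, Ck k D f.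

Definition smooth_mx p q D (F : 'cV[R]_n -> 'M[R]_(p, q)) : Prop :=
  forall i j, smooth D (fun x => F x i j).

Definition jacobian_mx p (F : 'cV[R]_n -> 'cV[R]_p) (x : 'cV[R]_n) :
    'M[R]_(p, n) :=
  \matrix_(i, k) partial k (fun y => F y i ord0) x.

Definition vf_app (Y : 'cV[R]_n -> 'cV[R]_n) f (x : 'cV[R]_n) : R :=
  \sum_k Y x k ord0 * partial k f x.

Definition vf_app_mx p q (Y : 'cV[R]_n -> 'cV[R]_n)
    (F : 'cV[R]_n -> 'M[R]_(p, q)) (x : 'cV[R]_n) : 'M[R]_(p, q) :=
  \matrix_(i, j) vf_app Y (fun y => F y i j) x.

Definition vf_bracket (Y1 Y2 : 'cV[R]_n -> 'cV[R]_n) (x : 'cV[R]_n) :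
    'cV[R]_n :=
  vf_app_mx Y1 Y2 x - vf_app_mx Y2 Y1 x.

(* [set_bij D D' Phi] makes the partial inverse ['pinv_] of the library a
   genuine inverse D' -> D of Phi. *)
Definition diffeomorphism D D' (Phi : 'cV[R]_n -> 'cV[R]_n) : Prop :=
  [/\ open D, open D', set_bij D D' Phi, smooth_mx D Phi &
      smooth_mx D' ('pinv_(fun=> 0) D Phi)].

Definition depends_only_on D (J : pred 'I_n) f : Prop :=
  forall x y, D x -> D y -> (forall k, J k -> x k ord0 = y k ord0) ->
  f x = f y.

End Calculus.

Record sde (R : realType) (n m : nat) := SDE {
  drift : 'cV[R]_n -> 'cV[R]_n;
  diffusion : 'cV[R]_n -> 'M[R]_(n, m) }.

Section SDEs.
Context {R : realType} {n m : nat}.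
Implicit Types (M : set 'cV[R]_n) (E : sde R n m).

Definition smooth_sde M E : Prop :=
  smooth_mx M (drift E) /\ smooth_mx M (diffusion E).

Definition generator E (f : 'cV[R]_n -> R) (x : 'cV[R]_n) : R :=
  2^-1 * (\sum_i \sum_j (diffusion E x *m (diffusion E x)^T) i j *
                         partial i (partial j f) x)
  + \sum_i drift E x i ord0 * partial i f x.

Definition generator_cv p E (F : 'cV[R]_n -> 'cV[R]_p) (x : 'cV[R]_n) :
    'cV[R]_p :=
  \col_i generator E (fun y => F y i ord0) x.

Definition triangular (D : set 'cV[R]_n) (r : nat) E : Prop :=
  forall j : 'I_n,
  let J : pred 'I_n := fun k => if (r <= j)%N then (r <= k)%N else (j < k)%N in
  depends_only_on D J (fun x => drift E x j ord0) /\
  forall a : 'I_m, depends_only_on D J (fun x => diffusion E x j a).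

End SDEs.

Section WeakSolutions.
Context {R : realType} {n m : nat}.
Context {d : measure_display} {Omega : measurableType d}.
Variable P : probability Omega R.

Definition filtration (F : R -> set (set Omega)) : Prop :=
  (forall t : R, 0 <= t ->
     sigma_algebra [set: Omega] (F t) /\ F t `<=` @measurable d Omega) /\
  (forall s t : R, 0 <= s -> s <= t -> F s `<=` F t).

(* The last clause says at once that W t - W s is independent of F s and that
   its law is the product of m copies of N(0, t - s); [normal_prob] takes the
   standard deviation as its parameter. *)
Definition brownian_motion (F : R -> set (set Omega))
    (W : R -> Omega -> 'cV[R]_m) : Prop :=
  [/\ {ae P, forall w, W 0 w = 0},
      forall w, {within `[0, +oo[%classic, continuous (fun t => W t w)},
      forall (t : R) (a : 'I_m) (B : set (measurableTypeR R)), 0 <= t ->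
        measurable B -> F t [set w | B (W t w a ord0)] &
      forall (s t : R) (A : set Omega) (B : 'I_m -> set (measurableTypeR R)),
        0 <= s -> s < t -> F s A -> (forall a, measurable (B a)) ->
        P (A `&` [set w | forall a, B a (W t w a ord0 - W s w a ord0)]) =
        (P A * \prod_(a < m) normal_prob 0 (Num.sqrt (t - s)) (B a))%E].

(* Left-endpoint sums of the i-th component of the stochastic integral of
   sigma(X) against W over [0, t], with N.+1 subintervals of equal length. *)
Definition ito_sum (sigma : 'cV[R]_n -> 'M[R]_(n, m))
    (X : R -> Omega -> 'cV[R]_n) (W : R -> Omega -> 'cV[R]_m)
    (t : R) (i : 'I_n) (N : nat) (w : Omega) : R :=
  let s k := t * k%:R / N.+1%:R in
  \sum_(k < N.+1) \sum_a
    sigma (X (s k) w) i a * (W (s k.+1) w a ord0 - W (s k) w a ord0).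

(* X solves the SDE in M on the stochastic interval [0, zeta), zeta > 0 being
   a stopping time.  For an integrand that is continuous and adapted up to
   zeta, the Ito integral over [0, t] is, on the event {t < zeta}, the limit in
   probability of its left-endpoint sums; the equation is stated in that form. *)
Record local_solution (M : set 'cV[R]_n) (E : sde R n m)
    (F : R -> set (set Omega)) (W : R -> Omega -> 'cV[R]_m)
    (zeta : Omega -> \bar R) (X : R -> Omega -> 'cV[R]_n) : Prop := {
  lifetime_gt0 : forall w, (0 < zeta w)%E;
  lifetime_stopping : forall t : R, 0 <= t -> F t [set w | (zeta w <= t%:E)%E];
  solution_in : forall w (t : R), 0 <= t -> (t%:E < zeta w)%E -> M (X t w);
  solution_continuous : forall w,
    {within [set t : R | 0 <= t /\ (t%:E < zeta w)%E], continuous (fun t => X t w)};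
  solution_adapted : forall (t : R) (i : 'I_n) (B : set (measurableTypeR R)),
    0 <= t -> measurable B ->
    F t [set w | (t%:E < zeta w)%E /\ B (X t w i ord0)];
  solution_equation : forall (t : R) (i : 'I_n) (e : R), 0 <= t -> 0 < e ->
    (fun N => P [set w | (t%:E < zeta w)%E /\
       e <= `| X t w i ord0 - X 0 w i ord0
               - (\int[lebesgue_measure]_(s in `[0%R, t])
                    drift E (X s w) i ord0)
               - ito_sum (diffusion E) X W t i N w |]) @ \oo --> 0%E }.

(* The solution cannot be continued beyond zeta: where zeta is finite, X
   leaves every compact subset of M for good before zeta. *)
Definition maximal_lifetime (M : set 'cV[R]_n) (zeta : Omega -> \bar R)
    (X : R -> Omega -> 'cV[R]_n) : Prop :=
  forall K : set 'cV[R]_n, compact K -> K `<=` M ->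
  {ae P, forall w, (zeta w < +oo)%E ->
     exists t0 : R, (t0%:E < zeta w)%E /\
       forall t : R, 0 <= t -> t0 < t -> (t%:E < zeta w)%E -> ~ K (X t w)}.

End WeakSolutions.

Definition non_explosive (R : realType) (n m : nat) (M : set 'cV[R]_n)
    (E : sde R n m) : Prop :=
  forall (d : measure_display) (Omega : measurableType d)
    (P : probability Omega R) (F : R -> set (set Omega))
    (W : R -> Omega -> 'cV[R]_m) (zeta : Omega -> \bar R)
    (X : R -> Omega -> 'cV[R]_n),
  filtration F -> brownian_motion P F W ->
  local_solution P M E F W zeta X -> maximal_lifetime P M zeta X ->
  {ae P, forall w, zeta w = +oo%E}.

Record stoch_transf (R : realType) (n m : nat) := StochTransf {
  st_Phi : 'cV[R]_n -> 'cV[R]_n;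
  st_B : 'cV[R]_n -> 'M[R]_m;
  st_eta : 'cV[R]_n -> R;
  st_h : 'cV[R]_n -> 'cV[R]_m }.

Section StochasticTransformations.
Context {R : realType} {n m : nat}.
Implicit Types (D : set 'cV[R]_n) (T : stoch_transf R n m) (E : sde R n m).

Definition special_orthogonal (B : 'M[R]_m) : Prop :=
  B *m B^T = 1%:M /\ \det B = 1.

Definition is_stoch_transf D D' T : Prop :=
  [/\ diffeomorphism D D' (st_Phi T),
      smooth_mx D (st_B T) /\ (forall x, D x -> special_orthogonal (st_B T x)),
      smooth D (st_eta T) /\ (forall x, D x -> 0 < st_eta T x) &
      smooth_mx D (st_h T)].

Definition st_eq_on D T1 T2 : Prop :=
  forall x, D x ->
  [/\ st_Phi T1 x = st_Phi T2 x, st_B T1 x = st_B T2 x,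
      st_eta T1 x = st_eta T2 x & st_h T1 x = st_h T2 x].

Definition st_id : stoch_transf R n m :=
  StochTransf (fun x => x) (fun=> 1%:M) (fun=> 1) (fun=> 0).

Definition st_comp T2 T1 : stoch_transf R n m :=
  StochTransf
    (fun x => st_Phi T2 (st_Phi T1 x))
    (fun x => st_B T2 (st_Phi T1 x) *m st_B T1 x)
    (fun x => st_eta T2 (st_Phi T1 x) * st_eta T1 x)
    (fun x => Num.sqrt (st_eta T1 x) *:
                (invmx (st_B T1 x) *m st_h T2 (st_Phi T1 x)) + st_h T1 x).

(* [D] is the domain of [T]; the result is meaningful on its image. *)
Definition transformed_sde D T E : sde R n m :=
  let Psi := 'pinv_(fun=> 0) D (st_Phi T) in
  SDE
    (fun y => let x := Psi y in
       (st_eta T x)^-1 *: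
         (generator_cv E (st_Phi T) x +
          jacobian_mx (st_Phi T) x *m diffusion E x *m st_h T x))
    (fun y => let x := Psi y in
       (Num.sqrt (st_eta T x))^-1 *:
         (jacobian_mx (st_Phi T) x *m diffusion E x *m invmx (st_B T x))).

Definition one_parameter_group D (T : R -> stoch_transf R n m) : Prop :=
  [/\ forall a, is_stoch_transf D D (T a),
      st_eq_on D (T 0) st_id &
      forall a b, st_eq_on D (T (a + b)) (st_comp (T a) (T b))].

End StochasticTransformations.

Record inf_transf (R : realType) (n m : nat) := InfTransf {
  it_Y : 'cV[R]_n -> 'cV[R]_n;
  it_C : 'cV[R]_n -> 'M[R]_m;
  it_tau : 'cV[R]_n -> R;
  it_H : 'cV[R]_n -> 'cV[R]_m }.

Section InfinitesimalTransformations.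
Context {R : realType} {n m : nat}.
Implicit Types (M : set 'cV[R]_n) (V : inf_transf R n m) (E : sde R n m).

Definition is_inf_transf M V : Prop :=
  [/\ smooth_mx M (it_Y V),
      smooth_mx M (it_C V) /\ (forall x, M x -> (it_C V x)^T = - it_C V x),
      smooth M (it_tau V) &
      smooth_mx M (it_H V)].

Definition generates M V (T : R -> stoch_transf R n m) : Prop :=
  forall x, M x ->
  [/\ is_derive (0 : R) (1 : R) (fun a => st_Phi (T a) x) (it_Y V x),
      is_derive (0 : R) (1 : R) (fun a => st_B (T a) x) (it_C V x),
      is_derive (0 : R) (1 : R) (fun a => st_eta (T a) x) (it_tau V x) &
      is_derive (0 : R) (1 : R) (fun a => st_h (T a) x) (it_H V x)].

Definition vf_diffusion_bracket (Y : 'cV[R]_n -> 'cV[R]_n)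
    (sigma : 'cV[R]_n -> 'M[R]_(n, m)) (x : 'cV[R]_n) : 'M[R]_(n, m) :=
  \matrix_(k, a)
    (\sum_i Y x i ord0 * partial i (fun y => sigma y k a) x -
     \sum_i sigma x i a * partial i (fun y => Y y k ord0) x).

Definition determining_equations M E V : Prop :=
  forall x, M x ->
  vf_app_mx (it_Y V) (drift E) x - generator_cv E (it_Y V) x
    - diffusion E x *m it_H V x + it_tau V x *: drift E x = 0 /\
  vf_diffusion_bracket (it_Y V) (diffusion E) x
    + (2^-1 * it_tau V x) *: diffusion E x
    + diffusion E x *m it_C V x = 0.

Definition inf_symmetry M E V : Prop :=
  [/\ is_inf_transf M V,
      exists T, one_parameter_group M T /\ generates M V T &
      determining_equations M E V].

Definition it_bracket (V1 V2 : inf_transf R n m) : inf_transf R n m :=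
  let Y1 := it_Y V1 in let C1 := it_C V1 in
  let tau1 := it_tau V1 in let H1 := it_H V1 in
  let Y2 := it_Y V2 in let C2 := it_C V2 in
  let tau2 := it_tau V2 in let H2 := it_H V2 in
  InfTransf
    (vf_bracket Y1 Y2)
    (fun x => vf_app_mx Y1 C2 x - vf_app_mx Y2 C1 x
              - (C1 x *m C2 x - C2 x *m C1 x))
    (fun x => vf_app Y1 tau2 x - vf_app Y2 tau1 x)
    (fun x => vf_app_mx Y1 H2 x - vf_app_mx Y2 H1 x
              - ((- (tau1 x / 2))%:M + C1 x) *m H2 x
              + ((- (tau2 x / 2))%:M + C2 x) *m H1 x).

Definition it_eq_on M (V1 V2 : inf_transf R n m) : Prop :=
  forall x, M x ->
  [/\ it_Y V1 x = it_Y V2 x, it_C V1 x = it_C V2 x,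
      it_tau V1 x = it_tau V2 x & it_H V1 x = it_H V2 x].

Definition it_zero : inf_transf R n m :=
  InfTransf (fun=> 0) (fun=> 0) (fun=> 0) (fun=> 0).

Definition it_lincomb k (c : 'I_k -> R) (V : 'I_k -> inf_transf R n m) :
    inf_transf R n m :=
  InfTransf
    (fun x => \sum_i c i *: it_Y (V i) x)
    (fun x => \sum_i c i *: it_C (V i) x)
    (fun x => \sum_i c i * it_tau (V i) x)
    (fun x => \sum_i c i *: it_H (V i) x).

(* Infinitesimal transformations of M are identified when they agree on M. *)
Definition it_span M (S : set (inf_transf R n m)) : set (inf_transf R n m) :=
  [set V | exists k (c : 'I_k -> R) (W : 'I_k -> inf_transf R n m),
     (forall i, S (W i)) /\ it_eq_on M V (it_lincomb c W)].

Fixpoint derived_series M (g : set (inf_transf R n m)) (k : nat) :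
    set (inf_transf R n m) :=
  if k is k'.+1 then
    it_span M [set Z | exists V1 V2, [/\ derived_series M g k' V1,
                         derived_series M g k' V2 & Z = it_bracket V1 V2]]
  else g.

Definition lie_subalgebra (g : set (inf_transf R n m)) : Prop :=
  forall V1 V2, g V1 -> g V2 -> g (it_bracket V1 V2).

Definition solvable_lie M (g : set (inf_transf R n m)) : Prop :=
  exists k, forall V, derived_series M g k V -> it_eq_on M V it_zero.

Definition regular_vf r M (Y : 'I_r -> 'cV[R]_n -> 'cV[R]_n) : Prop :=
  forall x, M x -> free [tuple Y i x | i < r].

End InfinitesimalTransformations.

(* Main.v *)
(* On R^n x R^(m+1) a quadruple V = (Y, C, tau, H) acts as the vector field
   (Y(x), A(x) z) with A = [[C, -H], [0, tau/2]], and the bracket of quadruples becomes the bracket of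
   these fields.  Since the Lie algebra is solvable, its derived series gives a basis W_1, ..., W_r
   such that [W_i, W_l] is a combination of the W_p with p < max(i, l).  Composing the flows of the
   corresponding fields in this order produces a chart P such that W_i P^k = delta_ik for k >= i.  The
   first n components of P at z = 0 are the diffeomorphism Phi.  The z-derivative Q of the last m + 1
   components satisfies W_i Q = - Q A_i and Q = 1 on a slice transverse to the Y_i, and is therefore of
   the form [[B, s], [0, k]] with B orthogonal; put eta = k^2 and h = - B^T s.
   With this choice the determining equations say that Y_i commutes with eta^-1 (L + h . sigma) and
   with eta^(-1/2) sigma B^-1.  As Y_i Phi^j is constant for i <= j, the j-th coefficients of the
   transformed SDE are annihilated by Y_1, ..., Y_j, hence do not depend on the first j coordinates. *)
Require Import Defs.
From HB Require Import structures.
From mathcomp Require Import all_boot all_order all_algebra.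
From mathcomp Require Import all_classical all_reals all_analysis.
From mathcomp Require Import ring lra zify.
Set Implicit Arguments.
Unset Strict Implicit.
Unset Printing Implicit Defensive.
Import Order.TTheory GRing.Theory Num.Theory.
Import numFieldNormedType.Exports.

Local Open Scope classical_set_scope.
Local Open Scope ring_scope.

(** * Calculus on open subsets of R^n *)

Section Calculus.
Context {R : realType}.

(** The matrix A has a known origin. Attach to (Phi, B, eta, h) the matrix Q = [[B, -B h],
    [0, sqrt eta]]: the composition law becomes Q(x) = Q2(Phi1 x) Q1(x), and A is the derivative of
    this matrix at the identity. Conjugation of a one parameter group by T replaces A by (W Q + Q A)
    Q^-1, so W_i Q = - Q A_i asks that T remove the C, tau and H parts of all symmetries at once.
    This overdetermined system is not integrated directly: it is the z-derivative, at z = 0, of the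
    identities satisfied by the last components of the chart, and its compatibility is contained in
    the brackets of the extended fields. The W_i need not commute, so they cannot all become
    coordinate fields; only the W_i P^k with k >= i are controlled. A triangular form asks for no
    more, and the derived series gives this much over the reals, where the adjoint action may lack
    eigenvectors. The lower left block of Q is not 0 by construction; that it vanishes, like the
    orthogonality of B, follows from the skew-symmetry of C and from Q = 1 on the slice. *)

Lemma cv_norm_leP n (v : 'cV[R]_n) (c : R) :
  0 <= c -> (`|v| <= c) <-> (forall i, `|v i ord0| <= c).
Proof.
move=> c0; rewrite [`|v|]/Num.Def.normr /= mx_normrE; split=> [h i|h].
  exact: (le_trans (le_bigmax _ (fun ij => `|v ij.1 ij.2|) (i, ord0)) h).
by apply: bigmax_le => // -[i j] _ /=; rewrite ord1.
Qed.

Lemma cv_coord_le n (v : 'cV[R]_n) i : `|v i ord0| <= `|v|.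
Proof. by have /cv_norm_leP := lexx `|v|; apply. Qed.

Lemma cv_norm_ltP n (v : 'cV[R]_n) (c : R) :
  0 < c -> (`|v| < c) <-> (forall i, `|v i ord0| < c).
Proof.
move=> c0; rewrite [`|v|]/Num.Def.normr /= mx_normrE; split=> [h i|h].
  exact: (le_lt_trans (le_bigmax _ (fun ij => `|v ij.1 ij.2|) (i, ord0)) h).
by apply: bigmax_lt => // -[i j] _ /=; rewrite ord1.
Qed.

Lemma cont_edP (V W : normedModType R) (f : V -> W) (x : V) :
  {for x, continuous f} <->
  forall e : R, 0 < e -> exists2 d : R, 0 < d & forall y : V, `|y - x| < d -> `|f y - f x| < e.
Proof.
split=> [/cvgrPdist_lt h e e0|h].
  have /nbhs_normP[d d0 hd] := h e e0; exists d => // y yx.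
  by rewrite distrC; apply: hd; rewrite /= distrC.
apply/cvgrPdist_lt => e /h[d d0 hd]; apply/nbhs_normP; exists d => // y /=.
by rewrite distrC => /hd; rewrite distrC.
Qed.

Lemma open_edP (V : normedModType R) (D : set V) :
  open D <-> forall x : V, D x -> exists2 d : R, 0 < d & forall y : V, `|y - x| < d -> D y.
Proof.
rewrite openE; split=> h x /h.
  move=> /nbhs_normP[d d0 hd]; exists d => // y yx.
  by apply: hd; rewrite /= distrC.
move=> [d d0 hd]; apply/nbhs_normP; exists d => // y /=.
by rewrite distrC => /hd.
Qed.

Lemma open_norm_ball (V : normedModType R) (x0 : V) (e : R) : open [set x : V | `|x - x0| < e].
Proof.
apply/open_edP => x xe; exists (e - `|x - x0|); first by rewrite subr_gt0.
move=> y yx /=; rewrite -(subrKA x); apply: le_lt_trans (ler_normD _ _) _.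
by rewrite -ltrBrDr.
Qed.

Lemma open_near (V : normedModType R) (D : set V) (P : V -> Prop) x :
  open D -> D x -> (forall y, D y -> P y) -> \near x, P x.
Proof. by move=> oD Dx h; apply: filterS (open_nbhs_nbhs (conj oD Dx)). Qed.

Lemma cont_near_eq (V W : topologicalType) (f g : V -> W) (x : V) :
  (\near x, f x = g x) -> {for x, continuous f} -> {for x, continuous g}.
Proof.
move=> fg; rewrite /prop_for /continuous_at -(nbhs_singleton fg).
by apply: cvg_trans; apply: near_eq_cvg.
Qed.

(** Clearing the denominator of the difference quotient gives an estimate that also holds at h = 0;
    the comparison of solutions of differential equations is carried out in this form. *)
Lemma is_derive_edP (V : normedModType R) (f : V -> R) x v L :
  is_derive x v f L <->
  forall e : R, 0 < e -> exists2 d : R, 0 < d &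
    forall h : R, `|h| < d -> `|f (x + h *: v) - f x - h * L| <= e * `|h|.
Proof.
split=> [[df <-] e e0|H].
  have /cvgrPdist_le/(_ e e0)[d /= d0 hd] : (fun h => h^-1 *: ((f \o shift x) (h *: v) - f x)) @ 0^' -->
      'D_v f x by [].
  exists d => // h hl; have [->|h0] := eqVneq h 0.
    by rewrite scale0r addr0 subrr mul0r subrr !normr0 mulr0.
  have := hd h; rewrite /= sub0r normrN => /(_ hl h0); rewrite distrC [h *: v + x]addrC.
  move=> h1; rewrite -ler_pdivrMr ?normr_gt0 //.
  rewrite -normfV -normrM; apply: le_trans h1.
  by rewrite [_ * h^-1]mulrC mulrBr mulKf.
have H2 : (fun h => h^-1 *: ((f \o shift x) (h *: v) - f x)) @ 0^' --> L.
  apply/cvgrPdist_le => e /H[d d0 hd]; exists d => // h /=.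
  rewrite sub0r normrN => /hd h1 h0.
  rewrite distrC [h *: v + x]addrC -(@ler_pM2r _ `|h|) ?normr_gt0 //.
  rewrite -normrM mulrBl [_ *: _]mulrC mulfVK // [L * h]mulrC //.
split; first by apply/cvg_ex; exists L.
exact/cvg_lim.
Qed.

Lemma line_is_derive (V : normedModType R) (f : V -> R) x v t :
  derivable f (x + t *: v) v ->
  is_derive t 1 (fun s : R => f (x + s *: v)) ('D_v f (x + t *: v)).
Proof.
move=> /derivableP /is_derive_edP h; apply/is_derive_edP => e /h[d d0 hd].
by exists d => // k /hd; rewrite scalerDl addrA [k%:A]mulr1.
Qed.

(** The increment is based at 0 and t may have either sign; [Num.min] and [Num.max] treat both cases
    at once. *)
Lemma mvt0 (g dg : R -> R) (t : R) :
  (forall s : R, Num.min 0 t <= s <= Num.max 0 t -> is_derive s 1 g (dg s)) ->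
  exists2 c : R, Num.min 0 t <= c <= Num.max 0 t & g t - g 0 = dg c * t.
Proof.
have [t0|/ltW t0] := leP 0 t; rewrite ?min_l ?max_r ?(min_r t0) ?(max_l t0) // => h.
  have [] := @MVT_segment R g dg 0 t t0.
  - move=> x; rewrite in_itv /= => /andP[a b]; apply: h; rewrite !ltW //.
  - apply: derivable_within_continuous => x; rewrite in_itv /= => /h hx.
    by apply: ex_derive.
  by move=> c; rewrite in_itv /= subr0 => ch e; exists c.
have [] := @MVT_segment R g dg t 0 t0.
- move=> x; rewrite in_itv /= => /andP[a b]; apply: h; rewrite !ltW //.
- apply: derivable_within_continuous => x; rewrite in_itv /= => /h hx.
  by apply: ex_derive.
move=> c; rewrite in_itv /= sub0r mulrN => ch e; exists c => //.
by rewrite -opprB e opprK.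
Qed.

(** Partial derivatives alone do not compose. The chain rule needs differentiability in this total
    form, which [C1_frechet] provides for functions of class C^1. *)
Definition frechet n (f : 'cV[R]_n -> R) (x : 'cV[R]_n) (a : 'I_n -> R) := forall e : R, 0 < e ->
  exists2 d : R, 0 < d & forall y : 'cV[R]_n, `|y - x| < d ->
    `|f y - f x - \sum_i a i * (y - x) i ord0| <= e * `|y - x|.

Lemma sum_le_norm n (a : 'I_n -> R) (v : 'cV[R]_n) :
  `|\sum_i a i * v i ord0| <= (\sum_i `|a i|) * `|v|.
Proof.
rewrite mulr_suml; apply: le_trans (ler_norm_sum _ _ _) _.
by apply: ler_sum => i _; rewrite normrM ler_wpM2l // cv_coord_le.
Qed.

Lemma frechet_derive n (f : 'cV[R]_n -> R) x a v :
  frechet f x a -> is_derive x v f (\sum_i a i * v i ord0).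
Proof.
move=> fa; apply/is_derive_edP => e e0.
have v1 : 0 < `|v| + 1 by rewrite ltr_wpDl.
have [|d d0 hd] := fa (e / (`|v| + 1)); first by rewrite divr_gt0.
exists (d / (`|v| + 1)); first by rewrite divr_gt0.
move=> h hl.
have hv : `|h *: v| <= `|h| * (`|v| + 1) by rewrite normrZ ler_wpM2l // lerDl.
have : `|x + h *: v - x| < d.
  by rewrite addrC addKr (le_lt_trans hv) // -ltr_pdivlMr.
move=> /hd; rewrite [x + _]addrC addrK.
under eq_bigr do rewrite mxE mulrCA.
rewrite -mulr_sumr => /le_trans; apply.
by rewrite mulrAC ler_pdivrMr // -mulrA ler_wpM2l // ltW.
Qed.

Lemma frechet_partial n (f : 'cV[R]_n -> R) x a k :
  frechet f x a -> partial k f x = a k.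
Proof.
move=> /(frechet_derive (delta_mx k ord0))[_]; rewrite /partial => ->.
rewrite (bigD1 k) //= mxE !eqxx mulr1 big1 ?addr0 // => i ik.
by rewrite mxE (negbTE ik) mulr0.
Qed.

Lemma frechet_lip n (f : 'cV[R]_n -> R) (x : 'cV[R]_n) a : frechet f x a ->
  exists2 d : R, 0 < d & forall y : 'cV[R]_n, `|y - x| < d ->
    `|f y - f x| <= (1 + \sum_i `|a i|) * `|y - x|.
Proof.
move=> /(_ 1 ltr01)[d d0 hd]; exists d => // y /hd h.
rewrite -[f y - f x](subrK (\sum_i a i * (y - x) i ord0)).
rewrite (le_trans (ler_normD _ _)) // mulrDl lerD // sum_le_norm //.
Qed.

Lemma frechet_comp n p (f : 'cV[R]_p -> R) (G : 'cV[R]_n -> 'cV[R]_p) x a A :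
  frechet f (G x) a -> (forall i, frechet (fun y => G y i ord0) x (A i)) ->
  frechet (fun y => f (G y)) x (fun k => \sum_i a i * A i k).
Proof.
move=> fa GA e e0.
(* [C] dominates the local Lipschitz constants of all coordinates of G; the leading 1 keeps it
   positive when there are no coordinates. *)
pose C := 1 + \sum_i (1 + \sum_k `|A i k|).
have CiP i : 1 + \sum_k `|A i k| <= C.
  rewrite /C (bigD1 i) //= addrCA lerDl addr_ge0 // sumr_ge0 // => l _.
  by rewrite addr_ge0 // sumr_ge0.
have C0 : 0 < C by rewrite ltr_wpDr // sumr_ge0 // => l _; rewrite addr_ge0 // sumr_ge0.
have [d1 d10 h1] : exists2 d : R, 0 < d & forall y : 'cV[R]_n, `|y - x| < d -> `|G y - G x| <= C * `|y - x|.
  have : forall i, exists d : R, 0 < d /\ forall y, `|y - x| < d -> `|G y i ord0 - G x i ord0| <= C * `|y - x|.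
    move=> i; have [d d0 hd] := frechet_lip (GA i); exists d; split=> // y /hd /le_trans; apply.
    by rewrite ler_wpM2r.
  move=> /choice[d hd].
  exists (\big[Num.min/1]_i d i).
    by apply: lt_bigmin => // i _; have [] := hd i.
  move=> y yx; apply/cv_norm_leP; first by rewrite mulr_ge0 // ltW.
  move=> i; rewrite !mxE; have [_] := hd i; apply.
  by apply: lt_le_trans yx _; exact: bigmin_le.
pose S := 1 + \sum_i `|a i|.
have S0 : 0 < S by rewrite ltr_wpDr // sumr_ge0.
have [|d2 d20 h2] := fa (e / 2 / C); first by rewrite !divr_gt0.
have [d3 d30 h3] : exists2 d : R, 0 < d & forall y : 'cV[R]_n, `|y - x| < d -> forall i,
    `|G y i ord0 - G x i ord0 - \sum_k A i k * (y - x) k ord0| <= e / 2 / S * `|y - x|.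
  have : forall i, exists d : R, 0 < d /\ forall y, `|y - x| < d ->
    `|G y i ord0 - G x i ord0 - \sum_k A i k * (y - x) k ord0| <= e / 2 / S * `|y - x|.
    move=> i; have [|d d0 hd] := GA i (e / 2 / S); first by rewrite !divr_gt0.
    by exists d.
  move=> /choice[d hd].
  exists (\big[Num.min/1]_i d i).
    by apply: lt_bigmin => // i _; have [] := hd i.
  move=> y yx i; have [_] := hd i; apply.
  by apply: lt_le_trans yx _; exact: bigmin_le.
exists (Num.min d1 (Num.min (d2 / C) d3)).
  by rewrite !lt_min d10 d30 divr_gt0.
move=> y; rewrite !lt_min => /and3P[y1 y2 y3].
have e1 : \sum_k (\sum_i a i * A i k) * (y - x) k ord0 =
   \sum_i a i * \sum_k A i k * (y - x) k ord0.
  under eq_bigr do rewrite mulr_suml.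
  rewrite exchange_big /=; apply: eq_bigr => i _; rewrite mulr_sumr.
  by apply: eq_bigr => k _; rewrite mulrA.
rewrite {}e1.
have /h2 : `|G y - G x| < d2.
  by rewrite (le_lt_trans (h1 _ y1)) // mulrC -ltr_pdivlMr.
set s1 := \sum_i _ => H1; set s2 := \sum_i _.
(* The error is that of f at G x, controlled by |G y - G x| <= C |y - x|, plus the gradient of f
   applied to the errors of the coordinates of G. *)
rewrite -[_ - s2](subrK (s1 - s2)) (splitr e) mulrDl.
rewrite (le_trans (ler_normD _ _)) // lerD //.
  rewrite opprB addrA subrK.
  apply: le_trans H1 _.
  rewrite -mulrA ler_wpM2l ?divr_ge0 ?(ltW e0) // mulrC ler_pdivrMr // mulrC.
  exact: h1.
rewrite /s1 /s2 -sumrB; under eq_bigr do rewrite -mulrBr.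
apply: le_trans (ler_norm_sum _ _ _) _.
apply: (@le_trans _ _ ((\sum_i `|a i|) * (e / 2 / S * `|y - x|))).
  rewrite mulr_suml; apply: ler_sum => i _; rewrite normrM ler_wpM2l //.
  by have := h3 _ y3 i; rewrite !mxE.
rewrite (_ : _ * _ = ((\sum_i `|a i|) / S) * (e / 2 * `|y - x|)); last by ring.
apply: ler_piMl; first by rewrite mulr_ge0 // ltW // divr_gt0.
by rewrite ler_pdivrMr // mul1r lerDr.
Qed.

(** The path from z to z' changes one coordinate at a time, and the mean value theorem applies to
    each leg. In the sup norm all intermediate points stay in the ball. With a = 0 this is a
    Lipschitz bound, with a the gradient at x a Taylor estimate. *)
Lemma partial_mvt n (f : 'cV[R]_n -> R) (x z z' : 'cV[R]_n) (d : R) (a : 'I_n -> R) (e : R) :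
  (forall y : 'cV[R]_n, `|y - x| < d -> forall i,
     derivable f y (delta_mx i ord0) /\ `|partial i f y - a i| <= e) ->
  `|z - x| < d -> `|z' - x| < d ->
  `|f z' - f z - \sum_i a i * (z' - z) i ord0| <= n%:R * e * `|z' - z|.
Proof.
move=> H zx z'x.
have d0 : 0 < d by apply: le_lt_trans zx.
pose mix k : 'cV[R]_n := \col_i if (i < k)%N then z' i ord0 else z i ord0.
have -> : f z' - f z = \sum_(k < n) (f (mix k.+1) - f (mix k)).
  rewrite -(big_mkord xpredT (fun k => f (mix k.+1) - f (mix k))) telescope_sumr //.
  by congr (f _ - f _); apply/colP => i; rewrite !mxE ?ltn_ord.
rewrite -sumrB; apply: le_trans (ler_norm_sum _ _ _) _.
have -> : n%:R * e * `|z' - z| = \sum_(i < n) e * `|z' - z|.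
  by rewrite sumr_const card_ord -mulrA mulr_natl.
apply: ler_sum => k _.
pose t := z' k ord0 - z k ord0.
have mixS : mix k.+1 = mix k + t *: delta_mx k ord0.
  apply/colP => i; rewrite !mxE eqxx andbT ltnS.
  have [->|ik] := eqVneq i k; first by rewrite leqnn ltnn mulr1 /t addrC subrK.
  by rewrite mulr0 addr0 ltn_neqAle ik.
have mixd (s : R) : Num.min 0 t <= s <= Num.max 0 t -> `|mix k + s *: delta_mx k ord0 - x| < d.
  move=> hs; apply/cv_norm_ltP => // i; rewrite !mxE eqxx andbT.
  move/(cv_norm_ltP _ d0) : zx => /(_ i); rewrite !mxE => zx.
  move/(cv_norm_ltP _ d0) : z'x => /(_ i); rewrite !mxE => z'x.
  have [ik|ik] := eqVneq i k; last by rewrite mulr0 addr0; case: ifP.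
  rewrite mulr1 ik ltnn.
  move: zx z'x hs; rewrite ik /t !ltr_norml => /andP[z1 z2] /andP[z3 z4].
  by case: (leP 0 (z' k ord0 - z k ord0)) => _ /andP[? ?]; apply/andP; split; lra.
have [|c /mixd/H/(_ k)[_ hc]] := @mvt0 (fun s => f (mix k + s *: delta_mx k ord0))
   (fun s => partial k f (mix k + s *: delta_mx k ord0)) t.
  by move=> s /mixd/H/(_ k)[dk _]; apply: line_is_derive.
rewrite -mixS scale0r addr0 => ->.
have -> : (z' - z) k ord0 = t by rewrite !mxE.
rewrite -mulrBl normrM ler_pM //.
by have := cv_coord_le (z' - z) k; rewrite !mxE.
Qed.

Lemma C1_frechet n (D : set 'cV[R]_n) f x : open D -> Ck 1 D f -> D x ->
  frechet f x (fun i => partial i f x).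
Proof.
move=> oD [_ C1] Dx e e0.
(* Division by n + 1 instead of n covers n = 0. *)
have n1 : 0 < n%:R + 1 :> R by rewrite ltr_wpDl.
have [d d0 hd] : exists2 d : R, 0 < d & forall y : 'cV[R]_n, `|y - x| < d -> forall i,
     derivable f y (delta_mx i ord0) /\ `|partial i f y - partial i f x| <= e / (n%:R + 1).
  have [d1 d10 h1] := (open_edP D).1 oD x Dx.
  have : forall i, exists d : R, 0 < d /\ forall y : 'cV[R]_n, `|y - x| < d ->
     `|partial i f y - partial i f x| < e / (n%:R + 1).
    move=> i; have [_ [Ci _]] := C1 i.
    have [|d d0 hd] := (cont_edP _ _).1 (Ci x Dx) (e / (n%:R + 1)); first by rewrite divr_gt0.
    by exists d.
  move=> /choice[d hd]; exists (Num.min d1 (\big[Num.min/1]_i d i)).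
    by rewrite lt_min d10; apply: lt_bigmin => // i _; have [] := hd i.
  move=> y; rewrite lt_min => /andP[y1 y2] i; split.
    by have [+ _] := C1 i; apply; exact: h1.
  have [_ h2] := hd i; apply/ltW/h2.
  by apply: lt_le_trans y2 _; exact: bigmin_le.
exists d => // y yx.
have xx : `|x - x| < d by rewrite subrr normr0.
apply: le_trans (partial_mvt hd xx yx) _.
by rewrite ler_wpM2r // mulrA ler_pdivrMr // mulrC ler_wpM2l ?ltW // ltrDl.
Qed.

(** * Functions of class C^k *)

Section CkTheory.
Context {n : nat}.
Implicit Types (D : set 'cV[R]_n) (f g : 'cV[R]_n -> R).

Lemma Ck_cont k D f x : Ck k D f -> D x -> {for x, continuous f}.
Proof. by case: k => [|k] [h _] /h. Qed.

Lemma Ck_subset k D D' f : D' `<=` D -> Ck k D f -> Ck k D' f.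
Proof.
move=> D'D; elim: k f => [|k IH] f [h1 h2]; split=> //; first by move=> x /D'D/h1.
  by move=> x /D'D/h1.
move=> i; have [h3 h4] := h2 i; split; first by move=> x /D'D/h3.
exact: IH.
Qed.

Lemma Ck_le k l D f : (k <= l)%N -> Ck l D f -> Ck k D f.
Proof.
elim: k l f => [|k IH] [|l] f // kl [h1 h2]; split=> //.
by move=> i; have [h3 h4] := h2 i; split=> //; apply: IH h4.
Qed.

Lemma near_eq_on (W : Type) D (f g : 'cV[R]_n -> W) x :
  open D -> D x -> {in D, f =1 g} -> \near x, f x = g x.
Proof. by move=> oD Dx fg; apply: open_near oD Dx _ => y Dy; apply: fg; rewrite inE. Qed.

Lemma partial_ext D f g x i : open D -> D x -> {in D, f =1 g} ->
  partial i f x = partial i g x.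
Proof. by move=> oD Dx fg; apply/near_eq_derive/(near_eq_on oD Dx fg). Qed.

Lemma Ck_ext k D f g : open D -> {in D, f =1 g} -> Ck k D f -> Ck k D g.
Proof.
move=> oD; elim: k f g => [|k IH] f g fg [h1 h2].
  by split=> // x Dx; apply: cont_near_eq (near_eq_on oD Dx fg) (h1 x Dx).
split=> [x Dx|i].
  by apply: cont_near_eq (near_eq_on oD Dx fg) (h1 x Dx).
have [h3 h4] := h2 i; split=> [x Dx|].
  by apply: near_eq_derivable (h3 x Dx); exact: near_eq_on oD Dx fg.
apply: IH h4 => x; rewrite inE => Dx; exact: partial_ext oD Dx fg.
Qed.

Lemma partial_cst i (c : R) x : partial i (fun=> c) (x : 'cV[R]_n) = 0.
Proof. exact: derive_cst. Qed.

Lemma Ck_cst k D (c : R) : Ck k D (fun=> c).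
Proof.
elim: k c => [|k IH] c; split=> //; do ?by move=> x _; exact: cst_continuous.
move=> i; split; first by move=> x _; exact: derivable_cst.
rewrite (_ : partial i _ = fun=> 0) //; apply/funext => x; exact: partial_cst.
Qed.

Lemma frechet_coord (i : 'I_n) x :
  frechet (fun y : 'cV[R]_n => y i ord0) x (fun k => (k == i)%:R).
Proof.
move=> e e0; exists 1 => // y _.
rewrite (bigD1 i) //= eqxx mul1r big1; last by move=> j /negbTE ->; rewrite mul0r.
by rewrite !mxE addr0 subrr normr0 mulr_ge0 // ltW.
Qed.

Lemma partial_coord k (i : 'I_n) x :
  partial k (fun y : 'cV[R]_n => y i ord0) x = (k == i)%:R.
Proof. exact: frechet_partial (frechet_coord i x). Qed.

Lemma Ck_coord k D (i : 'I_n) : Ck k D (fun y => y i ord0).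
Proof.
have c x : {for x, continuous (fun y : 'cV[R]_n => y i ord0)} by exact: coord_continuous.
case: k => [|k]; split=> // j; split.
  by move=> x _; have [] := frechet_derive (delta_mx j ord0) (frechet_coord i x).
rewrite (_ : partial j _ = fun=> (j == i)%:R); first exact: Ck_cst.
by apply/funext => x; exact: partial_coord.
Qed.

Lemma partialD i f g x : derivable f x (delta_mx i ord0) -> derivable g x (delta_mx i ord0) ->
  partial i (fun y => f y + g y) x = partial i f x + partial i g x.
Proof. exact: deriveD. Qed.

Lemma partialM i f g x : derivable f x (delta_mx i ord0) -> derivable g x (delta_mx i ord0) ->
  partial i (fun y => f y * g y) x = f x * partial i g x + g x * partial i f x.
Proof. exact: deriveM. Qed.

Lemma Ck_add k D f g : open D -> Ck k D f -> Ck k D g -> Ck k D (fun x => f x + g x).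
Proof.
move=> oD; elim: k f g => [|k IH] f g [f1 f2] [g1 g2]; split=> //;
  do ?by move=> x Dx; apply: continuousD; [exact: f1|exact: g1].
move=> i; have [f3 f4] := f2 i; have [g3 g4] := g2 i; split.
  by move=> x Dx; apply: derivableD; [exact: f3|exact: g3].
apply: Ck_ext oD _ (IH _ _ f4 g4) => x; rewrite inE => Dx.
by rewrite partialD; [|exact: f3|exact: g3].
Qed.

Lemma Ck_mul k D f g : open D -> Ck k D f -> Ck k D g -> Ck k D (fun x => f x * g x).
Proof.
move=> oD; elim: k f g => [|k IH] f g [f1 f2] [g1 g2].
  by split=> // x Dx; apply: continuousM; [exact: f1|exact: g1].
split; first by move=> x Dx; apply: continuousM; [exact: f1|exact: g1].
move=> i; have [f3 f4] := f2 i; have [g3 g4] := g2 i; split.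
  by move=> x Dx; apply: derivableM; [exact: f3|exact: g3].
have fk : Ck k D f by apply: (@Ck_le k k.+1) => //; split.
have gk : Ck k D g by apply: (@Ck_le k k.+1) => //; split.
apply: Ck_ext oD _ (Ck_add oD (IH _ _ fk g4) (IH _ _ gk f4)) => x; rewrite inE => Dx.
by rewrite partialM; [|exact: f3|exact: g3].
Qed.

Lemma Ck_opp k D f : open D -> Ck k D f -> Ck k D (fun x => - f x).
Proof.
move=> oD h; apply: Ck_ext oD _ (Ck_mul oD (Ck_cst k D (-1)) h) => x _.
by rewrite mulN1r.
Qed.

Lemma Ck_sub k D f g : open D -> Ck k D f -> Ck k D g -> Ck k D (fun x => f x - g x).
Proof. by move=> oD hf hg; apply: Ck_add => //; apply: Ck_opp. Qed.

Lemma Ck_sum k D I (s : seq I) (P : pred I) (F : I -> 'cV[R]_n -> R) : open D ->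
  (forall i, P i -> Ck k D (F i)) -> Ck k D (fun x => \sum_(i <- s | P i) F i x).
Proof.
move=> oD h; elim: s => [|i s IH].
  by apply: Ck_ext oD _ (Ck_cst k D 0) => x _; rewrite big_nil.
case Pi: (P i).
  by apply: Ck_ext oD _ (Ck_add oD (h i Pi) IH) => x _; rewrite big_cons Pi.
by apply: Ck_ext oD _ IH => x _; rewrite big_cons Pi.
Qed.

Lemma Ck_prod k D I (s : seq I) (P : pred I) (F : I -> 'cV[R]_n -> R) : open D ->
  (forall i, P i -> Ck k D (F i)) -> Ck k D (fun x => \prod_(i <- s | P i) F i x).
Proof.
move=> oD h; elim: s => [|i s IH].
  by apply: Ck_ext oD _ (Ck_cst k D 1) => x _; rewrite big_nil.
case Pi: (P i).
  by apply: Ck_ext oD _ (Ck_mul oD (h i Pi) IH) => x _; rewrite big_cons Pi.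
by apply: Ck_ext oD _ IH => x _; rewrite big_cons Pi.
Qed.

(** The derivative - f^-2 f' involves f^-1 only to the order already obtained, which makes the
    induction on k work. *)
Lemma Ck_inv k D f : open D -> (forall x, D x -> f x != 0) -> Ck k D f ->
  Ck k D (fun x => (f x)^-1).
Proof.
move=> oD f0; elim: k => [|k IH] [f1 f2].
  by split=> // x Dx; apply: (continuousV (f0 x Dx) (f1 x Dx)).
have IV : Ck k D (fun x => (f x)^-1) by apply: IH; apply: (@Ck_le k k.+1) => //; split.
split; first by move=> x Dx; apply: (continuousV (f0 x Dx) (f1 x Dx)).
move=> i; have [f3 f4] := f2 i; split.
  by move=> x Dx; apply: derivableV; [exact: f0|exact: f3].
apply: Ck_ext oD _ (Ck_opp oD (Ck_mul oD (Ck_mul oD IV IV) f4)) => x; rewrite inE => Dx.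
rewrite /partial (deriveV (f0 x Dx)); last exact: f3.
by rewrite -mulNr -invfM -expr2.
Qed.

Lemma Ck_derivable k D f x i : Ck k.+1 D f -> D x -> derivable f x (delta_mx i ord0).
Proof. by move=> [_ h] Dx; have [h1 _] := h i; exact: h1. Qed.

Lemma Ck_partial k D f i : Ck k.+1 D f -> Ck k D (partial i f).
Proof. by move=> [_ h]; have [_] := h i. Qed.

Lemma partial_sum I (s : seq I) (P : pred I) (F : I -> 'cV[R]_n -> R) x i :
  (forall j, P j -> derivable (F j) x (delta_mx i ord0)) ->
  derivable (fun x => \sum_(j <- s | P j) F j x) x (delta_mx i ord0) /\
  partial i (fun x => \sum_(j <- s | P j) F j x) x = \sum_(j <- s | P j) partial i (F j) x.
Proof.
move=> h; elim: s => [|j s [IH1 IH2]].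
  under eq_fun do rewrite big_nil.
  by rewrite big_nil partial_cst; split=> //; exact: derivable_cst.
rewrite big_cons; case Pj: (P j).
  have -> : (fun x0 => \sum_(j0 <- (j :: s) | P j0) F j0 x0) =
     (fun x => F j x + \sum_(j <- s | P j) F j x).
    by apply/funext => y; rewrite big_cons Pj.
  split; first by apply: derivableD; [exact: h|exact: IH1].
  by rewrite partialD; [rewrite IH2|exact: h|exact: IH1].
have -> : (fun x0 => \sum_(j0 <- (j :: s) | P j0) F j0 x0) =
     (fun x => \sum_(j <- s | P j) F j x).
  by apply/funext => y; rewrite big_cons Pj.
by [].
Qed.

(** The second difference of f over a square of side h is symmetric in i and j; two applications of
    the mean value theorem, in either order, write it as h^2 times a mixed derivative at a nearby
    point. *)
Lemma schwarz D f x i j : open D -> Ck 2 D f -> D x ->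
  partial i (partial j f) x = partial j (partial i f) x.
Proof.
move=> oD C2 Dx; move: i j.
have alg (a b c' d q h p : R) : a - b - (c' - d) = q * h -> q = p * h ->
    a - b - c' + d = h * h * p.
  by move=> e1 e2; transitivity (q * h); [rewrite -e1; ring|rewrite e2; ring].
have step (i j : 'I_n) (e : R) : 0 < e -> exists2 d : R, 0 < d & forall h : R, 0 < h < d ->
   exists2 c, f (x + h *: delta_mx i ord0 + h *: delta_mx j ord0)
     - f (x + h *: delta_mx i ord0) - f (x + h *: delta_mx j ord0) + f x = h * h * c &
     `|c - partial j (partial i f) x| < e.
  move=> e0; have [d1 d10 h1] := (open_edP D).1 oD x Dx.
  have Cji : Ck 0 D (partial j (partial i f)) by do 2![apply: Ck_partial].
  have [d2 d20 h2] := (cont_edP _ _).1 (Ck_cont Cji Dx) e e0.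
  exists (Num.min d1 d2 / 2); first by rewrite divr_gt0 // lt_min d10.
  move=> h /andP[h0 hd].
  have hdn (s t : R) : 0 <= s <= h -> 0 <= t <= h ->
      `|x + s *: delta_mx i ord0 + t *: delta_mx j ord0 - x| < Num.min d1 d2.
    move=> /andP[s0 sh] /andP[t0 th]; apply/cv_norm_ltP; first by rewrite lt_min d10.
    move=> k; rewrite !mxE !eqxx !andbT addrC -addrA addKr.
    have : `|s * (k == i)%:R| <= h.
      by case: eqP => _; rewrite ?mulr1 ?mulr0 ?normr0 ?ger0_norm // ltW.
    have : `|t * (k == j)%:R| <= h.
      by case: eqP => _; rewrite ?mulr1 ?mulr0 ?normr0 ?ger0_norm // ltW.
    move=> a b; apply: le_lt_trans (ler_normD _ _) _; lra.
  have hD s t : 0 <= s <= h -> 0 <= t <= h -> D (x + s *: delta_mx i ord0 + t *: delta_mx j ord0).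
    by move=> a b; apply: h1; have := hdn _ _ a b; rewrite lt_min => /andP[].
  have h00 : (0 : R) <= 0 <= h by rewrite lexx ltW.
  have hhh : 0 <= h <= h by rewrite lexx ltW.
  have [|c + ec] := @mvt0 (fun s => f (x + s *: delta_mx i ord0 + h *: delta_mx j ord0) - f (x + s *:
      delta_mx i ord0))
    (fun s => partial i f (x + s *: delta_mx i ord0 + h *: delta_mx j ord0) - partial i f (x + s *:
        delta_mx i ord0)) h.
    move=> s; rewrite (min_l (ltW h0)) (max_r (ltW h0)) => sh.
    apply: is_deriveB.
      under eq_fun do rewrite addrAC.
      rewrite addrAC; apply: line_is_derive; rewrite addrAC.
      by apply: Ck_derivable C2 _; exact: hD.
    apply: line_is_derive; apply: Ck_derivable C2 _.
    by have := hD s 0 sh h00; rewrite scale0r addr0.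
  rewrite (min_l (ltW h0)) (max_r (ltW h0)) => ch.
  have [|c' + ec'] := @mvt0 (fun s => partial i f (x + c *: delta_mx i ord0 + s *: delta_mx j ord0))
    (fun s => partial j (partial i f) (x + c *: delta_mx i ord0 + s *: delta_mx j ord0)) h.
    move=> s; rewrite (min_l (ltW h0)) (max_r (ltW h0)) => sh.
    by apply: line_is_derive; apply: Ck_derivable (Ck_partial i C2) _; exact: hD.
  rewrite (min_l (ltW h0)) (max_r (ltW h0)) => c'h.
  exists (partial j (partial i f) (x + c *: delta_mx i ord0 + c' *: delta_mx j ord0)).
    move: ec ec'; rewrite !scale0r !addr0 => ec ec'.
    exact: alg ec ec'.
  by apply: h2; have := hdn _ _ ch c'h; rewrite lt_min => /andP[].
(* If the two mixed derivatives were at distance a > 0, both would lie strictly within a / 2 of the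
   same normalized second difference. *)
move=> i j; apply/eqP; rewrite -subr_eq0; apply/negPn/negP; rewrite -normr_gt0 => a0.
set a := `|_| in a0.
have [d1 d10 h1] := step i j (a / 2) (divr_gt0 a0 (ltr0n _ 2)).
have [d2 d20 h2] := step j i (a / 2) (divr_gt0 a0 (ltr0n _ 2)).
pose h := Num.min d1 d2 / 2.
have h0 : 0 < h by rewrite divr_gt0 // lt_min d10.
have hm : h < Num.min d1 d2 by rewrite ltr_pdivrMr // ltr_pMr ?ltr1n // lt_min d10.
move: (hm); rewrite lt_min => /andP[hd1 hd2].
have [|c1 e1 l1] := h1 h; first by rewrite h0.
have [|c2 e2 l2] := h2 h; first by rewrite h0.
have c12 : c1 = c2.
  apply: (@mulfI _ (h * h)); first by rewrite mulf_neq0 // gt_eqF.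
  rewrite -e1 -e2 [x + h *: delta_mx j ord0 + _]addrAC.
  by rewrite [_ - f (x + h *: delta_mx i ord0) - _]addrAC.
move: l1 l2; rewrite -c12 => l1 l2.
have : a < a / 2 + a / 2.
  rewrite {1}/a -(subrKA c1); apply: le_lt_trans (ler_normD _ _) _.
  by apply: ltrD; [rewrite distrC; exact: l2|exact: l1].
by rewrite -splitr ltxx.
Qed.

End CkTheory.

(** Induction on k through the chain rule: each partial derivative of the composite is a sum of
    products, to whose factors the induction hypothesis or the regularity of G applies. *)
Lemma Ck_comp n p k (D : set 'cV[R]_n) (D' : set 'cV[R]_p) f (G : 'cV[R]_n -> 'cV[R]_p) :
  open D -> open D' -> Ck k D' f -> (forall i, Ck k D (fun x => G x i ord0)) ->
  (forall x, D x -> D' (G x)) -> Ck k D (fun x => f (G x)).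
Proof.
move=> oD oD' fk Gk DD'.
have c0 (g : 'cV[R]_p -> R) : Ck 0 D' g -> (forall i, Ck 0 D (fun x => G x i ord0)) ->
    forall x, D x -> {for x, continuous (fun x => g (G x))}.
  move=> f0 G0 x Dx; apply/cont_edP => e e0.
  have [d d0 hd] := (cont_edP _ _).1 (Ck_cont f0 (DD' _ Dx)) e e0.
  have : forall i, exists d' : R, 0 < d' /\ forall y : 'cV[R]_n, `|y - x| < d' ->
     `|G y i ord0 - G x i ord0| < d.
    move=> i; have [d' d'0 h] := (cont_edP _ _).1 (Ck_cont (G0 i) Dx) d d0.
    by exists d'.
  move=> /choice[d' hd']; exists (\big[Num.min/1]_i d' i).
    by apply: lt_bigmin => // i _; have [] := hd' i.
  move=> y yx; apply: hd; apply/cv_norm_ltP => // i; rewrite !mxE.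
  have [_] := hd' i; apply; apply: lt_le_trans yx _; exact: bigmin_le.
elim: k f fk Gk => [|k IH] f fk Gk; first by split=> // x Dx; exact: c0.
split=> [|i].
  apply: c0; first by apply: Ck_le fk.
  by move=> i; apply: Ck_le (Gk i).
have fr x : D x -> frechet (fun y => f (G y)) x
    (fun l => \sum_i partial i f (G x) * partial l (fun y => G y i ord0) x).
  move=> Dx; apply: frechet_comp.
    by apply: C1_frechet oD' _ (DD' _ Dx); apply: Ck_le fk.
  by move=> j; apply: C1_frechet oD _ Dx; apply: Ck_le (Gk j).
split=> [x Dx|]; first by have [] := frechet_derive (delta_mx i ord0) (fr x Dx).
apply: (@Ck_ext n k D (fun x => \sum_j partial j f (G x) * partial i (fun y => G y j ord0) x)) => //.
  by move=> x; rewrite inE => Dx; rewrite (frechet_partial i (fr x Dx)).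
apply: Ck_sum => // j _; apply: Ck_mul => //.
  apply: IH; first exact: Ck_partial.
  by move=> l; apply: Ck_le (Gk l).
by apply: Ck_partial; exact: Gk.
Qed.

End Calculus.

(** * Ordinary differential equations *)

Section ODE.
Context {R : realType}.

(** Compactness of [-s, s] for an arbitrary property that is monotone in the radius; it serves for
    boundedness as well as for uniform continuity. *)
Lemma segment_uniform (s : R) (P : R -> R -> Prop) :
  (forall d d' t : R, d' <= d -> P d t -> P d' t) ->
  (forall t0 : R, `|t0| <= s -> exists2 d : R, 0 < d & forall t : R, `|t - t0| < d -> P d t) ->
  exists2 d : R, 0 < d & forall t : R, `|t| <= s -> P d t.
Proof.
move=> mono loc.
have := (compact_near_coveringP (`[- s, s]%classic : set R)).1 (@segment_compact R (- s) s).
move=> /(_ R (0^'+)%R P _)[].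
  move=> t0; rewrite /= in_itv /= -ler_norml => /loc[d d0 hd].
  exists (ball t0 d, [set e | 0 < e < d]).
    split; first exact: nbhsx_ballx.
    have h1 : \forall e \near 0^'+, (0 : R) < e by exact: nbhs_right_gt.
    have h2 : \forall e \near 0^'+, (e : R) < d by exact: nbhs_right_lt.
    by near=> e; apply/andP; split; near: e.
  move=> [t e] [/= + /andP[_ /ltW ed]]; rewrite /ball /= distrC => /hd.
  exact: mono.
move=> d /= d0 hd; exists (d / 2); first by rewrite divr_gt0.
move=> t ts; apply: hd => //=; last 2 first.
- by rewrite divr_gt0.
- by rewrite in_itv /= -ler_norml.
rewrite /ball_ /= sub0r normrN gtr0_norm ?divr_gt0 //.
by rewrite ltr_pdivrMr // ltr_pMr // ltr1n.
Unshelve. all: by end_near. Qed.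

Lemma is_derive_cont (f : R -> R) (t df : R) : is_derive t 1 f df -> {for t, continuous f}.
Proof. by move=> [/derivable1_diffP/differentiable_continuous]. Qed.

Lemma line_bounded n (w : R -> 'cV[R]_n) (s : R) :
  (forall t : R, `|t| <= s -> forall i, {for t, continuous (fun t => w t i ord0)}) ->
  exists2 C : R, 0 <= C & forall t : R, `|t| <= s -> `|w t| <= C.
Proof.
move=> wc.
(* The bound is encoded as the inverse of a radius, so that a smaller radius is a weaker claim; the
   case d <= 0 keeps the predicate monotone. *)
have [||d d0 hd] := @segment_uniform s (fun d t => `|w t| <= d^-1 /\ 0 < d \/ d <= 0).
- move=> d d' t d'd; have [d'0|d'0] := leP d' 0; first by right.
  have dp := lt_le_trans d'0 d'd.
  move=> [[h _]|]; last by rewrite leNgt dp.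
  by left; split=> //; apply: le_trans h _; rewrite lef_pV2.
- move=> t0 /wc ct.
  have : forall i, exists d : R, 0 < d /\ forall t : R, `|t - t0| < d -> `|w t i ord0| <= `|w t0| + 1.
    move=> i; have [d d0 hd] := (cont_edP _ _).1 (ct i) 1 ltr01.
    exists d; split=> // t /hd h.
    rewrite -[w t i ord0](subrK (w t0 i ord0)) addrC.
    by apply: le_trans (ler_normD _ _) _; apply: lerD (cv_coord_le _ _) (ltW h).
  move=> /choice[d hd].
  pose e := \big[Num.min/1]_i d i.
  have e0 : 0 < e by apply: lt_bigmin => // i _; have [] := hd i.
  have w1 : 0 < `|w t0| + 1 by rewrite ltr_wpDl.
  exists (Num.min e (`|w t0| + 1)^-1); first by rewrite lt_min e0 invr_gt0.
  move=> t; rewrite lt_min => /andP[te _]; left; split; last by rewrite lt_min e0 invr_gt0.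
  apply: (@le_trans _ _ (`|w t0| + 1)).
    apply/cv_norm_leP; first exact: ltW.
    by move=> i; have [_] := hd i; apply; apply: lt_le_trans te _; exact: bigmin_le.
  rewrite -[leLHS]invrK lef_pV2 ?posrE ?invr_gt0 //; first by rewrite ge_min lexx orbT.
  by rewrite lt_min e0 invr_gt0.
exists d^-1; first by rewrite invr_ge0 ltW.
by move=> t /hd[[//]|]; rewrite leNgt d0.
Qed.

Lemma mvt_bound (f df : R -> R) (s C t : R) : 0 <= C -> `|t| <= s ->
  (forall t : R, `|t| <= s -> is_derive t 1 f (df t)) -> (forall t : R, `|t| <= s -> `|df t| <= C) ->
  `|f t - f 0| <= s * C.
Proof.
move=> C0 ts h1 h2.
have inn c : Num.min 0 t <= c <= Num.max 0 t -> `|c| <= s.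
  move: ts; rewrite !ler_norml => /andP[? ?].
  by case: (leP 0 t) => _ /andP[? ?]; apply/andP; split; lra.
have [|c /inn ch ->] := @mvt0 _ f df t; first by move=> c /inn/h1.
by rewrite normrM mulrC ler_pM //; exact: h2.
Qed.

Lemma geometric_small (C a : R) : 0 <= C -> 0 < a -> exists k, C / 2 ^+ k <= a.
Proof.
move=> C0 a0.
have C1 : 0 <= C / a by rewrite divr_ge0 // ltW.
exists (Num.truncn (C / a)).+1.
rewrite ler_pdivrMr ?exprn_gt0 // mulrC -ler_pdivrMr //.
have [_ /ltW h] := andP (truncn_itv C1); apply: le_trans h _.
by rewrite -natrX ler_nat ltnW // ltn_expl.
Qed.

Lemma ode_est n (w w' : R -> 'cV[R]_n) (s K c : R) :
  0 <= s -> 0 <= K -> K * s <= 2^-1 -> 0 <= c ->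
  (forall t : R, `|t| <= s -> forall i, is_derive t 1 (fun t => w t i ord0) (w' t i ord0)) ->
  (forall t : R, `|t| <= s -> `|w' t| <= K * `|w t| + c) ->
  forall t : R, `|t| <= s -> `|w t| <= 2 * (`|w 0| + s * c).
Proof.
move=> s0 K0 Ks c0 dw bw.
have [|C C0 hC] := @line_bounded n w s.
  by move=> t /dw h i; apply: is_derive_cont (h i).
have step M : 0 <= M -> (forall t : R, `|t| <= s -> `|w t| <= M) ->
    forall t : R, `|t| <= s -> `|w t| <= `|w 0| + s * c + M / 2.
  move=> M0 hM t ts; apply/cv_norm_leP.
    by rewrite !addr_ge0 ?mulr_ge0 // ?divr_ge0.
  move=> i.
  have hb : `|w t i ord0 - w 0 i ord0| <= s * (K * M + c).
    apply: (@mvt_bound (fun t => w t i ord0) (fun t => w' t i ord0)) => //.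
    - by rewrite addr_ge0 // mulr_ge0.
    - by move=> u us; exact: dw.
    - move=> u us; apply: le_trans (cv_coord_le _ _) _; apply: le_trans (bw u us) _.
      by rewrite lerD2r ler_wpM2l //; exact: hM.
  rewrite -[w t i ord0](subrK (w 0 i ord0)) addrC.
  apply: le_trans (ler_normD _ _) _; rewrite -addrA lerD ?cv_coord_le //.
  apply: le_trans hb _; rewrite mulrDr [leLHS]addrC lerD2l mulrA [s * K]mulrC.
  by rewrite [leRHS]mulrC ler_wpM2r.
have it k : forall t : R, `|t| <= s -> `|w t| <= 2 * (`|w 0| + s * c) + C / 2 ^+ k.
  elim: k => [|k IH] t ts.
    rewrite expr0 divr1; apply: le_trans (hC t ts) _.
    by rewrite lerDr mulr_ge0 // addr_ge0 // mulr_ge0.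
  have P0 : 0 <= C / 2 ^+ k by rewrite divr_ge0 // exprn_ge0.
  apply: le_trans (step _ _ IH t ts) _.
    by rewrite addr_ge0 // mulr_ge0 // addr_ge0 // mulr_ge0.
  rewrite exprS invfM [2^-1 / _]mulrC mulrA.
  by move: P0; set p := C / _; set q := `|w 0| + _; lra.
move=> t ts; apply/ler_addgt0Pr => e e0.
have [k hk] := geometric_small C0 e0.
by apply: le_trans (it k t ts) _; rewrite lerD2l.
Qed.

Lemma deriv0_cst (f g df : R -> R) (e : R) : f 0 = g 0 ->
  (forall t : R, `|t| < e -> is_derive t 1 f (df t)) ->
  (forall t : R, `|t| < e -> is_derive t 1 g (df t)) ->
  forall t : R, `|t| < e -> f t = g t.
Proof.
move=> fg0 hf hg t te; apply/eqP; rewrite -subr_eq0.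
have [|c _] := @mvt0 _ (fun t => f t - g t) (fun=> 0) t.
  move=> c cb; have ce : `|c| < e.
    move: te cb; rewrite !ltr_norml => /andP[? ?].
    by case: (leP 0 t) => _ /andP[? ?]; apply/andP; split; lra.
  by apply: is_derive_eq (is_deriveB (hf c ce) (hg c ce)) (subrr _).
by rewrite fg0 subrr subr0 mul0r => ->.
Qed.

(** The fundamental theorem gives a primitive on each [-s, s] with s < e. Normalized to vanish at 0
    these agree where they overlap, and the value at t is taken from the one with s halfway between
    |t| and e. *)
Lemma antiderivative (f : R -> R) (e : R) : 0 < e ->
  (forall t : R, `|t| < e -> {for t, continuous f}) ->
  exists2 F : R -> R, F 0 = 0 & forall t : R, `|t| < e -> is_derive t 1 F (f t).
Proof.
move=> e0 fc.
have loc (s : R) : exists F : R -> R, 0 < s < e -> F 0 = 0 /\ forall t : R, `|t| < s -> is_derive t 1 F (f t).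
  have [/andP[s0 se]|_] := boolP (0 < s < e); last by exists (fun=> 0).
  pose G x := (\int[lebesgue_measure]_(t in [set` Interval (BLeft (- s)) (BRight x)]) f t)%R.
  exists (fun x => G x - G 0) => _; split; first exact: subrr.
  move=> t ts; rewrite -[f t]subr0; apply: is_deriveB.
  move: (ts); rewrite ltr_norml => /andP[t1 t2].
  have [] := @continuous_FTC1_closed R f (- s) t s t2 _ _ _.
  - apply: continuous_compact_integrable; first exact: segment_compact.
    apply: continuous_in_subspaceT => x; rewrite inE /= in_itv /= => xs.
    by apply: fc; apply: le_lt_trans se; rewrite ler_norml.
  - exact: t1.
  - by apply: fc; exact: lt_trans se.
  by rewrite derive1E => ? ?; split.
have /choice[F hF] := loc.
pose si (t : R) := (`|t| + e) / 2.
have siP (t : R) : `|t| < e -> [/\ `|t| < si t, 0 < si t & si t < e].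
  by move=> te; rewrite /si; have := normr_ge0 t; split; lra.
have agree s s' t : 0 < s < e -> 0 < s' < e -> `|t| < s -> `|t| < s' -> F s t = F s' t.
  move=> /hF[F0 dF] /hF[F'0 dF'] ts ts'.
  apply: (@deriv0_cst _ _ f (Num.min s s')); first by rewrite F0 F'0.
  - by move=> u; rewrite lt_min => /andP[us _]; exact: dF.
  - by move=> u; rewrite lt_min => /andP[_ us]; exact: dF'.
  - by rewrite lt_min ts.
exists (fun t => F (si t) t).
  have [|_ s0 se] := siP 0; first by rewrite normr0.
  by have [|->] := hF (si 0); rewrite ?s0.
move=> t te; have [ts s0 se] := siP t te.
have [|_ dF] := hF (si t); first by rewrite s0.
apply: near_eq_is_derive (dF t ts).
have ots : \forall x \near t, `|x| < si t.
  apply: open_near (_ : open [set x : R | `|x| < si t]) _ _ => //.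
  apply/open_edP => x /= xs; exists (si t - `|x|); first by rewrite subr_gt0.
  move=> y yx; rewrite -[y](subrK x); apply: le_lt_trans (ler_normD _ _) _.
  by rewrite -ltrBrDr.
near=> x; have xs : `|x| < si t by near: x.
have [xs' s0' se'] := siP x (lt_trans xs se).
by apply: agree; rewrite ?s0 ?s0'.
Unshelve. all: by end_near. Qed.

(** With [b k] the bound on the tail after k, the left end of any interval [u k - b k, u k + b k]
    lies below the right end of any other; the supremum of the left ends therefore belongs to all of
    them. *)
Lemma geometric_limit (u : nat -> R) (C : R) :
  (forall k, `|u k.+1 - u k| <= C / 2 ^+ k) ->
  exists l, forall k, `|l - u k| <= 2 * C / 2 ^+ k.
Proof.
move=> h.
have C0 : 0 <= C by have := h 0; rewrite expr0 divr1; apply: le_trans.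
pose b k := 2 * C / 2 ^+ k.
have b0 k : 0 <= b k by rewrite divr_ge0 ?mulr_ge0 // exprn_ge0.
have bS k : C / 2 ^+ k + b k.+1 = b k.
  by rewrite /b exprS invfM; set q := (2 ^+ k)^-1; field.
have hkm k m : `|u (k + m)%N - u k| <= b k - b (k + m)%N.
  elim: m k => [|m IH] k; first by rewrite addn0 !subrr normr0.
  rewrite -addSnnS -(subrKA (u k.+1)); apply: le_trans (ler_normD _ _) _.
  rewrite -(bS k) -addrA addrC.
  by have := IH k.+1; have := h k; lra.
have le2 k m : u k - b k <= u m + b m.
  have [km|mk] := leqP k m.
    have := hkm k (m - k)%N; rewrite subnKC // ler_norml => /andP[+ _].
    by have := b0 m; lra.
  have := hkm m (k - m)%N; rewrite subnKC ?(ltnW mk) // ler_norml => /andP[_ +].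
  by have := b0 k; lra.
pose S := [set u k - b k | k in [set: nat]].
exists (sup S) => k; rewrite ler_norml; apply/andP; split.
  rewrite lerBrDr addrC; apply: ub_le_sup; last by exists k.
  by exists (u 0%N + b 0%N) => _ [m _ <-]; exact: le2.
rewrite lerBlDl; apply: ge_sup; first by exists (u k - b k), k.
by move=> _ [m _ <-]; exact: le2.
Qed.

(* Picard iteration; [K * e <= 1/2] makes it contract on the whole interval at once. *)
Lemma ode_exist N (e K : R) (f : R -> 'cV[R]_N -> 'cV[R]_N) (g : 'cV[R]_N) :
  0 < e -> 0 <= K -> K * e <= 2^-1 ->
  (forall t : R, `|t| < e -> forall u v, `|f t u - f t v| <= K * `|u - v|) ->
  (forall v (t : R) i, `|t| < e -> {for t, continuous (fun t => f t v i ord0)}) ->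
  exists2 u : R -> 'cV[R]_N, u 0 = g &
    forall t : R, `|t| < e -> forall i, is_derive t 1 (fun t => u t i ord0) (f t (u t) i ord0).
Proof.
move=> e0 K0 Ke lip fc.
pose cont (u : R -> 'cV[R]_N) := forall t : R, `|t| < e -> forall i, {for t, continuous (fun t => u t i ord0)}.
have comp_cont u : cont u -> cont (fun t => f t (u t)).
  move=> uc t te i; apply/cont_edP => a a0.
  have K1 : 0 < K + 1 by rewrite ltr_wpDl.
  have a2 : 0 < a / 2 / (K + 1) by rewrite !divr_gt0.
  have [d1 d10 h1] := (cont_edP _ _).1 (fc (u t) t i te) (a / 2) (divr_gt0 a0 (ltr0n _ 2)).
  have : forall l, exists d : R, 0 < d /\ forall t' : R, `|t' - t| < d -> `|u t' l ord0 - u t l ord0| < a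
      / 2 / (K + 1).
    by move=> l; have [d d0 hd] := (cont_edP _ _).1 (uc t te l) _ a2; exists d.
  move=> /choice[d hd]; pose d2 := \big[Num.min/1]_l d l.
  have d20 : 0 < d2 by apply: lt_bigmin => // l _; have [] := hd l.
  exists (Num.min d1 (Num.min d2 (e - `|t|))).
    by rewrite !lt_min d10 d20 subr_gt0.
  move=> t'; rewrite !lt_min => /and3P[t1 t2 t3].
  have t'e : `|t'| < e.
    by rewrite -[t'](subrK t); apply: le_lt_trans (ler_normD _ _) _; rewrite -ltrBrDr.
  rewrite -(subrKA (f t' (u t) i ord0)); apply: le_lt_trans (ler_normD _ _) _.
  rewrite [ltRHS]splitr; apply: ler_ltD; last exact: h1.
  have := cv_coord_le (f t' (u t') - f t' (u t)) i; rewrite !mxE => /le_trans; apply.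
  apply: le_trans (lip _ t'e _ _) _.
  have ul : `|u t' - u t| <= a / 2 / (K + 1).
    apply/cv_norm_leP; first exact: ltW.
    move=> l; rewrite !mxE; have [_ /(_ t') hl] := hd l; apply/ltW/hl.
    by apply: lt_le_trans t2 _; exact: bigmin_le.
  apply: (@le_trans _ _ ((K + 1) * (a / 2 / (K + 1)))); last by rewrite mulrC divfK // gt_eqF.
  by rewrite ler_pM // lerDl.
(* The value 0 for a discontinuous u is a dummy that makes the Picard map total; by [Uc] all
   iterates are continuous. *)
have J u : exists v : R -> 'cV[R]_N, cont u -> v 0 = g /\
    forall t : R, `|t| < e -> forall i, is_derive t 1 (fun t => v t i ord0) (f t (u t) i ord0).
  have [uc|nuc] := pselect (cont u); last by exists (fun=> 0) => /nuc.
  have : forall i, exists F : R -> R, F 0 = 0 /\ forall t : R, `|t| < e -> is_derive t 1 F (f t (u t) i ord0).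
    move=> i; have [|F F0 dF] := @antiderivative (fun t => f t (u t) i ord0) e e0.
      by move=> t te; exact: comp_cont.
    by exists F.
  move=> /choice[F hF]; exists (fun t => \col_i (g i ord0 + F i t)) => _; split.
    by apply/colP => i; rewrite mxE; have [-> _] := hF i; rewrite addr0.
  move=> t te i; have [_ /(_ t te) dF] := hF i.
  under eq_fun do rewrite mxE.
  by rewrite -[f _ _ _ _]add0r; apply: is_deriveD.
have /choice[Jf hJ] := J.
pose U k := iter k Jf (fun=> g).
have dcont (v : R -> 'cV[R]_N) (dv : R -> 'I_N -> R) : (forall t : R, `|t| < e -> forall i, is_derive t 1
    (fun t => v t i ord0) (dv t i)) -> cont v.
  by move=> h t te i; apply: is_derive_cont (h t te i).
have Uc k : cont (U k).
  elim: k => [|k IH]; first by move=> t _ i; exact: cst_continuous.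
  by have [_ h] := hJ _ IH; apply: dcont h.
have US k : U k.+1 0 = g /\ forall t : R, `|t| < e -> forall i,
     is_derive t 1 (fun t => U k.+1 t i ord0) (f t (U k t) i ord0).
  exact: hJ (Uc k).
have U0 k : U k 0 = g by case: k => // k; have [] := US k.
(* The contraction factor is 1/2 on the whole open interval, but the first difference is bounded
   only on compact parts of it; hence C depends on s. *)
have unif (s : R) : 0 <= s -> s < e -> exists2 C : R, 0 <= C & forall t : R, `|t| <= s ->
   forall k, `|U k.+1 t - U k t| <= C / 2 ^+ k.
  move=> s0 se.
  have [|C C0 hC] := @line_bounded N (fun t => U 1%N t - U 0%N t) s.
    move=> t ts i; rewrite (_ : (fun t => _) = (fun t => U 1%N t i ord0 - U 0%N t i ord0)).
      2: by apply/funext => x; rewrite !mxE.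
    have te := le_lt_trans ts se.
    exact: (@continuousB R R R (fun t => U 1%N t i ord0) (fun t => U 0%N t i ord0) t (Uc 1%N t te i) (Uc 0%N t te i)).
  exists C => // t ts k; elim: k t ts => [|k IH] t ts; first by rewrite expr0 divr1; exact: hC.
  have P0 : 0 <= C / 2 ^+ k by rewrite divr_ge0 // exprn_ge0.
  apply/cv_norm_leP; first by rewrite divr_ge0 // exprn_ge0.
  move=> i; rewrite !mxE.
  have hb : `|(U k.+2 t i ord0 - U k.+1 t i ord0) - (U k.+2 0 i ord0 - U k.+1 0 i ord0)| <= s * (K * (C / 2 ^+ k)).
    apply: (@mvt_bound (fun t => U k.+2 t i ord0 - U k.+1 t i ord0)
      (fun t => f t (U k.+1 t) i ord0 - f t (U k t) i ord0)) => //.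
    - by rewrite mulr_ge0.
    - move=> u us; have ue := le_lt_trans us se.
      by apply: is_deriveB; [have [_] := US k.+1; apply|have [_] := US k; apply].
    - move=> u us; have ue := le_lt_trans us se.
      have := cv_coord_le (f u (U k.+1 u) - f u (U k u)) i; rewrite !mxE => /le_trans; apply.
      by apply: le_trans (lip _ ue _ _) _; rewrite ler_wpM2l //; exact: IH.
  move: hb; rewrite !U0 subrr subr0 => /le_trans; apply.
  rewrite mulrA [s * K]mulrC exprS invfM [leRHS]mulrCA ler_wpM2r //.
  by apply: le_trans Ke; rewrite ler_wpM2l // ltW.
(* The rate is required for every admissible C, so that a limit chosen separately at each t inherits
   the constants that are uniform on [-s, s]. *)
have : forall t, exists l : 'cV[R]_N, `|t| < e -> forall C : R,
    (forall k, `|U k.+1 t - U k t| <= C / 2 ^+ k) -> forall k, `|l - U k t| <= 2 * C / 2 ^+ k.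
  move=> t; have [te|nte] := boolP (`|t| < e); last by exists 0.
  have [C C0 /(_ t (lexx _)) hC] := unif _ (normr_ge0 t) te.
  have : forall i, exists l : R, forall k, `|l - U k t i ord0| <= 2 * C / 2 ^+ k.
    move=> i; apply: geometric_limit => k; apply: le_trans (hC k).
    by have := cv_coord_le (U k.+1 t - U k t) i; rewrite !mxE.
  move=> /choice[l hl]; exists (\col_i l i) => _ C' hC' k.
  have C'0 : 0 <= C' by have := hC' 0%N; rewrite expr0 divr1; apply: le_trans.
  apply/cv_norm_leP; first by rewrite divr_ge0 ?mulr_ge0 // exprn_ge0.
  move=> i; rewrite !mxE.
  have [l' hl'] : exists l : R, forall k, `|l - U k t i ord0| <= 2 * C' / 2 ^+ k.
    apply: geometric_limit => m; apply: le_trans (hC' m).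
    by have := cv_coord_le (U m.+1 t - U m t) i; rewrite !mxE.
  suff -> : l i = l' by exact: hl'.
  apply/eqP; rewrite -subr_eq0 -normr_le0; apply/ler_addgt0Pr => a a0; rewrite add0r.
  have CC0 : 0 <= 2 * C + 2 * C' by rewrite addr_ge0 ?mulr_ge0.
  have [m hm] := geometric_small CC0 a0.
  rewrite -(subrKA (U m t i ord0)); apply: le_trans (ler_normD _ _) _.
  rewrite [X in _ + X]distrC; apply: le_trans (lerD (hl i m) (hl' m)) _.
  by rewrite -mulrDl.
move=> /choice[u hu].
have unif2 (s : R) : 0 <= s -> s < e -> exists2 C : R, 0 <= C & forall t : R, `|t| <= s ->
   forall k, `|u t - U k t| <= C / 2 ^+ k.
  move=> s0 se; have [C C0 hC] := unif s s0 se; exists (2 * C); first by rewrite mulr_ge0.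
  by move=> t ts k; apply: hu; [exact: le_lt_trans se|exact: hC].
have uc : cont u.
  move=> t te i; apply/cont_edP => a a0.
  pose s := (`|t| + e) / 2.
  have [ts s0 se] : [/\ `|t| < s, 0 < s & s < e].
    by rewrite /s; have := normr_ge0 t; split; lra.
  have [C C0 hC] := unif2 s (ltW s0) se.
  have a40 : 0 < a / 4 by rewrite divr_gt0.
  have [k hk] := geometric_small C0 a40.
  have [d d0 hd] := (cont_edP _ _).1 (Uc k t te i) _ a40.
  exists (Num.min d (s - `|t|)); first by rewrite lt_min d0 subr_gt0.
  move=> t'; rewrite lt_min => /andP[/hd h1 t's].
  have t's' : `|t'| <= s.
    by rewrite -[t'](subrK t); apply: le_trans (ler_normD _ _) _; rewrite -lerBrDr ltW.
  have b (x : R) : `|x| <= s -> `|u x i ord0 - U k x i ord0| <= a / 4.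
    move=> xs; have := cv_coord_le (u x - U k x) i; rewrite !mxE => /le_trans; apply.
    exact: le_trans (hC x xs k) hk.
  have b1 := b _ t's'; have b2 := b _ (ltW ts).
  move: b1 b2 h1; rewrite !ler_norml !ltr_norml => /andP[? ?] /andP[? ?] /andP[? ?].
  by apply/andP; split; lra.
have [v0 dv] := hJ u uc.
(* [Jf u] has derivative f(t, u t) by construction; it remains to see that u is a fixed point of
   [Jf]. *)
exists (Jf u) => // t te i.
suff -> : Jf u t = u t by exact: dv.
have [C C0 hC] := unif2 _ (normr_ge0 t) te.
apply/colP => l; apply/eqP; rewrite -subr_eq0 -normr_le0; apply/ler_addgt0Pr => a a0; rewrite add0r.
have a20 : 0 < a / 2 by rewrite divr_gt0.
have [k hk] := geometric_small C0 a20.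
have hkS : C / 2 ^+ k.+1 <= a / 2.
  apply: le_trans hk; rewrite exprS invfM mulrCA ler_piMl //; last by rewrite invf_le1 // ler1n.
  by rewrite divr_ge0 // exprn_ge0.
rewrite -(subrKA (U k.+1 t l ord0)) (splitr a); apply: le_trans (ler_normD _ _) _.
apply: lerD; last first.
  rewrite distrC; have := cv_coord_le (u t - U k.+1 t) l; rewrite !mxE => /le_trans; apply.
  exact: le_trans (hC t (lexx _) _) hkS.
have hb : `|(Jf u t l ord0 - U k.+1 t l ord0) - (Jf u 0 l ord0 - U k.+1 0 l ord0)| <= `|t| * (K * (C / 2 ^+ k)).
  apply: (@mvt_bound (fun t => Jf u t l ord0 - U k.+1 t l ord0)
      (fun t => f t (u t) l ord0 - f t (U k t) l ord0)) => //.
  - by rewrite mulr_ge0 // divr_ge0 // exprn_ge0.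
  - move=> x xt; have xe := le_lt_trans xt te.
    by apply: is_deriveB; [exact: dv|have [_] := US k; apply].
  - move=> x xt; have xe := le_lt_trans xt te.
    have := cv_coord_le (f x (u x) - f x (U k x)) l; rewrite !mxE => /le_trans; apply.
    by apply: le_trans (lip _ xe _ _) _; rewrite ler_wpM2l //; exact: hC.
move: hb; rewrite v0 U0 subrr subr0 => /le_trans; apply.
rewrite (mulrA (`|t|) K); apply: (@le_trans _ _ (1 * (C / 2 ^+ k))); last by rewrite mul1r.
have P0 : 0 <= C / 2 ^+ k by rewrite divr_ge0 // exprn_ge0.
rewrite ler_wpM2r //.
rewrite mulrC; apply: le_trans (_ : K * e <= _); first by rewrite ler_wpM2l // ltW.
by apply: le_trans Ke _; lra.
Qed.

End ODE.

(** * Smooth dependence on parameters: affine equations *)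

Section ParametricODE.
Context {R : realType} {n : nat}.
Implicit Types (y z : 'cV[R]_n) (j : 'I_n).

Definition cube (e : R) : set 'cV[R]_n := [set y | `|y| < e].

Definition upd j y (t : R) : 'cV[R]_n := \col_i (if i == j then t else y i ord0).

Lemma open_cube e : open (cube e).
Proof.
apply/open_edP => x /= xs; exists (e - `|x|); first by rewrite subr_gt0.
move=> y yx; rewrite -[y](subrK x) /cube /=; apply: le_lt_trans (ler_normD _ _) _.
by rewrite -ltrBrDr.
Qed.

Lemma cube_gt0 e y : cube e y -> 0 < e.
Proof. by apply: le_lt_trans. Qed.

Lemma upd_id j y : upd j y (y j ord0) = y.
Proof. by apply/colP => i; rewrite mxE; case: eqP => // ->. Qed.

Lemma upd_at j y t : upd j y t j ord0 = t.
Proof. by rewrite mxE eqxx. Qed.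

Lemma upd_upd j y t t' : upd j (upd j y t) t' = upd j y t'.
Proof. by apply/colP => i; rewrite !mxE; case: eqP. Qed.

Lemma upd_add j y t h : upd j y (t + h) = upd j y t + h *: delta_mx j ord0.
Proof.
by apply/colP => i; rewrite !mxE andbT; case: eqP => _; rewrite ?mulr1 ?mulr0 ?addr0.
Qed.

Lemma upd_shift j l y t h : l != j ->
  upd j (y + h *: delta_mx l ord0) t = upd j y t + h *: delta_mx l ord0.
Proof.
move=> lj; apply/colP => i; rewrite !mxE andbT; case: eqP => // ->.
by rewrite eq_sym (negbTE lj) mulr0 addr0.
Qed.

Lemma cube_upd e j y t : cube e y -> `|t| < e -> cube e (upd j y t).
Proof.
move=> ye te; have e0 := cube_gt0 ye; apply/cv_norm_ltP => // i; rewrite mxE.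
by case: eqP => // _; apply: le_lt_trans ye; exact: cv_coord_le.
Qed.

Lemma upd_dist j y y' t : `|upd j y t - upd j y' t| <= `|y - y'|.
Proof.
apply/cv_norm_leP => // i; rewrite !mxE; case: eqP => _; first by rewrite subrr normr0.
by have := cv_coord_le (y - y') i; rewrite !mxE.
Qed.

Lemma upd_dist_t j y t t' : `|upd j y t - upd j y t'| <= `|t - t'|.
Proof.
apply/cv_norm_leP => // i; rewrite !mxE; case: eqP => _ //.
by rewrite subrr normr0.
Qed.

Lemma upd_derive j y t (F : 'cV[R]_n -> R) (L : R) :
  is_derive (upd j y t) (delta_mx j ord0 : 'cV[R]_n) F L ->
  is_derive t 1 (fun s : R => F (upd j y s)) L.
Proof.
move=> /is_derive_edP h; apply/is_derive_edP => e /h[d d0 hd].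
by exists d => // k /hd; rewrite [k *: 1]mulr1 upd_add.
Qed.

Lemma derive_upd j y (F : 'cV[R]_n -> R) (L : R) :
  is_derive (y j ord0) 1 (fun s : R => F (upd j y s)) L ->
  is_derive y (delta_mx j ord0 : 'cV[R]_n) F L.
Proof.
move=> /is_derive_edP h; apply/is_derive_edP => e /h[d d0 hd].
by exists d => // k /hd; rewrite [k *: 1]mulr1 upd_add upd_id.
Qed.

(* U solves dU/dy_j = f(y, U) on the cube with initial value g on the hyperplane y_j = 0; the other
   coordinates are parameters. *)
Definition solves N e j (f : 'cV[R]_n -> 'cV[R]_N -> 'cV[R]_N)
    (g U : 'cV[R]_n -> 'cV[R]_N) : Prop :=
  (forall y, cube e y -> y j ord0 = 0 -> U y = g y) /\
  (forall y, cube e y -> forall i,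
     is_derive y (delta_mx j ord0 : 'cV[R]_n) (fun y => U y i ord0) (f y (U y) i ord0)).

Lemma solves_exist N e (K : R) j (f : 'cV[R]_n -> 'cV[R]_N -> 'cV[R]_N) g :
  0 < e -> 0 <= K -> K * e <= 2^-1 ->
  (forall y, cube e y -> forall u v, `|f y u - f y v| <= K * `|u - v|) ->
  (forall v i, Ck 0 (cube e) (fun y => f y v i ord0)) ->
  exists U, solves e j f g U.
Proof.
move=> e0 K0 Ke lip fc.
have : forall z, exists u : R -> 'cV[R]_N, cube e z -> u 0 = g z /\
    forall t : R, `|t| < e -> forall i,
      is_derive t 1 (fun t => u t i ord0) (f (upd j z t) (u t) i ord0).
  move=> z; have [ze|nze] := pselect (cube e z); last by exists (fun=> 0).
  have [|v t i te|u u0 du] := @ode_exist R N e K (fun t => f (upd j z t)) (g z) e0 K0 Ke.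
  - by move=> t te u v; apply: lip; exact: cube_upd.
  - apply/cont_edP => a a0.
    have := (cont_edP _ _).1 (Ck_cont (fc v i) (cube_upd j ze te)) a a0.
    move=> [d d0 hd]; exists d => // t' t't; apply: hd.
    exact: le_lt_trans (upd_dist_t _ _ _ _) t't.
  - by exists u.
move=> /choice[sol hsol].
(* All points of a line in direction j share the base point [upd j y 0], hence use one and the same
   curve. *)
exists (fun y => sol (upd j y 0) (y j ord0)); split=> y ye.
  move=> y0; have zy : upd j y 0 = y by rewrite -y0 upd_id.
  by rewrite zy y0; have [-> _] := hsol y ye.
move=> i; apply: derive_upd.
have ye0 : cube e (upd j y 0) by apply: cube_upd => //; rewrite normr0.
have [_ /(_ (y j ord0))] := hsol _ ye0.
have yj : `|y j ord0| < e by apply: le_lt_trans ye; exact: cv_coord_le.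
move=> /(_ yj i); rewrite upd_upd upd_id.
by under [X in _ -> is_derive _ _ X _]eq_fun do rewrite upd_upd upd_at.
Qed.

Lemma solves_line N e j f (g U : 'cV[R]_n -> 'cV[R]_N) y (t : R) i :
  solves e j f g U -> cube e (upd j y t) ->
  is_derive t 1 (fun t => U (upd j y t) i ord0) (f (upd j y t) (U (upd j y t)) i ord0).
Proof. by move=> [_ h] ye; exact: upd_derive (h _ ye i). Qed.

Lemma cv_cont_edP (V : normedModType R) N (g : V -> 'cV[R]_N) (t0 : V) (w : R) : 0 < w ->
  (forall i, {for t0, continuous (fun t => g t i ord0)}) ->
  exists2 d : R, 0 < d & forall t : V, `|t - t0| < d -> `|g t - g t0| < w.
Proof.
move=> w0 gc.
have : forall i, exists d : R, 0 < d /\ forall t : V, `|t - t0| < d -> `|g t i ord0 - g t0 i ord0| < w.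
  by move=> i; have [d d0 hd] := (cont_edP _ _).1 (gc i) _ w0; exists d.
move=> /choice[d hd]; exists (\big[Num.min/1]_i d i).
  by apply: lt_bigmin => // i _; have [] := hd i.
move=> t td; apply/cv_norm_ltP => // i; rewrite !mxE; have [_] := hd i; apply.
by apply: lt_le_trans td _; exact: bigmin_le.
Qed.

(** Uniform continuity in a tube around a compact curve, for finitely many functions at once (the
    entries of a matrix). Around g t0 half of the local radius is spent on moving t, the other half
    on leaving the curve. *)
Lemma curve_uniform N (I : finType) (D : set 'cV[R]_N) (h : I -> 'cV[R]_N -> R)
    (g : R -> 'cV[R]_N) (s w : R) :
  open D -> (forall i, Ck 0 D (h i)) ->
  (forall t : R, `|t| <= s -> D (g t) /\ forall i, {for t, continuous (fun t => g t i ord0)}) ->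
  0 < w ->
  exists2 d : R, 0 < d & forall t : R, `|t| <= s -> forall z : 'cV[R]_N, `|z - g t| < d ->
    D z /\ forall i, `|h i z - h i (g t)| < w.
Proof.
move=> oD hc gD w0.
apply: (@segment_uniform R s (fun d t => forall z : 'cV[R]_N, `|z - g t| < d ->
    D z /\ forall i, `|h i z - h i (g t)| < w)).
  by move=> d d' t d'd H z zd; apply: H; exact: lt_le_trans d'd.
move=> t0 t0s; have [Dt0 gc] := gD t0 t0s.
have [d1 d10 h1] := (open_edP _).1 oD _ Dt0.
have w20 : 0 < w / 2 by rewrite divr_gt0.
have : forall i, exists d : R, 0 < d /\ forall z : 'cV[R]_N, `|z - g t0| < d -> `|h i z - h i (g t0)| < w / 2.
  move=> i; have [d d0 hd] := (cont_edP _ _).1 (Ck_cont (hc i) Dt0) _ w20.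
  by exists d.
move=> /choice[d hd]; pose d2 := \big[Num.min/1]_i d i.
have d20 : 0 < d2 by apply: lt_bigmin => // i _; have [] := hd i.
pose m := Num.min d1 d2.
have m0 : 0 < m by rewrite lt_min d10.
have m20 : 0 < m / 2 by rewrite divr_gt0.
have [d3 d30 h3] := cv_cont_edP m20 gc.
exists (Num.min d3 (m / 2)); first by rewrite lt_min d30.
move=> t; rewrite lt_min => /andP[/h3 tm _] z; rewrite lt_min => /andP[_ zt].
have near (z' : 'cV[R]_N) : `|z' - g t0| < m -> D z' /\ forall i, `|h i z' - h i (g t0)| < w / 2.
  rewrite lt_min => /andP[z1 z2]; split; first exact: h1.
  by move=> i; have [_] := hd i; apply; apply: lt_le_trans z2 _; exact: bigmin_le.
have [|ze hz] := near z.
  rewrite -(subrKA (g t)); apply: le_lt_trans (ler_normD _ _) _.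
  by rewrite [ltRHS]splitr; exact: ltrD.
have [|_ hu] := near (g t); first by apply: lt_trans tm _; rewrite ltr_pdivrMr // ltr_pMr // ltr1n.
split=> // i; rewrite -(subrKA (h i (g t0))); apply: le_lt_trans (ler_normD _ _) _.
by rewrite [ltRHS]splitr; apply: ltrD; [exact: hz|rewrite distrC; exact: hu].
Qed.

Lemma line_uniform (I : finType) e j (h : I -> 'cV[R]_n -> R) y0 (s w : R) :
  (forall i, Ck 0 (cube e) (h i)) -> cube e y0 -> s < e -> 0 < w ->
  exists2 d : R, 0 < d & forall t : R, `|t| <= s -> forall z, `|z - upd j y0 t| < d ->
    cube e z /\ forall i, `|h i z - h i (upd j y0 t)| < w.
Proof.
move=> hc ye se; apply: curve_uniform hc _; first exact: open_cube.
move=> t ts; split; first by apply: cube_upd => //; exact: le_lt_trans se.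
move=> i; apply/cont_edP => a a0; exists a => // t' tt'.
have := cv_coord_le (upd j y0 t' - upd j y0 t) i; rewrite !mxE => /le_lt_trans; apply.
exact: le_lt_trans (upd_dist_t _ _ _ _) tt'.
Qed.

Lemma mulmx_norm_le p N (A : 'M[R]_(p, N)) (v : 'cV[R]_N) (a : R) : 0 <= a ->
  (forall i l, `|A i l| <= a) -> `|A *m v| <= N%:R * a * `|v|.
Proof.
move=> a0 h; apply/cv_norm_leP; first by rewrite !mulr_ge0.
move=> i; rewrite mxE; apply: le_trans (ler_norm_sum _ _ _) _.
have -> : N%:R * a * `|v| = \sum_(l < N) a * `|v|.
  by rewrite sumr_const card_ord -mulrA mulr_natl.
by apply: ler_sum => l _; rewrite normrM ler_pM // cv_coord_le.
Qed.

Lemma line_taylor (V : normedModType R) (F : V -> R) (z v : V) (h a w : R) :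
  (forall c : R, `|c| <= `|h| -> derivable F (z + c *: v) v /\ `|'D_v F (z + c *: v) - a| <= w) ->
  `|F (z + h *: v) - F z - h * a| <= w * `|h|.
Proof.
move=> H.
have inn c : Num.min 0 h <= c <= Num.max 0 h -> `|c| <= `|h|.
  by case: (leP 0 h) => [h0|/ltW h0] /andP[? ?];
    rewrite ?(ger0_norm h0) ?(ler0_norm h0) ler_norml; apply/andP; split; lra.
have [|c /inn/H[_ hc]] := @mvt0 R (fun s => F (z + s *: v)) (fun s => 'D_v F (z + s *: v)) h.
  by move=> s /inn/H[ds _]; exact: line_is_derive.
by rewrite scale0r addr0 => ->; rewrite [h * a]mulrC -mulrBl normrM ler_wpM2r.
Qed.

Definition affine N (A : 'cV[R]_n -> 'M[R]_N) (b : 'cV[R]_n -> 'cV[R]_N)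
  (y : 'cV[R]_n) (v : 'cV[R]_N) : 'cV[R]_N := A y *m v + b y.

Section Affine.
Context {N : nat} (e K : R) (j : 'I_n).
Hypotheses (e0 : 0 < e) (K0 : 0 <= K) (Ke : K * e <= 2^-1).
Variable A : 'cV[R]_n -> 'M[R]_N.
Hypothesis AK : forall y, cube e y -> forall v : 'cV[R]_N, `|A y *m v| <= K * `|v|.

Let Ks s : 0 <= s -> s < e -> K * s <= 2^-1.
Proof. by move=> s0 /ltW se; apply: le_trans Ke; rewrite ler_wpM2l. Qed.

Lemma affine_cont k (b : 'cV[R]_n -> 'cV[R]_N) :
  (forall i l, Ck k (cube e) (fun y => A y i l)) ->
  (forall i, Ck k (cube e) (fun y => b y i ord0)) ->
  forall v i, Ck k (cube e) (fun y => affine A b y v i ord0).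
Proof.
move=> Ak bk v i.
apply: (@Ck_ext _ _ _ _ (fun y => \sum_l A y i l * v l ord0 + b y i ord0)).
- exact: open_cube.
- by move=> z _; rewrite !mxE.
- apply: Ck_add => //; first exact: open_cube.
  apply: Ck_sum => [|l _]; first exact: open_cube.
  by apply: Ck_mul => //; [exact: open_cube|exact: Ck_cst].
Qed.

Lemma affine_exist (b g : 'cV[R]_n -> 'cV[R]_N) :
  (forall i l, Ck 0 (cube e) (fun y => A y i l)) ->
  (forall i, Ck 0 (cube e) (fun y => b y i ord0)) ->
  exists U, solves e j (affine A b) g U.
Proof.
move=> Ac bc; apply: (solves_exist j g e0 K0 Ke).
  by move=> y ye u v; rewrite /affine opprD addrACA subrr addr0 -mulmxBr; exact: AK.
exact: affine_cont.
Qed.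

(** The solutions on the lines through y and y0 differ by a solution of an affine equation with
    bounded matrix and small source, to which [ode_est] applies; displacement along the line of y0
    itself is continuity in time. *)
Lemma affine_sol_cont (b g U : 'cV[R]_n -> 'cV[R]_N) :
  (forall i l, Ck 0 (cube e) (fun y => A y i l)) ->
  (forall i, Ck 0 (cube e) (fun y => b y i ord0)) ->
  (forall i, Ck 0 (cube e) (fun y => g y i ord0)) ->
  solves e j (affine A b) g U -> forall i, Ck 0 (cube e) (fun y => U y i ord0).
Proof.
move=> Ac bc gc solU i; split=> // y0 ye; apply/cont_edP => a a0.
pose s := (`|y0| + e) / 2.
have [y0s s0 se] : [/\ `|y0| < s, 0 < s & s < e].
  by rewrite /s; have := normr_ge0 y0; move: ye; rewrite /cube /= => ?; split; lra.
have [|M M0 hM] := @line_bounded R N (fun t => U (upd j y0 t)) s.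
  move=> t ts l; apply: is_derive_cont (solves_line l solU _).
  by apply: cube_upd => //; exact: le_lt_trans se.
(* [C * w] is what [ode_est] yields when coefficients and initial values vary by at most w; [M]
   bounds U on the line of y0. *)
pose C := 2 * (1 + s * (N%:R * M + 1)).
have C0 : 0 < C by rewrite mulr_gt0 // ltr_pwDl // mulr_ge0 ?(ltW s0) // addr_ge0 // mulr_ge0.
pose w := a / 2 / C; have w0 : 0 < w by rewrite !divr_gt0.
have [d1 d10 h1] := @line_uniform _ e j
   (fun p : 'I_N * 'I_N => fun y => A y p.1 p.2) y0 s w (fun p => Ac p.1 p.2) ye se w0.
have [d2 d20 h2] := @line_uniform _ e j (fun l => fun y => b y l ord0) y0 s w bc ye se w0.
have [d3 d30 h3] := @line_uniform _ e j (fun l => fun y => g y l ord0) y0 s w gc ye se w0.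
have [_ /(_ y0 ye i) dUi] := solU.
have a20 : 0 < a / 2 by rewrite divr_gt0.
have yj0 : `|y0 j ord0| <= `|y0| by exact: cv_coord_le.
have [d4 d40 h4] : exists2 d : R, 0 < d & forall t : R, `|t - y0 j ord0| < d -> `|U (upd j y0 t) i ord0 -
    U y0 i ord0| < a / 2.
  have dl := solves_line i solU (_ : cube e (upd j y0 (y0 j ord0))).
  have [] := (cont_edP _ _).1 (is_derive_cont (dl _)) _ a20.
    by rewrite upd_id.
  by rewrite upd_id => d d0 hd; exists d.
exists (Num.min (Num.min d1 d2) (Num.min d3 (Num.min d4 (s - `|y0|)))).
  by rewrite !lt_min d10 d20 d30 d40 subr_gt0.
move=> y; rewrite !lt_min => /andP[/andP[y1 y2] /and3P[y3 y4 y5]].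
have ys : `|y j ord0| <= s.
  apply: le_trans (cv_coord_le _ _) _; rewrite -[y](subrK y0).
  by apply: le_trans (ler_normD _ _) _; rewrite -lerBrDr ltW.
have near t := le_lt_trans (upd_dist j y y0 t).
have ute t : `|t| <= s -> cube e (upd j y0 t) by move=> ts; apply: cube_upd => //; exact: le_lt_trans se.
have est := @ode_est R N (fun t => U (upd j y t) - U (upd j y0 t))
   (fun t => affine A b (upd j y t) (U (upd j y t)) - affine A b (upd j y0 t) (U (upd j y0 t)))
   s K (w * (N%:R * M + 1)) (ltW s0) K0 (Ks (ltW s0) se) _ _ _ (y j ord0) ys.
rewrite -(subrKA (U (upd j y0 (y j ord0)) i ord0)).
apply: le_lt_trans (ler_normD _ _) _; rewrite [ltRHS]splitr; apply: ler_ltD; last first.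
  by apply: h4; have := cv_coord_le (y - y0) j; rewrite !mxE => /le_lt_trans; apply.
have {est} : `|U (upd j y (y j ord0)) - U (upd j y0 (y j ord0))| <= 2 * (`|U (upd j y 0) - U (upd j y0
    0)| + s * (w * (N%:R * M + 1))).
  apply: est.
  - by rewrite mulr_ge0 ?(ltW w0) // addr_ge0 // mulr_ge0.
  - move=> t ts l.
    have e1 : (fun t0 => (U (upd j y t0) - U (upd j y0 t0)) l ord0) =
       (fun t0 => U (upd j y t0) l ord0 - U (upd j y0 t0) l ord0) by apply/funext => x; rewrite !mxE.
    rewrite e1 [X in is_derive _ _ _ X]mxE [X in _ + X]mxE.
    apply: is_deriveB; apply: solves_line solU _; last exact: ute.
    by have [] := h1 t ts (upd j y t) (near _ _ y1).
  - move=> t ts.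
    have -> : affine A b (upd j y t) (U (upd j y t)) - affine A b (upd j y0 t) (U (upd j y0 t)) =
      A (upd j y t) *m (U (upd j y t) - U (upd j y0 t)) +
      ((A (upd j y t) - A (upd j y0 t)) *m U (upd j y0 t) + (b (upd j y t) - b (upd j y0 t))).
      rewrite /affine mulmxBr mulmxBl opprD !addrA; congr (_ - _).
      by rewrite [RHS]addrAC subrK addrAC.
    have [ze hA] := h1 t ts (upd j y t) (near _ _ y1).
    have [_ hb] := h2 t ts (upd j y t) (near _ _ y2).
    apply: le_trans (ler_normD _ _) _; apply: lerD; first exact: AK.
    apply: le_trans (ler_normD _ _) _; rewrite mulrDr mulr1; apply: lerD; last first.
      by apply/cv_norm_leP; [exact: ltW|move=> l; rewrite !mxE; apply/ltW/hb].
    apply: le_trans (mulmx_norm_le _ (ltW w0) _) _.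
      by move=> p q; rewrite !mxE; apply/ltW/(hA (p, q)).
    rewrite (_ : _ * _ * _ = w * (N%:R * `|U (upd j y0 t)|)); last by ring.
    by rewrite ler_wpM2l ?(ltW w0) // ler_wpM2l //; exact: hM.
rewrite upd_id => /(le_trans (cv_coord_le _ i)); rewrite !mxE => /le_trans; apply.
have zs : `|0 : R| <= s by rewrite normr0 ltW.
have [z3 hg] := h3 0 zs (upd j y 0) (near _ _ y3).
have [solU0 _] := solU.
rewrite (solU0 _ z3) ?upd_at // (solU0 _ (ute 0 zs)) ?upd_at //.
have : `|g (upd j y 0) - g (upd j y0 0)| <= w.
  by apply/cv_norm_leP; [exact: ltW|move=> l; rewrite !mxE; apply/ltW/hg].
move=> hg'; apply: (@le_trans _ _ (C * w)); last by rewrite mulrC divfK // gt_eqF.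
rewrite /C -mulrA ler_wpM2l // mulrDl mul1r; apply: lerD => //.
by rewrite -mulrA [_ * w]mulrC.
Qed.

(* W solves the variational equation. *)
Lemma affine_sol_partial (l : 'I_n) (b g U W : 'cV[R]_n -> 'cV[R]_N) : l != j ->
  (forall i k, Ck 1 (cube e) (fun y => A y i k)) ->
  (forall i, Ck 1 (cube e) (fun y => b y i ord0)) ->
  (forall i, Ck 1 (cube e) (fun y => g y i ord0)) ->
  solves e j (affine A b) g U ->
  solves e j (affine A (fun y =>
       (\matrix_(i, k) partial l (fun y => A y i k) y) *m U y +
       \col_i partial l (fun y => b y i ord0) y))
     (fun y => \col_i partial l (fun y => g y i ord0) y) W ->
  forall y, cube e y -> forall i,
    is_derive y (delta_mx l ord0 : 'cV[R]_n) (fun y => U y i ord0) (W y i ord0).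
Proof.
move=> lj A1 b1 g1 solU solW y0 ye i.
set dA := fun y => \matrix_(i, k) partial l (fun y => A y i k) y in solW.
set db := fun y => \col_i partial l (fun y => b y i ord0) y in solW.
pose s := (`|y0| + e) / 2.
have [y0s s0 se] : [/\ `|y0| < s, 0 < s & s < e].
  by rewrite /s; have := normr_ge0 y0; move: ye; rewrite /cube /= => ?; split; lra.
have ute t : `|t| <= s -> cube e (upd j y0 t) by move=> ts; apply: cube_upd => //; exact: le_lt_trans se.
have [|M M0 hM] := @line_bounded R N (fun t => U (upd j y0 t)) s.
  by move=> t ts k; apply: is_derive_cont (solves_line k solU (ute t ts)).
have [|M' M'0 hM'] := @line_bounded R N (fun t => W (upd j y0 t)) s.
  by move=> t ts k; apply: is_derive_cont (solves_line k solW (ute t ts)).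
apply/is_derive_edP => a a0.
(* The outer 1 pays for the initial value, [M'] for the variation of A against W, [M] for the Taylor
   error of A against U, and the last 1 for that of b. *)
pose C := 2 * (1 + s * (N%:R * M' + (N%:R * M + 1))).
have C0 : 0 < C by rewrite mulr_gt0 // ltr_pwDl // mulr_ge0 ?(ltW s0) // !addr_ge0 // mulr_ge0.
pose w := a / C; have w0 : 0 < w by rewrite divr_gt0.
have [d1 d10 h1] := @line_uniform _ e j
   (fun p : 'I_N * 'I_N => fun y => A y p.1 p.2) y0 s w (fun p => Ck_le (leq0n 1) (A1 p.1 p.2)) ye se w0.
have [d2 d20 h2] := @line_uniform _ e j
   (fun p : 'I_N * 'I_N => partial l (fun y => A y p.1 p.2)) y0 s w (fun p => Ck_partial l (A1 p.1 p.2)) ye se w0.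
have [d3 d30 h3] := @line_uniform _ e j
   (fun p : 'I_N => partial l (fun y => b y p ord0)) y0 s w (fun p => Ck_partial l (b1 p)) ye se w0.
have [d4 d40 h4] := @line_uniform _ e j
   (fun p : 'I_N => partial l (fun y => g y p ord0)) y0 s w (fun p => Ck_partial l (g1 p)) ye se w0.
exists (Num.min (Num.min d1 d2) (Num.min d3 d4)).
  by rewrite !lt_min d10 d20 d30 d40.
move=> h; rewrite !lt_min => /andP[/andP[hd1 hd2] /andP[hd3 hd4]].
pose el : 'cV[R]_n := delta_mx l ord0.
have nel : `|el| <= 1.
  by apply/cv_norm_leP => // k; rewrite mxE andbT; case: eqP; rewrite ?normr1 ?normr0.
have nearc (c d : R) t : `|c| < d -> `|upd j y0 t + c *: el - upd j y0 t| < d.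
  move=> cd; rewrite addrC addKr normrZ; apply: le_lt_trans cd.
  by rewrite -[leRHS]mulr1 ler_wpM2l.
have ys : `|y0 j ord0| <= s by apply: le_trans (cv_coord_le _ _) (ltW y0s).
have shE t : upd j (y0 + h *: el) t = upd j y0 t + h *: el by rewrite upd_shift.
(* The first order remainder solves an affine equation along the line whose source and initial value
   are bounded by multiples of w |h|. *)
have est := @ode_est R N (fun t => U (upd j (y0 + h *: el) t) - U (upd j y0 t) - h *: W (upd j y0 t))
   (fun t => affine A b (upd j (y0 + h *: el) t) (U (upd j (y0 + h *: el) t)) - affine A b (upd j y0 t)
       (U (upd j y0 t))
      - h *: affine A (fun y => dA y *m U y + db y) (upd j y0 t) (W (upd j y0 t)))
   s K (`|h| * w * (N%:R * M' + (N%:R * M + 1))) (ltW s0) K0 (Ks (ltW s0) se) _ _ _ (y0 j ord0) ys.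
have {est} := est _ _ _.
rewrite upd_id upd_shift // upd_id => est.
apply: (@le_trans _ _ (`|U (y0 + h *: el) - U y0 - h *: W y0|)).
  by have := cv_coord_le (U (y0 + h *: el) - U y0 - h *: W y0) i; rewrite !mxE.
apply: (le_trans (est _ _ _)) => {est}.
- by apply: mulr_ge0; [rewrite mulr_ge0 // ltW|rewrite !addr_ge0 // mulr_ge0].
- move=> t ts k.
  have e1 : (fun t0 => (U (upd j (y0 + h *: el) t0) - U (upd j y0 t0) - h *: W (upd j y0 t0)) k ord0) =
     (fun t0 => U (upd j (y0 + h *: el) t0) k ord0 - U (upd j y0 t0) k ord0 - h * W (upd j y0 t0) k ord0).
    by apply/funext => x; rewrite !mxE.
  have e2 (u v x : 'cV[R]_N) : (u - v - h *: x) k ord0 = u k ord0 - v k ord0 - h * x k ord0.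
    by rewrite !mxE.
  rewrite e1 e2.
  have zc : cube e (upd j (y0 + h *: el) t).
    by rewrite shE; have [] := h1 t ts (upd j y0 t + h *: el) (nearc _ _ _ hd1).
  apply: is_deriveB; first apply: is_deriveB.
  + exact: solves_line solU zc.
  + exact: solves_line solU (ute t ts).
  + by apply: (is_deriveZ h); exact: solves_line solW (ute t ts).
- move=> t ts; rewrite shE; set z := upd j y0 t; set z' := z + h *: el.
  have [zc hA] := h1 t ts z' (nearc _ _ _ hd1).
  have -> : affine A b z' (U z') - affine A b z (U z) - h *: affine A (fun y => dA y *m U y + db y) z (W z) =
     A z' *m (U z' - U z - h *: W z) + ((A z' - A z) *m (h *: W z) +
      ((A z' - A z - h *: dA z) *m U z + (b z' - b z - h *: db z))).
    rewrite /affine !mulmxBr !mulmxBl -!scalemxAr -!scalemxAl !scalerDr.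
    set p1 := A z' *m U z'; set p2 := A z' *m U z; set p3 := A z *m U z.
    set p4 := h *: (A z' *m W z); set p5 := h *: (A z *m W z).
    set p6 := h *: (dA z *m U z); set p7 := h *: db z.
    by apply/colP => k; rewrite !mxE; ring.
  apply: le_trans (ler_normD _ _) _; apply: lerD; first exact: AK.
  rewrite mulrDr; apply: le_trans (ler_normD _ _) _; apply: lerD.
    apply: le_trans (mulmx_norm_le _ (ltW w0) _) _.
      by move=> p q; rewrite !mxE; apply/ltW/(hA (p, q)).
    rewrite normrZ (_ : N%:R * w * (`|h| * `|W z|) = `|h| * w * (N%:R * `|W z|)); last by ring.
    by apply: ler_wpM2l; [rewrite mulr_ge0 // ltW|apply: ler_wpM2l => //; exact: hM'].
  rewrite mulrDr mulr1; apply: le_trans (ler_normD _ _) _; apply: lerD.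
    have wh : 0 <= w * `|h| by rewrite mulr_ge0 ?(ltW w0).
    apply: le_trans (mulmx_norm_le _ wh _) _.
      move=> p q; rewrite !mxE; apply: (@line_taylor _ (fun y => A y p q) z el) => c ch.
      have [zc2 hA2] := h2 t ts (z + c *: el) (nearc _ _ _ (le_lt_trans ch hd2)).
      by split; [exact: Ck_derivable (A1 p q) zc2|apply/ltW/(hA2 (p, q))].
    rewrite (_ : N%:R * (w * `|h|) * `|U z| = `|h| * w * (N%:R * `|U z|)); last by ring.
    by apply: ler_wpM2l; [rewrite mulr_ge0 // ltW|apply: ler_wpM2l => //; exact: hM].
  rewrite mulrC; apply/cv_norm_leP; first by rewrite mulr_ge0 ?(ltW w0).
  move=> p; rewrite !mxE; apply: (@line_taylor _ (fun y => b y p ord0) z el) => c ch.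
  have [zc2 hb2] := h3 t ts (z + c *: el) (nearc _ _ _ (le_lt_trans ch hd3)).
  by split; [exact: Ck_derivable (b1 p) zc2|apply/ltW/(hb2 p)].
have zs : `|0 : R| <= s by rewrite normr0 ltW.
have [solU0 _] := solU; have [solW0 _] := solW.
have [zc _] := h4 0 zs (upd j y0 0 + h *: el) (nearc _ _ _ hd4).
rewrite (solU0 (upd j (y0 + h *: el) 0)) ?upd_at //; last by rewrite shE.
rewrite (solU0 _ (ute 0 zs)) ?upd_at // (solW0 _ (ute 0 zs)) ?upd_at // shE.
have hg : `|g (upd j y0 0 + h *: el) - g (upd j y0 0) - h *: (\col_i partial l (fun y => g y i ord0) (upd
    j y0 0))| <= w * `|h|.
  apply/cv_norm_leP; first by rewrite mulr_ge0 ?(ltW w0).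
  move=> p; rewrite !mxE; apply: (@line_taylor _ (fun y => g y p ord0) (upd j y0 0) el) => c ch.
  have [zc2 hg2] := h4 0 zs (upd j y0 0 + c *: el) (nearc _ _ _ (le_lt_trans ch hd4)).
  by split; [exact: Ck_derivable (g1 p) zc2|apply/ltW/(hg2 p)].
have aE : a = C * w by rewrite /w mulrC divfK // gt_eqF.
rewrite (_ : a * `|h| = 2 * (w * `|h| + s * (`|h| * w * (N%:R * M' + (N%:R * M + 1))))).
  by apply: ler_wpM2l => //; apply: lerD.
by rewrite {1}aE /C; ring.
Qed.

(** In a parameter direction the derivative of U solves an affine equation with the same matrix A,
    only the source and the initial value change; so the bound on A, and with it the cube, is the
    same for all k. In direction j the equation itself gives the derivative. *)
Lemma affine_sol_Ck k (b g U : 'cV[R]_n -> 'cV[R]_N) :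
  (forall i l, Ck k (cube e) (fun y => A y i l)) ->
  (forall i, Ck k (cube e) (fun y => b y i ord0)) ->
  (forall i, Ck k (cube e) (fun y => g y i ord0)) ->
  solves e j (affine A b) g U -> forall i, Ck k (cube e) (fun y => U y i ord0).
Proof.
elim: k b g U => [|k IH] b g U Ak bk gk solU i; first exact: affine_sol_cont solU i.
have Uk : forall i, Ck k (cube e) (fun y => U y i ord0).
  apply: (IH b g) => //.
  - by move=> p q; apply: Ck_le (Ak p q).
  - by move=> p; apply: Ck_le (bk p).
  - by move=> p; apply: Ck_le (gk p).
have oc := @open_cube e.
split; first by move=> x Dx; exact: Ck_cont (Uk i) Dx.
move=> l; have [->|lj] := eqVneq l j.
  have [_ dU] := solU.
  split; first by move=> x Dx; have [] := dU x Dx i.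
  apply: (@Ck_ext _ _ _ _ (fun y => \sum_l A y i l * U y l ord0 + b y i ord0)) => //.
    move=> x; rewrite inE => Dx; have [_ h] := dU x Dx i.
    by rewrite /partial h !mxE.
  apply: Ck_add => //; last by apply: Ck_le (bk i).
  by apply: Ck_sum => // q _; apply: Ck_mul => //; apply: Ck_le (Ak i q).
pose b' y : 'cV[R]_N := (\matrix_(i, k) partial l (fun y => A y i k) y) *m U y +
       \col_i partial l (fun y => b y i ord0) y.
pose g' y : 'cV[R]_N := \col_i partial l (fun y => g y i ord0) y.
have b'k : forall i, Ck k (cube e) (fun y => b' y i ord0).
  move=> p; apply: (@Ck_ext _ _ _ _ (fun y => \sum_q partial l (fun y => A y p q) y * U y q ord0
       + partial l (fun y => b y p ord0) y)) => //.
    by move=> x _; rewrite !mxE; congr (_ + _); apply: eq_bigr => q _; rewrite !mxE.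
  apply: Ck_add => //; last exact: Ck_partial.
  by apply: Ck_sum => // q _; apply: Ck_mul => //; exact: Ck_partial.
have g'k : forall i, Ck k (cube e) (fun y => g' y i ord0).
  move=> p; apply: (@Ck_ext _ _ _ _ (partial l (fun y => g y p ord0))) => //.
    by move=> x _; rewrite !mxE.
  exact: Ck_partial.
have Ak' : forall i l, Ck k (cube e) (fun y => A y i l) by move=> p q; apply: Ck_le (Ak p q).
have [||W solW] := @affine_exist b' g'.
  by move=> p q; apply: Ck_le (Ak p q).
  by move=> p; apply: Ck_le (b'k p).
have dU := affine_sol_partial lj (fun p q => Ck_le (isT : (1 <= k.+1)%N) (Ak p q))
   (fun p => Ck_le (isT : (1 <= k.+1)%N) (bk p)) (fun p => Ck_le (isT : (1 <= k.+1)%N) (gk p)) solU solW.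
split; first by move=> x Dx; have [] := dU x Dx i.
apply: Ck_ext oc _ (IH b' g' W Ak' b'k g'k solW i).
by move=> x; rewrite inE => Dx; have [_ h] := dU x Dx i; rewrite /partial h.
Qed.

End Affine.

End ParametricODE.

(** * Flows *)

Section Flow.
Context {R : realType}.

Lemma locally_bounded N (I : finType) (D : set 'cV[R]_N) (h : I -> 'cV[R]_N -> R) z0 :
  open D -> (forall i, Ck 0 D (h i)) -> D z0 ->
  exists d C : R, [/\ 0 < d, 0 < C & forall z : 'cV[R]_N, `|z - z0| < d -> D z /\ forall i, `|h i z| <= C].
Proof.
move=> oD hc Dz.
have [d1 d10 h1] := (open_edP _).1 oD _ Dz.
have : forall i, exists d : R, 0 < d /\ forall z : 'cV[R]_N, `|z - z0| < d -> `|h i z - h i z0| < 1.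
  by move=> i; have [d d0 hd] := (cont_edP _ _).1 (Ck_cont (hc i) Dz) _ ltr01; exists d.
move=> /choice[d hd]; exists (Num.min d1 (\big[Num.min/1]_i d i)), (1 + \sum_i `|h i z0|).
have S0 : 0 <= \sum_i `|h i z0| by apply: sumr_ge0.
split; last move=> z; rewrite ?lt_min ?d10 /=.
- by apply: lt_bigmin => // i _; have [] := hd i.
- by rewrite ltr_pwDl.
- move=> /andP[/h1 Dz' z2]; split=> // i.
  rewrite -[h i z](subrK (h i z0)); apply: le_trans (ler_normD _ _) _; apply: lerD.
    by have [_ H] := hd i; apply/ltW/H; apply: lt_le_trans z2 _; exact: bigmin_le.
  by rewrite (bigD1 i) //= lerDl sumr_ge0.
Qed.

Lemma smooth_cv n (D : set 'cV[R]_n) N (F : 'cV[R]_n -> 'cV[R]_N) :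
  smooth_mx D F <-> forall i, smooth D (fun x => F x i ord0).
Proof. by split=> [h i|h i j]; [exact: h|rewrite ord1; exact: h]. Qed.

Lemma clamp_scalar (a r x y : R) : 0 <= r ->
  let c z := Num.max (a - r) (Num.min (a + r) z) in
  [/\ `|c x - a| <= r, `|c x - c y| <= `|x - y| & `|x - a| <= r -> c x = x].
Proof.
move=> r0 c.
have P z : [/\ a - r <= c z, c z <= a + r & [\/ c z = z, c z = a - r /\ z <= a - r | c z = a + r /\ a + r <= z]].
  rewrite /c; case: (leP (a + r) z) => h1; last case: (leP (a - r) z) => h2.
  - by rewrite max_r; last lra; split; [lra|lra|constructor 3].
  - by split; try lra; constructor 1.
  - by split; try lra; constructor 2; split; lra.
have [x1 x2 x3] := P x; have [y1 y2 y3] := P y.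
split.
- by rewrite ler_norml; apply/andP; split; lra.
- move: x3 y3; set u := c x in x1 x2 *; set v := c y in y1 y2 *.
  case=> [ux|[ux hx]|[ux hx]]; case=> [vy|[vy hy]|[vy hy]];
   case: (leP 0 (x - y)) => h; rewrite ?(ger0_norm h) ?(ltr0_norm h) ler_norml; apply/andP; split; lra.
- rewrite ler_norml => /andP[? ?]; case: x3 => [//|[? ?]|[? ?]]; lra.
Qed.

(** [ode_est] without source term. This Lipschitz dependence on the initial value precedes any
    differentiability of U and is what makes the linearization error quadratically small. *)
Lemma flow_sol_est n N e (K : R) j (B : set 'cV[R]_N) (X : 'cV[R]_N -> 'cV[R]_N) (g U : 'cV[R]_n -> 'cV[R]_N) :
  0 <= K -> K * e <= 2^-1 ->
  (forall u v, B u -> B v -> `|X u - X v| <= K * `|u - v|) ->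
  (forall y, cube e y -> B (U y)) ->
  solves e j (fun _ u => X u) g U ->
  forall (s : R) y y', 0 <= s -> s < e -> cube e y ->
  (forall t : R, `|t| <= s -> cube e (upd j y' t)) ->
  forall t : R, `|t| <= s -> `|U (upd j y' t) - U (upd j y t)| <= 2 * `|g (upd j y' 0) - g (upd j y 0)|.
Proof.
move=> K0 Ke lip UB solU s y y' s0 se ye y'e t ts.
have ute u : `|u| <= s -> cube e (upd j y u) by move=> us; apply: cube_upd => //; exact: le_lt_trans se.
have zs : `|0 : R| <= s by rewrite normr0.
have [solU0 _] := solU.
have := @ode_est R N (fun t => U (upd j y' t) - U (upd j y t))
   (fun t => X (U (upd j y' t)) - X (U (upd j y t))) s K 0 s0 K0 _ (lexx 0) _ _ t ts.
rewrite mulr0 addr0 (solU0 _ (y'e 0 zs)) ?upd_at // (solU0 _ (ute 0 zs)) ?upd_at //; apply.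
- by apply: le_trans Ke; rewrite ler_wpM2l // ltW.
- move=> u us i.
  have e1 : (fun t0 => (U (upd j y' t0) - U (upd j y t0)) i ord0) =
       (fun t0 => U (upd j y' t0) i ord0 - U (upd j y t0) i ord0) by apply/funext => x; rewrite !mxE.
  have e2 (p q : 'cV[R]_N) : (p - q) i ord0 = p i ord0 - q i ord0 by rewrite !mxE.
  rewrite e1 e2.
  by apply: is_deriveB; [exact: solves_line solU (y'e u us)|exact: solves_line solU (ute u us)].
- by move=> u us; rewrite addr0; apply: lip; apply: UB; [exact: y'e|exact: ute].
Qed.

(** * Smooth dependence of a flow on its initial data *)

Section Smoothness.
Context {n N : nat} (e C : R) (j : 'I_n) (D : set 'cV[R]_N) (z0 : 'cV[R]_N) (r : R)
  (X : 'cV[R]_N -> 'cV[R]_N) (g U : 'cV[R]_n -> 'cV[R]_N).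
Hypotheses (e0 : 0 < e) (C0 : 0 <= C) (Ke : N%:R * C * e <= 2^-1) (oD : open D)
  (Xs : forall i, smooth D (fun z => X z i ord0))
  (gs : forall i, smooth (cube e) (fun y => g y i ord0))
  (BD : forall z : 'cV[R]_N, `|z - z0| < r -> D z)
  (BX : forall z : 'cV[R]_N, `|z - z0| < r -> forall i k, `|partial k (fun z => X z i ord0) z| <= C)
  (UB : forall y, cube e y -> `|U y - z0| < r)
  (solU : solves e j (fun _ u => X u) g U).

Let K := N%:R * C.
Let K0 : 0 <= K. Proof. by rewrite mulr_ge0. Qed.

Lemma flow_lip u v : `|u - z0| < r -> `|v - z0| < r -> `|X u - X v| <= K * `|u - v|.
Proof.
move=> ur vr; apply/cv_norm_leP; first by rewrite mulr_ge0.
move=> i; rewrite !mxE.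
have := @partial_mvt R N (fun z => X z i ord0) z0 v u r (fun=> 0) C _ vr ur.
rewrite big1 ?subr0; last by move=> k _; rewrite mul0r.
apply=> z zr k; rewrite subr0; split; last exact: BX.
by apply: Ck_derivable (Xs i 1) _; exact: BD.
Qed.

Let est := @flow_sol_est n N e K j (fun z => `|z - z0| < r) X g U K0 Ke flow_lip UB solU.

Lemma flow_sol_cont i : Ck 0 (cube e) (fun y => U y i ord0).
Proof.
split=> // y0 ye; apply/cont_edP => a a0.
pose s := (`|y0| + e) / 2.
have [y0s s0 se] : [/\ `|y0| < s, 0 < s & s < e].
  by rewrite /s; have := normr_ge0 y0; move: ye; rewrite /cube /= => ?; split; lra.
have a40 : 0 < a / 4 by rewrite divr_gt0.
have a20 : 0 < a / 2 by rewrite divr_gt0.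
have gc i' := gs i' 0.
have [d3 d30 h3] := @line_uniform R n _ e j (fun l => fun y => g y l ord0) y0 s (a / 4 / 2) gc ye se
    (divr_gt0 a40 (ltr0n _ 2)).
have [d4 d40 h4] : exists2 d : R, 0 < d & forall t : R, `|t - y0 j ord0| < d -> `|U (upd j y0 t) i ord0 -
    U y0 i ord0| < a / 2.
  have dl := solves_line i solU (_ : cube e (upd j y0 (y0 j ord0))).
  have [] := (cont_edP _ _).1 (is_derive_cont (dl _)) _ a20.
    by rewrite upd_id.
  by rewrite upd_id => d d0 hd; exists d.
exists (Num.min d3 (Num.min d4 (s - `|y0|))).
  by rewrite !lt_min d30 d40 subr_gt0.
move=> y; rewrite !lt_min => /and3P[y3 y4 y5].
have ys' : `|y| < s.
  rewrite -[y](subrK y0).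
  by apply: le_lt_trans (ler_normD _ _) _; rewrite -ltrBrDr.
have ys : `|y j ord0| <= s by apply: le_trans (cv_coord_le _ _) (ltW ys').
have ye' : cube e y by apply: lt_trans ys' se.
rewrite -(subrKA (U (upd j y0 (y j ord0)) i ord0)).
apply: le_lt_trans (ler_normD _ _) _; rewrite [ltRHS]splitr; apply: ltrD; last first.
  by apply: h4; have := cv_coord_le (y - y0) j; rewrite !mxE => /le_lt_trans; apply.
have ute t : `|t| <= s -> cube e (upd j y t) by move=> ts; apply: cube_upd => //; exact: le_lt_trans se.
have := est (ltW s0) se ye ute ys; rewrite upd_id => /(le_trans (cv_coord_le _ i)).
rewrite [X in `|X| <= _]mxE [X in `|_ + X| <= _]mxE => /le_lt_trans; apply.
have zs : `|0 : R| <= s by rewrite normr0 ltW.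
have [_ hg] := h3 0 zs (upd j y 0) (le_lt_trans (upd_dist j y y0 0) y3).
apply: (@le_lt_trans _ _ (2 * (a / 4 / 2))); last by lra.
apply: ler_wpM2l => //; apply/cv_norm_leP; first by rewrite !divr_ge0 // ltW.
by move=> l; rewrite !mxE; apply/ltW/hg.
Qed.

Let A y : 'M[R]_N := \matrix_(i, k) partial k (fun z => X z i ord0) (U y).

Lemma flow_A_bound y : cube e y -> forall v : 'cV[R]_N, `|A y *m v| <= K * `|v|.
Proof.
by move=> ye v; apply: mulmx_norm_le => // i k; rewrite mxE; apply: BX; exact: UB.
Qed.

Lemma flow_A_Ck k : (forall i, Ck k (cube e) (fun y => U y i ord0)) ->
  forall i l, Ck k (cube e) (fun y => A y i l).
Proof.
move=> Uk i l.
apply: (@Ck_ext _ _ _ _ (fun y => partial l (fun z => X z i ord0) (U y))).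
- exact: open_cube.
- by move=> y _; rewrite mxE.
- apply: (@Ck_comp R n N k (cube e) D _ U) => //; first exact: open_cube.
    by apply: Ck_partial; exact: Xs.
  by move=> y ye; apply: BD; exact: UB.
Qed.

(** The first order remainder satisfies the equation linearized along U up to X p - X q - A (p - q).
    This is small compared with |p - q| by the mean value estimate for X, and |p - q| = O(h) by
    [est]. *)
Lemma flow_sol_partial (l : 'I_n) (W : 'cV[R]_n -> 'cV[R]_N) : l != j ->
  solves e j (affine A (fun=> 0)) (fun y => \col_i partial l (fun y => g y i ord0) y) W ->
  forall y, cube e y -> forall i,
    is_derive y (delta_mx l ord0 : 'cV[R]_n) (fun y => U y i ord0) (W y i ord0).
Proof.
move=> lj solW y0 ye i.
pose s := (`|y0| + e) / 2.
have [y0s s0 se] : [/\ `|y0| < s, 0 < s & s < e].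
  by rewrite /s; have := normr_ge0 y0; move: ye; rewrite /cube /= => ?; split; lra.
have ute t : `|t| <= s -> cube e (upd j y0 t) by move=> ts; apply: cube_upd => //; exact: le_lt_trans se.
have zs : `|0 : R| <= s by rewrite normr0 ltW.
apply/is_derive_edP => a a0.
(* [L] is a Lipschitz constant of g at the base point of the line; the two curves to be compared are
   then at most 2 L |h| apart. *)
have [L [dL [L0 dL0 hL]]] : exists L d : R, [/\ 0 < L, 0 < d & forall y, `|y - upd j y0 0| < d ->
    `|g y - g (upd j y0 0)| <= L * `|y - upd j y0 0|].
  have : forall i, exists p : R * R, [/\ 0 < p.1, 0 < p.2 & forall y, `|y - upd j y0 0| < p.2 ->
    `|g y i ord0 - g (upd j y0 0) i ord0| <= p.1 * `|y - upd j y0 0|].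
    move=> k; have [d d0 hd] := frechet_lip (C1_frechet (@open_cube _ _ e) (gs k 1) (ute 0 zs)).
    exists (1 + \sum_q `|partial q (fun y => g y k ord0) (upd j y0 0)|, d); split=> //=.
    by rewrite ltr_wpDr // sumr_ge0.
  move=> /choice[p hp].
  exists (1 + \sum_k (p k).1), (\big[Num.min/1]_k (p k).2); split.
  - by rewrite ltr_wpDr // sumr_ge0 // => k _; have [/ltW] := hp k.
  - by apply: lt_bigmin => // k _; have [] := hp k.
  - move=> y yd; apply/cv_norm_leP.
      by rewrite mulr_ge0 // addr_ge0 // sumr_ge0 // => k _; have [/ltW] := hp k.
    move=> k; rewrite !mxE; have [_ _ hk] := hp k.
    apply: le_trans (hk y _) _; first by apply: lt_le_trans yd _; exact: bigmin_le.
    rewrite ler_wpM2r // (bigD1 k) //= addrCA lerDl addr_ge0 // sumr_ge0 // => q _.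
    by have [/ltW] := hp q.
pose C2 := 2 * (1 + s * (N%:R * (2 * L))).
have C20 : 0 < C2 by rewrite mulr_gt0 // ltr_pwDl // mulr_ge0 ?(ltW s0) // !mulr_ge0 // ltW.
pose w := a / C2; have w0 : 0 < w by rewrite divr_gt0.
have [d1 d10 h1] := @line_uniform R n 'I_N e j
   (fun p : 'I_N => partial l (fun y => g y p ord0)) y0 s w (fun p => Ck_partial l (gs p 1)) ye se w0.
have [|d2 d20 h2] := @curve_uniform R N ('I_N * 'I_N)%type D
   (fun p => partial p.2 (fun z => X z p.1 ord0)) (fun t => U (upd j y0 t)) s w oD
   (fun p => Ck_partial p.2 (Xs p.1 1)) _ w0.
  move=> t ts; split; first by apply: BD; apply: UB; exact: ute.
  by move=> k; apply: is_derive_cont (solves_line k solU (ute t ts)).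
exists (Num.min d1 (Num.min dL (d2 / (2 * L)))).
  by rewrite !lt_min d10 dL0 divr_gt0 // mulr_gt0.
move=> h; rewrite !lt_min => /and3P[hd1 hdL hd2].
pose el : 'cV[R]_n := delta_mx l ord0.
have nel : `|el| <= 1.
  by apply/cv_norm_leP => // k; rewrite mxE andbT; case: eqP; rewrite ?normr1 ?normr0.
have nel2 (c : R) : `|c *: el| <= `|c| by rewrite normrZ -[leRHS]mulr1 ler_wpM2l.
have nearc (c d t : R) : `|c| < d -> `|upd j y0 t + c *: el - upd j y0 t| < d.
  by move=> cd; rewrite addrC addKr; apply: le_lt_trans cd.
have ys : `|y0 j ord0| <= s by apply: le_trans (cv_coord_le _ _) (ltW y0s).
have shE t : upd j (y0 + h *: el) t = upd j y0 t + h *: el by rewrite upd_shift.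
have zc t : `|t| <= s -> cube e (upd j (y0 + h *: el) t).
  by move=> ts; rewrite shE; have [] := h1 t ts (upd j y0 t + h *: el) (nearc _ _ _ hd1).
have dU t : `|t| <= s -> `|U (upd j (y0 + h *: el) t) - U (upd j y0 t)| <= 2 * L * `|h|.
  move=> ts; apply: le_trans (est (ltW s0) se ye zc ts) _.
  rewrite -mulrA ler_wpM2l // shE; apply: le_trans (hL _ (nearc _ _ _ hdL)) _.
  by rewrite addrC addKr ler_wpM2l // ltW.
have est1 := @ode_est R N (fun t => U (upd j (y0 + h *: el) t) - U (upd j y0 t) - h *: W (upd j y0 t))
   (fun t => X (U (upd j (y0 + h *: el) t)) - X (U (upd j y0 t))
      - h *: affine A (fun=> 0) (upd j y0 t) (W (upd j y0 t)))
   s K (`|h| * w * (N%:R * (2 * L))) (ltW s0) K0 _ _ _ _ (y0 j ord0) ys.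
have {est1} := est1 _ _ _ _.
rewrite upd_id upd_shift // upd_id => est1.
apply: (@le_trans _ _ (`|U (y0 + h *: el) - U y0 - h *: W y0|)).
  by have := cv_coord_le (U (y0 + h *: el) - U y0 - h *: W y0) i; rewrite !mxE.
apply: (le_trans (est1 _ _ _ _)) => {est1}.
- by apply: le_trans Ke; rewrite ler_wpM2l // ltW.
- by apply: mulr_ge0; [rewrite mulr_ge0 // ltW|rewrite !mulr_ge0 // ltW].
- move=> t ts k.
  have e1 : (fun t0 => (U (upd j (y0 + h *: el) t0) - U (upd j y0 t0) - h *: W (upd j y0 t0)) k ord0) =
     (fun t0 => U (upd j (y0 + h *: el) t0) k ord0 - U (upd j y0 t0) k ord0 - h * W (upd j y0 t0) k ord0).
    by apply/funext => x; rewrite !mxE.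
  have e2 (u v x : 'cV[R]_N) : (u - v - h *: x) k ord0 = u k ord0 - v k ord0 - h * x k ord0.
    by rewrite !mxE.
  rewrite e1 e2.
  apply: is_deriveB; first apply: is_deriveB.
  + exact: solves_line solU (zc t ts).
  + exact: solves_line solU (ute t ts).
  + by apply: (is_deriveZ h); exact: solves_line solW (ute t ts).
- move=> t ts; move: (dU t ts); set p := U _; set z := upd j y0 t; set q := U z => pq.
  have -> : X p - X q - h *: affine A (fun=> 0) z (W z) =
     A z *m (p - q - h *: W z) + (X p - X q - A z *m (p - q)).
    rewrite /affine addr0 !mulmxBr -!scalemxAr.
    set p1 := A z *m p; set p2 := A z *m q; set p4 := A z *m W z.
    by apply/colP => k; rewrite !mxE; ring.
  apply: le_trans (ler_normD _ _) _; apply: lerD; first by apply: flow_A_bound; exact: ute.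
  have pqd : `|p - q| < d2.
    by apply: le_lt_trans pq _; rewrite mulrC -ltr_pdivlMr // mulr_gt0.
  have qqd : `|q - q| < d2 by rewrite subrr normr0.
  apply: (@le_trans _ _ (N%:R * w * `|p - q|)); last first.
    rewrite (_ : `|h| * w * (N%:R * (2 * L)) = N%:R * w * (2 * L * `|h|)); last by ring.
    by apply: ler_wpM2l => //; rewrite mulr_ge0 // ltW.
  apply/cv_norm_leP; first by rewrite mulr_ge0 // mulr_ge0 // (ltW w0).
  move=> k; rewrite [X in `|X| <= _]mxE [X in `|X + _| <= _]mxE [X in `|_ + X + _| <= _]mxE
    [X in `|_ + X| <= _]mxE [X in `|_ - X| <= _]mxE.
  under [X in `|_ - X| <= _]eq_bigr do rewrite [A _ _ _]mxE.
  apply: (@partial_mvt R N (fun z => X z k ord0) q q p d2 (fun c => partial c (fun z => X z k ord0) (U z)) w) => //.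
  move=> x xq c; have [Dx hx] := h2 t ts x xq; split; last by apply/ltW/(hx (k, c)).
  exact: Ck_derivable (Xs k 1) Dx.
have [solU0 _] := solU; have [solW0 _] := solW.
rewrite (solU0 (upd j (y0 + h *: el) 0)) ?upd_at //; last exact: zc.
rewrite (solU0 _ (ute 0 zs)) ?upd_at // (solW0 _ (ute 0 zs)) ?upd_at // shE.
have hg : `|g (upd j y0 0 + h *: el) - g (upd j y0 0) - h *: (\col_i partial l (fun y => g y i ord0) (upd
    j y0 0))| <= w * `|h|.
  apply/cv_norm_leP; first by rewrite mulr_ge0 ?(ltW w0).
  move=> p; rewrite !mxE; apply: (@line_taylor R _ (fun y => g y p ord0) (upd j y0 0) el) => c ch.
  have [zc2 hg2] := h1 0 zs (upd j y0 0 + c *: el) (nearc _ _ _ (le_lt_trans ch hd1)).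
  by split; [exact: Ck_derivable (gs p 1) zc2|apply/ltW/(hg2 p)].
have aE : a = C2 * w by rewrite /w mulrC divfK // gt_eqF.
rewrite (_ : a * `|h| = 2 * (w * `|h| + s * (`|h| * w * (N%:R * (2 * L))))).
  by apply: ler_wpM2l => //; apply: lerD.
by rewrite {1}aE /C2; ring.
Qed.

(* By [flow_sol_partial] the derivatives of U solve an affine equation whose coefficients are as
   regular as U. *)
Lemma flow_sol_Ck k i : Ck k (cube e) (fun y => U y i ord0).
Proof.
elim: k i => [|k IH] i; first exact: flow_sol_cont.
have oc := @open_cube R n e.
split; first by move=> x Dx; exact: Ck_cont (IH i) Dx.
move=> l; have [->|lj] := eqVneq l j.
  have [_ dU] := solU.
  split; first by move=> x Dx; have [] := dU x Dx i.
  apply: (@Ck_ext _ _ _ _ (fun y => X (U y) i ord0)) => //.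
    move=> x; rewrite inE => Dx; have [_ h] := dU x Dx i.
    by rewrite /partial h.
  apply: (@Ck_comp R n N k (cube e) D (fun z => X z i ord0) U) => //; first exact: Xs.
  by move=> y ye; apply: BD; exact: UB.
pose g' y : 'cV[R]_N := \col_i partial l (fun y => g y i ord0) y.
have g's : forall i, Ck k (cube e) (fun y => g' y i ord0).
  move=> p; apply: (@Ck_ext _ _ _ _ (partial l (fun y => g y p ord0))) => //.
    by move=> x _; rewrite !mxE.
  by apply: Ck_partial; exact: gs.
have [W solW] := @affine_exist R n N e K j e0 K0 Ke A flow_A_bound (fun=> 0) g'
   (flow_A_Ck flow_sol_cont) (fun i => Ck_ext oc (fun x _ => esym (mxE _ _ i ord0)) (Ck_cst _ _ 0)).
have dU := flow_sol_partial lj solW.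
split; first by move=> x Dx; have [] := dU x Dx i.
apply: Ck_ext oc _ (affine_sol_Ck e0 K0 Ke flow_A_bound (flow_A_Ck IH) _ g's solW i).
  by move=> x; rewrite inE => Dx; have [_ h] := dU x Dx i; rewrite /partial h.
by move=> q; apply: Ck_ext (@open_cube R n e) (fun x _ => esym (mxE _ _ q ord0)) (Ck_cst _ _ 0).
Qed.

End Smoothness.

(** The size of the cube is fixed by bounds on X and its first derivatives and by the continuity of
    g, so that one cube serves all orders of differentiability. *)
Theorem flow_exists n N (D : set 'cV[R]_N) (X : 'cV[R]_N -> 'cV[R]_N)
    (g : 'cV[R]_n -> 'cV[R]_N) (e0 : R) j :
  open D -> smooth_mx D X -> 0 < e0 -> smooth_mx (cube e0) g -> D (g 0) ->
  exists (e : R) (U : 'cV[R]_n -> 'cV[R]_N),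
   [/\ 0 < e <= e0, smooth_mx (cube e) U, forall y, cube e y -> D (U y) &
       solves e j (fun _ u => X u) g U].
Proof.
move=> oD /smooth_cv Xs e00 /smooth_cv gs Dg.
have [d1 [C1 [d10 C10 h1]]] := locally_bounded oD (fun p : 'I_N * 'I_N => Ck_partial p.2 (Xs p.1 1)) Dg.
have [d2 [C2 [d20 C20 h2]]] := locally_bounded oD (fun p : 'I_N => Xs p 0) Dg.
(* Three concentric balls around g(0): initial values lie within r, solutions within 2 r, and the
   bounds on X hold within 3 r. *)
pose r := Num.min d1 d2 / 3.
have r0 : 0 < r by rewrite divr_gt0 // lt_min d10.
have r3 (z : 'cV[R]_N) : `|z - g 0| < 3 * r -> `|z - g 0| < d1 /\ `|z - g 0| < d2.
  by rewrite mulrC divfK // lt_min => /andP[].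
have cube00 : cube e0 (0 : 'cV[R]_n) by rewrite /cube /= normr0.
have [d3 d30 h3] : exists2 d : R, 0 < d & forall y : 'cV[R]_n, `|y| < d -> `|g y - g 0| < r.
  have : forall i, exists d : R, 0 < d /\ forall y : 'cV[R]_n, `|y - 0| < d -> `|g y i ord0 - g 0 i ord0| < r.
    by move=> i; have [d d0 hd] := (cont_edP _ _).1 (Ck_cont (gs i 0) cube00) _ r0; exists d.
  move=> /choice[d hd]; exists (\big[Num.min/1]_i d i).
    by apply: lt_bigmin => // i _; have [] := hd i.
  move=> y yd; apply/cv_norm_ltP => // i; rewrite !mxE; have [_] := hd i; apply.
  by rewrite subr0; apply: lt_le_trans yd _; exact: bigmin_le.
pose K := N%:R * C1.
have K0 : 0 <= K by rewrite mulr_ge0 // ltW.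
(* The bounds keep the cube in the domain of g, keep g within r of g(0), give K e <= 1/2, and limit
   the displacement at speed [C2] to r. *)
pose e := Num.min (Num.min e0 d3) (Num.min (2^-1 / (K + 1)) (r / C2)).
have K1 : 0 < K + 1 by rewrite ltr_wpDl.
have ep : 0 < e.
  by rewrite !lt_min e00 d30 /=; apply/andP; split; apply: divr_gt0; rewrite // invr_gt0.
have ee0 : e <= e0 by rewrite !ge_min lexx.
have ed3 : e <= d3 by rewrite !ge_min lexx !orbT.
have Ke : K * e <= 2^-1.
  apply: (@le_trans _ _ ((K + 1) * (2^-1 / (K + 1)))); last by rewrite mulrC divfK // gt_eqF // ltr_wpDl.
  by apply: ler_pM => //; [exact: ltW|rewrite lerDl|rewrite !ge_min lexx !orbT].
have Ce : e * C2 <= r by rewrite -ler_pdivlMr // !ge_min lexx !orbT.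
have sub : @cube R n e `<=` cube e0 by move=> y ye; exact: lt_le_trans ye ee0.
(* X \o cl is globally Lipschitz, and its integral curves do not leave the region where cl is the
   identity. *)
pose cl (z : 'cV[R]_N) : 'cV[R]_N :=
  \col_i Num.max (g 0 i ord0 - 2 * r) (Num.min (g 0 i ord0 + 2 * r) (z i ord0)).
have r20 : 0 <= 2 * r by rewrite mulr_ge0 // ltW.
have cl1 z : `|cl z - g 0| < 3 * r.
  apply: (@le_lt_trans _ _ (2 * r)); last by lra.
  by apply/cv_norm_leP => // i; rewrite !mxE; have [] := clamp_scalar (g 0 i ord0) (z i ord0) 0 r20.
have cl2 z z' : `|cl z - cl z'| <= `|z - z'|.
  apply/cv_norm_leP => // i; rewrite !mxE.
  have [_ h _] := clamp_scalar (g 0 i ord0) (z i ord0) (z' i ord0) r20.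
  by apply: le_trans h _; have := cv_coord_le (z - z') i; rewrite !mxE.
have cl3 z : `|z - g 0| <= 2 * r -> cl z = z.
  move=> zr; apply/colP => i; rewrite mxE.
  have [_ _ h] := clamp_scalar (g 0 i ord0) (z i ord0) 0 r20; apply: h.
  by apply: le_trans zr; have := cv_coord_le (z - g 0) i; rewrite !mxE.
have BD (z : 'cV[R]_N) : `|z - g 0| < 3 * r -> D z by move=> /r3[/h1[]].
have BX (z : 'cV[R]_N) : `|z - g 0| < 3 * r -> forall i k, `|partial k (fun z => X z i ord0) z| <= C1.
  by move=> /r3[/h1[_ h] _] i k; exact: (h (i, k)).
have lip := flow_lip (ltW C10) Xs BD BX.
have [||U solU] := @solves_exist R n N e K j (fun _ u => X (cl u)) g ep K0 Ke.
- by move=> y ye u v; apply: le_trans (lip _ _ (cl1 u) (cl1 v)) _; rewrite ler_wpM2l.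
- by move=> v i; exact: Ck_cst.
have UB y : cube e y -> `|U y - g 0| <= 2 * r.
  move=> ye; have yj : `|y j ord0| < e by apply: le_lt_trans ye; exact: cv_coord_le.
  have ute t : `|t| <= `|y j ord0| -> cube e (upd j y t) by move=> ts; apply: cube_upd => //; exact: le_lt_trans yj.
  have zs : `|0 : R| <= `|y j ord0| by rewrite normr0.
  have [solU0 _] := solU.
  have := h3 (upd j y 0) (lt_le_trans (ute 0 zs) ed3); rewrite -(solU0 _ (ute 0 zs)) ?upd_at // => h4.
  rewrite -(subrKA (U (upd j y 0))) mulr2n mulrDl !mul1r.
  apply: le_trans (ler_normD _ _) _; apply: lerD (ltW h4).
  apply: le_trans Ce; apply/cv_norm_leP; first by rewrite mulr_ge0 // ltW.
  move=> i; rewrite !mxE.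
  have := @mvt_bound R (fun t => U (upd j y t) i ord0) (fun t => X (cl (U (upd j y t))) i ord0) (`|y j
      ord0|) C2 (y j ord0).
  rewrite upd_id => /(_ (ltW C20) (lexx _) _ _)/le_trans; apply.
  + by move=> t ts; exact: solves_line solU (ute t ts).
  + by move=> t ts; have [_ /h2[_]] := r3 _ (cl1 (U (upd j y t))); apply.
  + by rewrite ler_wpM2r // ltW.
have UB3 y : cube e y -> `|U y - g 0| < 3 * r.
  by move=> /UB /le_lt_trans; apply; lra.
have solU' : solves e j (fun _ u => X u) g U.
  have [s1 s2] := solU; split=> // y ye i.
  by have := s2 y ye i; rewrite cl3 //; exact: UB.
exists e, U; split=> //.
- by rewrite ep.
- apply/smooth_cv => i k.
  apply: (@flow_sol_Ck n N e C1 j D (g 0) (3 * r) X g U) => //; first exact: ltW.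
  by move=> q p; apply: Ck_subset sub _; exact: gs.
- by move=> y /UB3/BD.
Qed.

End Flow.

(** * The inverse function theorem *)

Section CkMx.
Context {R : realType} {n : nat} (k : nat) (D : set 'cV[R]_n).
Hypothesis oD : open D.

Definition Ckmx p q (A : 'cV[R]_n -> 'M[R]_(p, q)) := forall i j, Ck k D (fun x => A x i j).

Lemma Ckmx_mul p q r (A : 'cV[R]_n -> 'M[R]_(p, q)) (B : 'cV[R]_n -> 'M[R]_(q, r)) :
  Ckmx A -> Ckmx B -> Ckmx (fun x => A x *m B x).
Proof.
move=> hA hB i j; apply: (@Ck_ext _ _ _ _ (fun x => \sum_l A x i l * B x l j)) => //.
  by move=> x _; rewrite mxE.
by apply: Ck_sum => // l _; apply: Ck_mul.
Qed.

Lemma Ckmx_add p q (A B : 'cV[R]_n -> 'M[R]_(p, q)) :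
  Ckmx A -> Ckmx B -> Ckmx (fun x => A x + B x).
Proof.
move=> hA hB i j; apply: (@Ck_ext _ _ _ _ (fun x => A x i j + B x i j)) => //.
  by move=> x _; rewrite mxE.
exact: Ck_add.
Qed.

Lemma Ckmx_scale p q (f : 'cV[R]_n -> R) (A : 'cV[R]_n -> 'M[R]_(p, q)) :
  Ck k D f -> Ckmx A -> Ckmx (fun x => f x *: A x).
Proof.
move=> hf hA i j; apply: (@Ck_ext _ _ _ _ (fun x => f x * A x i j)) => //.
  by move=> x _; rewrite mxE.
exact: Ck_mul.
Qed.

Lemma Ckmx_opp p q (A : 'cV[R]_n -> 'M[R]_(p, q)) : Ckmx A -> Ckmx (fun x => - A x).
Proof.
move=> hA i j; apply: (@Ck_ext _ _ _ _ (fun x => - A x i j)) => //.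
  by move=> x _; rewrite mxE.
exact: Ck_opp.
Qed.

Lemma Ckmx_cst p q (A : 'M[R]_(p, q)) : Ckmx (fun=> A).
Proof. by move=> i j; exact: Ck_cst. Qed.

Lemma Ckmx_tr p q (A : 'cV[R]_n -> 'M[R]_(p, q)) : Ckmx A -> Ckmx (fun x => (A x)^T).
Proof.
move=> hA i j; apply: (@Ck_ext _ _ _ _ (fun x => A x j i)) => //.
by move=> x _; rewrite mxE.
Qed.

Lemma Ck_det p (A : 'cV[R]_n -> 'M[R]_p) : Ckmx A -> Ck k D (fun x => \det (A x)).
Proof.
move=> hA; rewrite /determinant; apply: Ck_sum => // s _; apply: Ck_mul => //.
  exact: Ck_cst.
exact: Ck_prod.
Qed.

(** Cofactor formula: the entries of the inverse are polynomials in those of A divided by the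
    determinant. *)
Lemma Ckmx_inv p (A : 'cV[R]_n -> 'M[R]_p) : (forall x, D x -> A x \in unitmx) ->
  Ckmx A -> Ckmx (fun x => invmx (A x)).
Proof.
move=> uA hA i j.
apply: (@Ck_ext _ _ _ _ (fun x => (\det (A x))^-1 * ((-1) ^+ (j + i) * \det (row' j (col' i (A x)))))) => //.
  by move=> x; rewrite inE => /uA Ax; rewrite /invmx Ax !mxE.
apply: Ck_mul => //; first apply: Ck_inv => //.
- by move=> x /uA; rewrite unitmxE unitfE.
- exact: Ck_det.
apply: Ck_mul => //; first exact: Ck_cst.
apply: Ck_det => a b; apply: (@Ck_ext _ _ _ _ (fun x => A x (lift j a) (lift i b))) => //.
by move=> x _; rewrite !mxE.
Qed.

End CkMx.

Section InverseFunction.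
Context {R : realType} {n : nat}.

Lemma smooth_mxE p q D (F : 'cV[R]_n -> 'M[R]_(p, q)) :
  smooth_mx D F <-> forall k, Ckmx k D F.
Proof. by split=> h; [move=> k i j; exact: h|move=> i j k; exact: h]. Qed.

Lemma Ckmx_jacobian k D p (F : 'cV[R]_n -> 'cV[R]_p) : open D -> Ckmx k.+1 D F -> Ckmx k D (jacobian_mx F).
Proof.
move=> oD hF i j; apply: (@Ck_ext _ _ _ _ (partial j (fun y => F y i ord0))) => //.
  by move=> x _; rewrite mxE.
by apply: Ck_partial; exact: hF.
Qed.

Lemma jacobian_frechet D p (F : 'cV[R]_n -> 'cV[R]_p) x : open D -> Ckmx 1 D F -> D x ->
  forall i, frechet (fun y => F y i ord0) x (fun k => jacobian_mx F x i k).
Proof.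
move=> oD hF Dx i; rewrite (_ : (fun k => _) = fun k => partial k (fun y => F y i ord0) x).
  exact: C1_frechet oD (hF i ord0) Dx.
by apply/funext => k; rewrite mxE.
Qed.

Lemma partialZ i (c : R) (f : 'cV[R]_n -> R) x : derivable f x (delta_mx i ord0) ->
  partial i (fun y => c * f y) x = c * partial i f x.
Proof. exact: deriveZ. Qed.

Lemma partialB i (f g : 'cV[R]_n -> R) x : derivable f x (delta_mx i ord0) ->
  derivable g x (delta_mx i ord0) ->
  partial i (fun y => f y - g y) x = partial i f x - partial i g x.
Proof. exact: deriveB. Qed.

Lemma mulmx_bound p q (B : 'M[R]_(p, q)) : exists2 b : R, 0 < b & forall v : 'cV[R]_q, `|B *m v| <= b * `|v|.
Proof.
pose a := \sum_i \sum_j `|B i j|.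
have a0 : 0 <= a by apply: sumr_ge0 => i _; apply: sumr_ge0.
exists (q%:R * a + 1); first by rewrite ltr_wpDl // mulr_ge0.
move=> v; apply: le_trans (mulmx_norm_le v a0 _) _.
  move=> i j; rewrite /a (bigD1 i) //= (bigD1 j) //= -addrA lerDl addr_ge0 //.
    by apply: sumr_ge0.
  by apply: sumr_ge0 => k _; apply: sumr_ge0.
by rewrite ler_wpM2r // lerDl.
Qed.

Theorem inverse_function (D : set 'cV[R]_n) (F : 'cV[R]_n -> 'cV[R]_n) x0 :
  open D -> smooth_mx D F -> D x0 -> jacobian_mx F x0 \in unitmx ->
  exists (d r : R) (G : 'cV[R]_n -> 'cV[R]_n),
   [/\ 0 < d, 0 < r,
    forall x : 'cV[R]_n, `|x - x0| < d -> D x /\ jacobian_mx F x \in unitmx,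
    (forall x : 'cV[R]_n, `|x - x0| < d -> `|F x - F x0| < r -> G (F x) = x) /\
    (forall y : 'cV[R]_n, `|y - F x0| < r -> `|G y - x0| < d /\ F (G y) = y) &
    smooth_mx [set y | `|y - F x0| < r] G].
Proof.
move=> oD /smooth_mxE Fs Dx0 uJ.
(* Dimension 0 is separate because the bound 1 / (2 n) on the derivatives of h, which becomes the
   contraction factor 1/2 after summing over n coordinates, needs n > 0. *)
have [n0|n_gt0] := posnP n.
  have e (x y : 'cV[R]_n) : x = y by apply/colP => -[i] hi; exfalso; rewrite n0 in hi.
  exists 1, 1, id; split=> //.
  - by move=> x _; rewrite (e x x0).
  - split=> [x _ _|y _]; first exact: e.
    by rewrite (e y x0) subrr normr0; split=> //; exact: e.
  - by move=> i; exfalso; move: i; rewrite n0 => -[].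
pose B := invmx (jacobian_mx F x0).
have [b b0 hb] := mulmx_bound B.
(* h has zero derivative at x0, and F x = y means x = h x + B y. *)
pose h x := x - B *m F x.
have hs : Ckmx 1 D h.
  apply: Ckmx_add => //; first by move=> i j; rewrite ord1; exact: Ck_coord.
  by apply: Ckmx_opp => //; apply: Ckmx_mul => //; exact: Ckmx_cst.
have jh0 i k : partial k (fun x => h x i ord0) x0 = 0.
  have fr : frechet (fun x => h x i ord0) x0 (fun k => (k == i)%:R + - \sum_l B i l * jacobian_mx F x0 l k).
    have e : (fun x => h x i ord0) = (fun x => x i ord0 - \sum_l B i l * F x l ord0).
      by apply/funext => x; rewrite !mxE.
    have H := C1_frechet oD (hs i ord0) Dx0.
    suff -> : (fun k => (k == i)%:R + - \sum_l B i l * jacobian_mx F x0 l k) =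
      (fun k => partial k (fun x => h x i ord0) x0) by [].
    apply/funext => l; rewrite e /partial.
    have dF q : derivable (fun x => F x q ord0) x0 (delta_mx l ord0) by exact: Ck_derivable (Fs 1 q ord0) Dx0.
    have dBF q : derivable (fun x => B i q * F x q ord0) x0 (delta_mx l ord0).
      by apply: derivableM => //; exact: derivable_cst.
    have [ds es] := partial_sum (index_enum 'I_n) (P := xpredT) (fun q _ => dBF q).
    have dx : derivable (fun y : 'cV[R]_n => y i ord0) x0 (delta_mx l ord0).
      by have [] := frechet_derive (delta_mx l ord0) (frechet_coord i x0).
    rewrite -/(partial l _ x0) (partialB dx ds) partial_coord es.
    congr (_ - _); apply: eq_bigr => q _; rewrite (partialZ _ (dF q)).
    by rewrite mxE.
  rewrite (frechet_partial k fr).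
  have : (B *m jacobian_mx F x0) i k = (i == k)%:R by rewrite mulVmx // mxE.
  by rewrite mxE => ->; rewrite eq_sym subrr.
have w0 : 0 < (2 * n%:R)^-1 :> R by rewrite invr_gt0 mulr_gt0 // ltr0n.
have [|d1 d10 h1] := @curve_uniform R n ('I_n * 'I_n)%type D (fun p => partial p.2 (fun x => h x p.1 ord0))
   (fun=> x0) 0 (2 * n%:R)^-1 oD (fun p => Ck_partial p.2 (hs p.1 ord0)) _ w0.
  by move=> t _; split=> // q; exact: cst_continuous.
have det0 : \det (jacobian_mx F x0) != 0 by move: uJ; rewrite unitmxE unitfE.
have Js k : Ckmx k D (jacobian_mx F) by apply: Ckmx_jacobian.
have detp : 0 < `|\det (jacobian_mx F x0)| by rewrite normr_gt0.
have [d2 d20 h2] := (cont_edP _ _).1 (Ck_cont (Ck_det oD (Js 0%N)) Dx0) _ detp.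
have {}h2 (x : 'cV[R]_n) : `|x - x0| < d2 -> jacobian_mx F x \in unitmx.
  move=> /h2 hx; rewrite unitmxE unitfE; apply/eqP => e.
  by move: hx; rewrite e sub0r normrN ltxx.
pose d := Num.min d1 d2.
have d0 : 0 < d by rewrite lt_min d10.
have zz : `|0 : R| <= 0 by rewrite normr0.
have h1' x : `|x - x0| < d1 -> D x /\ forall i k, `|partial k (fun x => h x i ord0) x| <= (2 * n%:R)^-1.
  move=> /(h1 0 zz)[Dx hx]; split=> // i k; have := hx (i, k); rewrite /= jh0 subr0; exact: ltW.
have ctr (x x' : 'cV[R]_n) : `|x - x0| < d -> `|x' - x0| < d -> `|h x' - h x| <= 2^-1 * `|x' - x|.
  rewrite !lt_min => /andP[xd _] /andP[x'd _]; apply/cv_norm_leP; first by rewrite mulr_ge0.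
  move=> i; have := @partial_mvt R n (fun x => h x i ord0) x0 x x' d1 (fun=> 0) (2 * n%:R)^-1 _ xd x'd.
  rewrite big1 ?subr0; last by move=> q _; rewrite mul0r.
  have nn : n%:R != 0 :> R by rewrite pnatr_eq0 -lt0n.
  rewrite invfM mulrCA mulfV // mulr1 [(h x' - h x) i ord0]mxE [(- h x) i ord0]mxE; apply.
  move=> y /h1'[Dy hy] q; rewrite subr0; split; last by rewrite -invfM; exact: hy.
  exact: Ck_derivable (hs i ord0) Dy.
have lipinv (x x' : 'cV[R]_n) : `|x - x0| < d -> `|x' - x0| < d -> `|x' - x| <= 2 * b * `|F x' - F x|.
  move=> xd x'd; have := ctr x x' xd x'd.
  have -> : h x' - h x = (x' - x) - B *m (F x' - F x).
    rewrite /h mulmxBr; set p := B *m _; set q := B *m _.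
    by apply/colP => i; rewrite !mxE; ring.
  have := hb (F x' - F x); set v := B *m _; set u := x' - x => vb uv.
  have : `|u| <= `|u - v| + `|v| by rewrite -{1}(subrK v u); exact: ler_normD.
  rewrite -mulrA; set P := b * _ in vb *; move: uv vb; lra.
(* The first Newton step is then shorter than d / 4, and halving of the steps keeps all iterates
   within d / 2 of x0. *)
pose r := d / (4 * b).
have b40 : 0 < 4 * b by rewrite mulr_gt0.
have r0 : 0 < r by rewrite divr_gt0.
have surj y : `|y - F x0| < r -> exists x : 'cV[R]_n, `|x - x0| < d /\ F x = y.
  move=> yr; pose phi (x : 'cV[R]_n) := h x + B *m y.
  pose xs k := iter k phi x0.
  pose a := `|xs 1%N - x0|.
  have a0 : 0 <= a by exact: normr_ge0.
  have ab : a < d / 4.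
    have -> : a = `|B *m (y - F x0)|.
      rewrite /a /xs /= /phi /h mulmxBr; congr `|_|.
      set p := B *m _; set q := B *m _.
      by apply/colP => i; rewrite !mxE; ring.
    apply: le_lt_trans (hb _) _.
    by move: yr; rewrite /r invfM mulrA ltr_pdivlMr // mulrC.
  have xsd k : `|xs k.+1 - xs k| <= a / 2 ^+ k /\ `|xs k.+1 - x0| <= 2 * a - a / 2 ^+ k.
    elim: k => [|k [IH1 IH2]]; first by rewrite expr0 divr1; split=> //; rewrite /a; lra.
    have P0 : 0 <= a / 2 ^+ k by rewrite divr_ge0 // exprn_ge0.
    have E : a / 2 ^+ k.+1 = a / 2 ^+ k / 2 by rewrite exprS invfM; ring.
    have xkd : `|xs k - x0| < d.
      case: k IH1 IH2 P0 E => [|k] IH1 IH2 P0 E; first by rewrite /xs /= subrr normr0.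
      apply: le_lt_trans (_ : 2 * a < _); last by lra.
      rewrite -(subrKA (xs k.+2)); apply: le_trans (ler_normD _ _) _.
      by rewrite distrC; lra.
    have xk1d : `|xs k.+1 - x0| < d by lra.
    have s1 : `|xs k.+2 - xs k.+1| <= a / 2 ^+ k.+1.
      have -> : xs k.+2 - xs k.+1 = h (xs k.+1) - h (xs k) by rewrite /xs /= /phi opprD addrACA subrr addr0.
      by apply: le_trans (ctr _ _ xkd xk1d) _; rewrite E mulrC ler_wpM2r.
    split=> //; rewrite -(subrKA (xs k.+1)); apply: le_trans (ler_normD _ _) _.
    by lra.
  have : forall i, exists l : R, forall k, `|l - xs k i ord0| <= 2 * a / 2 ^+ k.
    move=> i; apply: geometric_limit => k; have [+ _] := xsd k; apply: le_trans.
    by have := cv_coord_le (xs k.+1 - xs k) i; rewrite !mxE.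
  move=> /choice[l hl]; pose x : 'cV[R]_n := \col_i l i.
  have hx k : `|x - xs k| <= 2 * a / 2 ^+ k.
    apply/cv_norm_leP; first by rewrite divr_ge0 ?mulr_ge0 // exprn_ge0.
    by move=> i; rewrite !mxE.
  have xd : `|x - x0| < d.
    by have := hx 0%N; rewrite expr0 divr1 => /le_lt_trans; apply; lra.
  have xskd k : `|xs k - x0| < d.
    case: k => [|k]; first by rewrite subrr normr0.
    have [_ h3] := xsd k; apply: le_lt_trans h3 _.
    have P0 : 0 <= a / 2 ^+ k by rewrite divr_ge0 // exprn_ge0.
    by lra.
  exists x; split=> //.
  have fx : phi x = x.
    apply/eqP; rewrite -subr_eq0 -normr_le0; apply/ler_addgt0Pr => e e0; rewrite add0r.
    have [k hk] := geometric_small (mulr_ge0 (ler0n _ 4) a0) e0.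
    apply: le_trans hk.
    rewrite -(subrKA (xs k.+1)); apply: le_trans (ler_normD _ _) _.
    have s1 : `|phi x - xs k.+1| <= 2^-1 * (2 * a / 2 ^+ k).
      have -> : phi x - xs k.+1 = h x - h (xs k) by rewrite /xs /= /phi opprD addrACA subrr addr0.
      by apply: le_trans (ctr _ _ (xskd k) xd) _; rewrite ler_wpM2l.
    have s2 := hx k.+1; rewrite distrC in s2.
    apply: le_trans (lerD s1 s2) _.
    have P0 : 0 <= a / 2 ^+ k by rewrite divr_ge0 // exprn_ge0.
    rewrite exprS invfM; set q := (2 ^+ k)^-1 in P0 *.
    have -> : 2^-1 * (2 * a * q) + 2 * a * (2^-1 * q) = 2 * (a * q) by field.
    by rewrite -mulrA; lra.
  have : B *m F x = B *m y.
    apply: (addIr (x - B *m F x)); rewrite addrC subrK.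
    by move: fx; rewrite /phi /h addrC.
  by move=> /(congr1 (mulmx (jacobian_mx F x0))); rewrite !mulmxA mulmxV // !mul1mx.
have : forall y, exists x : 'cV[R]_n, `|y - F x0| < r -> `|x - x0| < d /\ F x = y.
  move=> y; have [yr|ny] := boolP (`|y - F x0| < r); last by exists 0.
  by have [x hx] := surj y yr; exists x.
move=> /choice[G hG].
have hD x : `|x - x0| < d -> D x /\ jacobian_mx F x \in unitmx.
  by rewrite lt_min => /andP[/h1'[Dx _] /h2 ux].
pose V : set 'cV[R]_n := [set y | `|y - F x0| < r].
have oV : open V by exact: open_norm_ball.
have GL y y' : V y -> V y' -> `|G y' - G y| <= 2 * b * `|y' - y|.
  move=> /hG[yd Fy] /hG[y'd Fy']; have := lipinv _ _ yd y'd.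
  by rewrite Fy Fy'.
(* The expansion of F at G y is solved for the increment of G; [GL] turns an error relative to this
   increment into one relative to |y' - y|. *)
have fr y : V y -> forall i, frechet (fun y => G y i ord0) y (fun k => invmx (jacobian_mx F (G y)) i k).
  move=> Vy i e e0; have [xd Fx] := hG y Vy; have [Dx ux] := hD _ xd.
  have [c c0 hc] := mulmx_bound (invmx (jacobian_mx F (G y))).
  have b20 : 0 < 2 * b by rewrite mulr_gt0.
  pose w := e / c / (2 * b); have wp : 0 < w by rewrite !divr_gt0.
  have : forall l, exists d3 : R, 0 < d3 /\ forall x' : 'cV[R]_n, `|x' - G y| < d3 ->
      `|F x' l ord0 - F (G y) l ord0 - \sum_k jacobian_mx F (G y) l k * (x' - G y) k ord0| <= w * `|x' - G y|.
    by move=> l; have [d3 d30 h3] := jacobian_frechet oD (Fs 1%N) Dx l wp; exists d3.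
  move=> /choice[d3 h3]; pose d4 := \big[Num.min/1]_l d3 l.
  have d40 : 0 < d4 by apply: lt_bigmin => // l _; have [] := h3 l.
  have [d5 d50 h5] := (open_edP _).1 oV y Vy.
  exists (Num.min d5 (d4 / (2 * b))); first by rewrite lt_min d50 divr_gt0.
  move=> y'; rewrite lt_min => /andP[/h5 Vy' y'd].
  have [x'd Fx'] := hG y' Vy'.
  have xx' : `|G y' - G y| < d4.
    by apply: le_lt_trans (GL _ _ Vy Vy') _; rewrite mulrC -ltr_pdivlMr.
  have E : `|y' - y - jacobian_mx F (G y) *m (G y' - G y)| <= w * `|G y' - G y|.
    apply/cv_norm_leP; first by rewrite mulr_ge0 // ltW.
    move=> l; have [_ /(_ (G y'))] := h3 l; rewrite Fx Fx' => h4.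
    rewrite [X in `|X| <= _]mxE [X in `|X + _| <= _]mxE [X in `|_ + X + _| <= _]mxE
      [X in `|_ + X| <= _]mxE [X in `|_ - X| <= _]mxE.
    by apply: h4; apply: lt_le_trans xx' _; exact: bigmin_le.
  have -> : G y' i ord0 - G y i ord0 - \sum_k invmx (jacobian_mx F (G y)) i k * (y' - y) k ord0 =
     (- (invmx (jacobian_mx F (G y)) *m (y' - y - jacobian_mx F (G y) *m (G y' - G y)))) i ord0.
    have alg (Bi J : 'M[R]_n) (u v : 'cV[R]_n) : Bi *m J = 1%:M ->
        u i ord0 - \sum_k Bi i k * v k ord0 = (- (Bi *m (v - J *m u))) i ord0.
      by move=> BJ; rewrite mulmxBr mulmxA BJ mul1mx opprB !mxE.
    by rewrite -alg ?mulVmx // [X in _ = X - _]mxE [X in _ = _ + X - _]mxE.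
  apply: le_trans (cv_coord_le _ _) _; rewrite normrN; apply: le_trans (hc _) _.
  apply: (@le_trans _ _ (c * (w * (2 * b * `|y' - y|)))).
    apply: ler_wpM2l; first exact: ltW.
    by apply: le_trans E _; apply: ler_wpM2l; [exact: ltW|exact: GL].
  have -> : c * (w * (2 * b * `|y' - y|)) = (c / c) * ((2 * b) / (2 * b)) * (e * `|y' - y|) by rewrite /w; ring.
  by rewrite !mulfV ?gt_eqF // !mul1r.
exists d, r, G; split=> //.
  split=> [x xd Fxr|y yr]; last exact: hG.
  have [xd' Fx'] := hG _ Fxr.
  have := lipinv _ _ xd xd'; rewrite Fx' subrr normr0 mulr0 normr_le0 subr_eq0.
  by move=> /eqP.
(* Bootstrap: the derivative of G is the inverse Jacobian of F composed with G, hence as regular as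
   G itself. *)
apply/smooth_mxE; rewrite -/V; elim=> [|k IH] i j; rewrite ord1.
  split=> // y Vy; have [dd dd0 hdd] := frechet_lip (fr y Vy i).
  apply/cont_edP => e e0.
  set L := 1 + _ in hdd.
  have L0 : 0 < L by rewrite /L ltr_wpDr // sumr_ge0.
  exists (Num.min dd (e / L)); first by rewrite lt_min dd0 divr_gt0.
  move=> y'; rewrite lt_min => /andP[/hdd h3 y'e]; apply: le_lt_trans h3 _.
  by rewrite mulrC -ltr_pdivlMr.
have Gk i' : Ck k V (fun y => G y i' ord0) by exact: IH.
split; first by move=> y Vy; exact: Ck_cont (Gk i) Vy.
move=> l; split; first by move=> y Vy; have [] := frechet_derive (delta_mx l ord0) (fr y Vy i).
apply: (@Ck_ext _ _ _ _ (fun y => invmx (jacobian_mx F (G y)) i l)) => //.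
  by move=> y; rewrite inE => Vy; rewrite (frechet_partial l (fr y Vy i)).
pose D' : set 'cV[R]_n := [set x | `|x - x0| < d].
have oD' : open D' by exact: open_norm_ball.
apply: (@Ck_comp R n n k V D' (fun x => invmx (jacobian_mx F x) i l) G) => //.
  apply: Ckmx_inv => //; first by move=> x /hD[].
  by move=> p q; apply: Ck_subset (Js k p q); move=> x /hD[].
by move=> y Vy; have [] := hG y Vy.
Qed.

End InverseFunction.

(** * Straightening of a frame *)

Section Straightening.
Context {R : realType}.

Lemma chain_partial n p (D : set 'cV[R]_n) (D' : set 'cV[R]_p) f (G : 'cV[R]_n -> 'cV[R]_p) x k :
  open D -> open D' -> Ck 1 D' f -> Ckmx 1 D G -> D x -> D' (G x) ->
  partial k (fun y => f (G y)) x =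
  \sum_i partial i f (G x) * partial k (fun y => G y i ord0) x.
Proof.
move=> oD oD' f1 G1 Dx Dgx.
have H := frechet_comp (C1_frechet oD' f1 Dgx) (fun i => C1_frechet oD (G1 i ord0) Dx).
exact: frechet_partial k H.
Qed.

Context {N : nat} (D : set 'cV[R]_N) (z0 : 'cV[R]_N) (Fr : 'cV[R]_N -> 'M[R]_N) (r : nat).
Hypotheses (oD : open D) (Dz : D z0) (Frs : forall k, Ckmx k D Fr)
  (Fru : forall x, D x -> Fr x \in unitmx) (rN : (r <= N)%N).

Let W (l : 'I_N) (x : 'cV[R]_N) : 'cV[R]_N := col l (Fr x).

(** [invmx (Fr x)] reads off components in the frame, so this is the flag condition: among the first
    r fields, [W_j, W_l] only involves the W_p with p < max(j, l). *)
Hypothesis FrB : forall x, D x -> forall j l p : 'I_N, (j < r)%N -> (l < r)%N ->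
  (j <= p)%N -> (l <= p)%N -> (invmx (Fr x) *m vf_bracket (W j) (W l) x) p ord0 = 0.

Let WE l i : (fun x => W l x i ord0) = (fun x => Fr x i l).
Proof. by apply/funext => x; rewrite mxE. Qed.

Let Bm j x : 'M[R]_N := \matrix_(i, l) vf_bracket (W j) (W l) x i ord0.

Let BmE j x i l : Bm j x i l =
  vf_app (W j) (fun x => Fr x i l) x - vf_app (W l) (fun x => Fr x i j) x.
Proof. by rewrite !mxE !WE. Qed.

Let vf_appE l f x : vf_app (W l) f x = \sum_p Fr x p l * partial p f x.
Proof. by apply: eq_bigr => p _; rewrite mxE. Qed.

Let vf_appCk k l f : Ck k.+1 D f -> Ck k D (vf_app (W l) f).
Proof.
move=> fk; apply: (@Ck_ext _ _ _ _ (fun x => \sum_p Fr x p l * partial p f x)) => //.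
by apply: Ck_sum => // p _; apply: Ck_mul => //; [exact: Frs|exact: Ck_partial].
Qed.

Let BmCk k j : Ckmx k D (Bm j).
Proof.
move=> i l; apply: (@Ck_ext _ _ _ _ (fun x => vf_app (W j) (fun x => Fr x i l) x - vf_app (W l) (fun x =>
    Fr x i j) x)) => //.
by apply: Ck_sub => //; apply: vf_appCk; exact: Frs.
Qed.

Section Step.
Variables (e : R) (j : 'I_N) (U : 'cV[R]_N -> 'cV[R]_N).
Hypotheses (jr : (j < r)%N) (Us : forall k, Ckmx k (cube e) U)
  (UD : forall y, cube e y -> D (U y))
  (dU : forall y, cube e y -> forall i, partial j (fun y => U y i ord0) y = Fr (U y) i j).

(** Column k holds the components of the k-th partial derivative of U in the frame along U. *)
Let S y := invmx (Fr (U y)) *m jacobian_mx U y.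

Let oc : open (cube e : set 'cV[R]_N). Proof. exact: open_cube. Qed.

Let FrU k : Ckmx k (cube e) (fun y => Fr (U y)).
Proof. by move=> a b; apply: Ck_comp (Frs k a b) _ UD => // i; exact: Us. Qed.

Let SCk k : Ckmx k (cube e) S.
Proof.
apply: Ckmx_mul => //; last by apply: Ckmx_jacobian => //; exact: Us.
by apply: Ckmx_inv => //; move=> x xe; apply: Fru; exact: UD.
Qed.

Let jacE y : cube e y -> jacobian_mx U y = Fr (U y) *m S y.
Proof. by move=> ye; rewrite /S mulmxA mulmxV ?mul1mx //; apply: Fru; exact: UD. Qed.

(** Equality of the mixed derivatives of U in the directions j and k, where the derivative along j
    is W_j(U) and the one along k is the combination of the W_l(U) with coefficients S_lk. *)
Lemma frame_transport y k : cube e y ->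
  \col_q partial j (fun y => S y q k) y = - (invmx (Fr (U y)) *m Bm j (U y) *m col k (S y)).
Proof.
move=> ye; have Dy := UD ye.
have dj f : Ck 1 D f -> partial j (fun y => f (U y)) y = vf_app (W j) f (U y).
  move=> f1; rewrite (chain_partial _ oc oD f1 (Us 1%N) ye Dy) vf_appE.
  by apply: eq_bigr => p _; rewrite dU // mulrC.
have dk f : Ck 1 D f -> partial k (fun y => f (U y)) y = \sum_l vf_app (W l) f (U y) * S y l k.
  move=> f1; rewrite (chain_partial _ oc oD f1 (Us 1%N) ye Dy).
  transitivity (\sum_p partial p f (U y) * \sum_l Fr (U y) p l * S y l k).
    apply: eq_bigr => p _; congr (_ * _).
    by have := congr1 (fun A : 'M[R]_N => A p k) (jacE ye); rewrite !mxE.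
  under [RHS]eq_bigr do rewrite vf_appE mulr_suml.
  rewrite exchange_big /=; apply: eq_bigr => p _; rewrite mulr_sumr.
  by apply: eq_bigr => l _; rewrite mulrA [_ * Fr _ _ _]mulrC.
have E : Bm j (U y) *m col k (S y) + Fr (U y) *m (\col_q partial j (fun y => S y q k) y) = 0.
  apply/colP => i; rewrite [LHS]mxE [RHS]mxE.
  have e1 : partial j (partial k (fun y => U y i ord0)) y =
     \sum_l (vf_app (W j) (fun x => Fr x i l) (U y) * S y l k + Fr (U y) i l * partial j (fun y => S y l k) y).
    have -> : partial j (partial k (fun y => U y i ord0)) y = partial j (fun y => \sum_l Fr (U y) i l * S y l k) y.
      apply: partial_ext oc ye _ => x; rewrite inE => xe.
      by have := congr1 (fun A : 'M[R]_N => A i k) (jacE xe); rewrite !mxE.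
    have [_ ->] := partial_sum (index_enum 'I_N) (P := xpredT)
       (fun l _ => Ck_derivable (i := j) (Ck_mul oc (FrU 1 i l) (SCk 1 l k)) ye).
    apply: eq_bigr => l _.
    rewrite partialM; last 2 first.
      exact: Ck_derivable (FrU 1 i l) ye.
      exact: Ck_derivable (SCk 1 l k) ye.
    by rewrite (dj _ (Frs 1 i l)) addrC [S y l k * _]mulrC.
  have e2 : partial k (partial j (fun y => U y i ord0)) y =
     \sum_l vf_app (W l) (fun x => Fr x i j) (U y) * S y l k.
    rewrite -(dk _ (Frs 1 i j)); apply: partial_ext oc ye _ => x; rewrite inE => xe.
    by rewrite dU.
  have := schwarz j k oc (Us 2 i ord0) ye; rewrite e1 e2 big_split /= => /eqP.
  rewrite -subr_eq0 addrAC -sumrB => /eqP E.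
  rewrite -[RHS]E; congr (_ + _); rewrite mxE; apply: eq_bigr => l _; last by rewrite mxE.
  by rewrite BmE mxE mulrBl.
move/(congr1 (mulmx (invmx (Fr (U y))))): E.
rewrite mulmxDr !mulmxA mulVmx ?mul1mx ?mulmx0; last exact: Fru.
by move=> /eqP; rewrite addrC addr_eq0 => /eqP.
Qed.

(* By [FrB] the entries of S in column k and in the rows q >= k satisfy a closed linear homogeneous
   equation along the flow of W_j. *)
Lemma frame_step (C : R) (k : 'I_N) : 0 <= C -> N%:R * C * e <= 2^-1 ->
  (forall y, cube e y -> forall a b, `|(invmx (Fr (U y)) *m Bm j (U y)) a b| <= C) ->
  (j < k)%N -> (k < r)%N ->
  (forall y, cube e y -> y j ord0 = 0 -> forall q : 'I_N, (k <= q)%N -> S y q k = (q == k)%:R) ->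
  forall y, cube e y -> forall q : 'I_N, (k <= q)%N -> S y q k = (q == k)%:R.
Proof.
move=> C0 Ce hC jk kr init y ye q kq.
pose s := `|y j ord0|.
have yj : s < e by apply: le_lt_trans ye; exact: cv_coord_le.
have ute t : `|t| <= s -> cube e (upd j y t) by move=> ts; apply: cube_upd => //; exact: le_lt_trans yj.
(* The rows of index below k are filled with 0 in [m] and [M], so that the closed subsystem is
   written in full dimension. *)
pose m y : 'cV[R]_N := \col_q if (k <= q)%N then S y q k - (q == k)%:R else 0.
pose M x : 'M[R]_N := \matrix_(q, l) if (k <= q)%N then - (invmx (Fr x) *m Bm j x) q l else 0.
have key y' : cube e y' -> forall q : 'I_N, (k <= q)%N ->
    partial j (fun y => S y q k) y' = (M (U y') *m m y') q ord0.
  move=> y'e p kp; have := congr1 (fun A : 'cV[R]_N => A p ord0) (frame_transport k y'e).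
  rewrite [in X in X -> _]mxE => ->.
  rewrite [LHS]mxE [X in - X]mxE [RHS]mxE -sumrN; apply: eq_bigr => l _.
  rewrite [M _ _ _]mxE kp [m _ _ _]mxE [col _ _ _ _]mxE mulNr; congr (- _).
  have [lk|kl] := leqP l k; last first.
    by rewrite (ltnW kl) gt_eqF // subr0.
  (* For l <= k the flag condition kills this coefficient, as p >= k > j and p >= l. This closes the
     system on the rows from k on, and makes the subtraction of 1 at l = k harmless. *)
  suff -> : (invmx (Fr (U y')) *m Bm j (U y')) p l = 0 by rewrite !mul0r.
  have <- := FrB (UD y'e) jr (leq_ltn_trans lk kr) (leq_trans (ltnW jk) kp) (leq_trans lk kp).
  by rewrite !mxE; apply: eq_bigr => a _; rewrite [Bm _ _ _ _]mxE.
have := @ode_est R N (fun t => m (upd j y t)) (fun t => M (U (upd j y t)) *m m (upd j y t)) s (N%:R * C) 0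
   (normr_ge0 _) _ _ (lexx 0) _ _ (y j ord0) (lexx _).
rewrite upd_id => h.
have m0 : m (upd j y 0) = 0.
  apply/colP => p; rewrite [LHS]mxE [RHS]mxE; case: ifP => // kp.
  have ze : cube e (upd j y 0) by apply: ute; rewrite normr0; exact: normr_ge0.
  by rewrite (init _ ze (upd_at _ _ _) p kp) subrr.
have : `|m y| <= 0.
  apply: le_trans (h _ _ _ _) _; last by rewrite m0 normr0 mulr0 addr0 mulr0.
  - by rewrite mulr_ge0.
  - by apply: le_trans Ce; rewrite ler_wpM2l // ?mulr_ge0 // ltW.
  - move=> t ts i; have [ki|ki] := leqP k i; last first.
      rewrite (_ : (fun t0 => m (upd j y t0) i ord0) = fun=> 0); last first.
        by apply/funext => x; rewrite mxE leqNgt ki.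
      rewrite (_ : (M _ *m _) i ord0 = 0); first exact: is_derive_cst.
      by rewrite mxE big1 // => l _; rewrite [M _ _ _]mxE leqNgt ki mul0r.
    rewrite (_ : (fun t0 => m (upd j y t0) i ord0) = fun t0 => S (upd j y t0) i k - (i == k)%:R); last first.
      by apply/funext => x; rewrite mxE ki.
    rewrite -(key _ (ute t ts) i ki) -[partial _ _ _]subr0.
    apply: is_deriveB; apply: (@upd_derive R N j y t (fun y => S y i k)).
    by apply: derivableP; exact: Ck_derivable (SCk 1 i k) (ute t ts).
  - move=> t ts; rewrite addr0; apply: mulmx_norm_le => // a b; rewrite mxE.
    by case: ifP => _; rewrite ?normr0 // normrN; apply: hC; exact: ute.
rewrite normr_le0 => /eqP /(congr1 (fun A : 'cV[R]_N => A q ord0)).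
by rewrite [X in X = _ -> _]mxE [X in _ = X -> _]mxE kq => /eqP; rewrite subr_eq0 => /eqP.
Qed.

End Step.

(** A derivative in a direction tangent to the hyperplane y_j = 0 sees only values on it; this
    supplies the initial values of the transport equation. *)
Lemma hyperplane_partial n p (e : R) (j k : 'I_n) (F G : 'cV[R]_n -> 'cV[R]_p) y i : k != j ->
  cube e y -> y j ord0 = 0 ->
  (forall y, cube e y -> y j ord0 = 0 -> F y = G y) ->
  derivable (fun y => G y i ord0) y (delta_mx k ord0) ->
  partial k (fun y => F y i ord0) y = partial k (fun y => G y i ord0) y.
Proof.
move=> kj ye y0 FG /derivableP/is_derive_edP dG.
suff [_] : is_derive y (delta_mx k ord0 : 'cV[R]_n) (fun y => F y i ord0)
   (partial k (fun y => G y i ord0) y) by [].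
apply/is_derive_edP => a /dG[d d0 hd]; have [d1 d10 h1] := (open_edP _).1 (@open_cube R n e) y ye.
exists (Num.min d d1); first by rewrite lt_min d0.
move=> h; rewrite lt_min => /andP[/hd hh hd1].
have hye : cube e (y + h *: (delta_mx k ord0 : 'cV[R]_n)).
  apply: h1; rewrite addrC addKr normrZ; apply: le_lt_trans hd1; rewrite -[leRHS]mulr1.
  rewrite ler_wpM2l //; apply/cv_norm_leP => // q; rewrite mxE andbT.
  by case: eqP; rewrite ?normr1 ?normr0.
rewrite (FG _ hye) ?(FG y ye y0) //.
by rewrite !mxE y0 eq_sym (negbTE kj) mulr0 addr0.
Qed.

Let slice (y : 'cV[R]_N) := forall k : 'I_N, (k < r)%N -> y k ord0 = 0.

(* The chart of step i.+1 is obtained by flowing the one of step i along W_j, j = r - i.+1. *)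
Lemma frame_chart (i : nat) : (i <= r)%N ->
  exists (e : R) (G : 'cV[R]_N -> 'cV[R]_N),
  [/\ 0 < e, forall k, Ckmx k (cube e) G,
      forall y, cube e y -> D (G y),
      forall y, cube e y -> slice y -> G y = z0 + Fr z0 *m y &
      (forall k : 'I_N, (r - i <= k)%N -> col k (jacobian_mx G 0) = col k (Fr z0)) /\
      (forall y, cube e y -> forall k q : 'I_N, (r - i <= k)%N -> (k < r)%N -> (k <= q)%N ->
        (invmx (Fr (G y)) *m jacobian_mx G y) q k = (q == k)%:R)].
Proof.
elim: i => [_|i IH ir].
  (* Before any field is used the map is affine in the coordinates from r on and ignores the first
     r. *)
  pose G (y : 'cV[R]_N) : 'cV[R]_N := z0 + Fr z0 *m \col_k (if (r <= k)%N then y k ord0 else 0).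
  have Gs k : Ckmx k setT G.
    have oT : open (setT : set 'cV[R]_N) := openT.
    apply: Ckmx_add => //; first exact: Ckmx_cst.
    apply: Ckmx_mul => //; first exact: Ckmx_cst.
    move=> a b; apply: (@Ck_ext _ _ _ _ (fun y => if (r <= a)%N then y a ord0 else 0)) => //.
      by move=> y _; rewrite mxE.
    by case: (r <= a)%N; [exact: Ck_coord|exact: Ck_cst].
  have G0 : G 0 = z0.
    rewrite /G (_ : \col_k _ = 0) ?mulmx0 ?addr0 //; apply/colP => k; rewrite !mxE.
    by case: ifP.
  have [d d0 hd] := (open_edP _).1 oD z0 Dz.
  have [|c c0 hc] := @cv_cont_edP R 'cV[R]_N N (fun y => G y) 0 d d0 _.
    by move=> a; apply: Ck_cont (Gs 0%N a ord0) _.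
  exists c, G; split=> //.
  - by move=> k a b; apply: Ck_subset (Gs k a b).
  - by move=> y ye; apply: hd; rewrite -G0; apply: hc; rewrite subr0.
  - move=> y ye ys; rewrite /G; congr (_ + _ *m _); apply/colP => k; rewrite mxE.
    by case: leqP => // /ys.
  - split; last by move=> y _ k q; rewrite subn0 => rk; rewrite ltnNge rk.
    move=> k; rewrite subn0 => rk; apply/colP => a; rewrite !mxE.
    have fr : frechet (fun y => G y a ord0) 0 (fun l => if (r <= l)%N then Fr z0 a l else 0).
      have GE (y : 'cV[R]_N) : G y a ord0 =
          z0 a ord0 + \sum_(l < N) (if (r <= l)%N then Fr z0 a l else 0) * y l ord0.
        rewrite !mxE; congr (_ + _); apply: eq_bigr => l _; rewrite mxE.
        by case: ifP; rewrite ?mulr0 ?mul0r.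
      move=> w w0; exists 1 => // y _; rewrite !GE.
      rewrite (_ : _ - _ - _ = 0) ?normr0 ?mulr_ge0 ?(ltW w0) //.
      rewrite [\sum_(i < N) _ * (0 : 'cV[R]_N) i ord0]big1 ?addr0; last by move=> l _; rewrite mxE mulr0.
      rewrite [z0 a ord0 + _]addrC addrK; apply/eqP; rewrite subr_eq0; apply/eqP.
      by apply: eq_bigr => l _; rewrite subr0.
    by rewrite (frechet_partial k fr) rk.
have [e1 [G1 [e10 G1s G1D G1slice [G1jac G1S]]]] := IH (ltnW ir).
have cube0 (e : R) : 0 < e -> cube e (0 : 'cV[R]_N) by rewrite /cube /= normr0.
have jN : (r - i.+1 < N)%N by apply: leq_trans rN; rewrite ltn_subrL (leq_trans _ ir).
(* The fields are used in decreasing order: flowing along W_j must preserve the columns k > j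
   already settled, and for these [W_j, W_k] has no component of index k or more. *)
pose j := Ordinal jN.
have jr : (j < r)%N by rewrite /= ltn_subrL (leq_trans _ ir).
have G10 : G1 0 = z0 by rewrite G1slice ?mulmx0 ?addr0 //; [exact: cube0|move=> k _; rewrite mxE].
have [|e2 [U [/andP[e20 e21] Us UD solU]]] :=
   @flow_exists R N N D (W j) G1 e1 j oD _ e10 ((smooth_mxE _ _).2 G1s) (G1D _ (cube0 _ e10)).
  apply/smooth_mxE => k a b; apply: (@Ck_ext _ _ _ _ (fun x => Fr x a j)) => //; last exact: Frs.
  by move=> x _; rewrite mxE.
move/smooth_mxE: Us => Us.
have sub21 : @cube R N e2 `<=` cube e1 by move=> y ye; exact: lt_le_trans ye e21.
have [U0 dU] := solU.
have dU' y : cube e2 y -> forall a, partial j (fun y => U y a ord0) y = Fr (U y) a j.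
  by move=> ye a; have [_ h] := dU y ye a; rewrite /partial h mxE.
have U00 : U 0 = z0 by rewrite U0 ?G10 ?mxE //; exact: cube0.
have [d [C [d0 C0 hC]]] := locally_bounded oD
   (fun p : 'I_N * 'I_N => Ckmx_mul oD (Ckmx_inv oD Fru (Frs 0%N)) (@BmCk 0%N j) p.1 p.2) Dz.
have [|c c0 hc] := @cv_cont_edP R 'cV[R]_N N U 0 d d0 _.
  by move=> a; apply: Ck_cont (Us 0%N a ord0) _; exact: cube0.
pose K : R := N%:R * C; have K1 : 0 < K + 1 by rewrite ltr_wpDl // mulr_ge0 // ltW.
(* [C] bounds the coefficients of the transport equation near z0; e keeps U in that region and
   satisfies the smallness condition of [frame_step]. *)
pose e := Num.min e2 (Num.min c (2^-1 / (K + 1))).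
have e0 : 0 < e by rewrite !lt_min e20 c0 divr_gt0 // invr_gt0.
have ee2 : e <= e2 by rewrite ge_min lexx.
have ec : e <= c by rewrite !ge_min lexx !orbT.
have Ke : K * e <= 2^-1.
  apply: (@le_trans _ _ ((K + 1) * (2^-1 / (K + 1)))); last by rewrite mulrC divfK // gt_eqF.
  by apply: ler_pM => //; [rewrite mulr_ge0 // ltW|exact: ltW|rewrite lerDl|rewrite !ge_min lexx !orbT].
have sub : @cube R N e `<=` cube e2 by move=> y ye; exact: lt_le_trans ye ee2.
have hpart (y : 'cV[R]_N) (k : 'I_N) a : k != j -> cube e2 y -> y j ord0 = 0 ->
    partial k (fun y => U y a ord0) y = partial k (fun y => G1 y a ord0) y.
  move=> kj ye yj; have dG := Ck_derivable (i := k) (G1s 1%N a ord0) (sub21 _ ye).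
  exact: hyperplane_partial kj ye yj U0 dG.
have rij : (r - i = j.+1)%N by rewrite /= subnSK.
exists e, U; split=> //.
- by move=> k a b; apply: Ck_subset (Us k a b).
- by move=> y ye; apply: UD; exact: sub.
- move=> y ye ys; rewrite U0 ?G1slice //; first by apply: sub21; exact: sub.
    exact: sub.
  exact: ys.
- split=> [k|y ye k q jk kr kq].
    rewrite leq_eqVlt => /orP[/eqP jk|jk].
      have -> : k = j by apply: val_inj.
      apply/colP => a; rewrite !mxE dU' ?U00 //; exact: cube0.
    have kj : k != j by apply/eqP => h; move: jk; rewrite h ltnn.
    rewrite -G1jac ?rij //; apply/colP => a; rewrite !mxE hpart ?mxE //; exact: cube0.
  have UDe y' : cube e y' -> D (U y') by move=> y'e; apply: UD; exact: sub.
  move: jk; rewrite leq_eqVlt => /orP[/eqP jk|jk].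
    (* Column j is a unit vector because the derivative of U along y_j is W_j(U). *)
    have -> : k = j by apply: val_inj.
    transitivity ((invmx (Fr (U y)) *m Fr (U y)) q j).
      rewrite !mxE; apply: eq_bigr => a _; congr (_ * _); rewrite mxE dU' //; exact: sub.
    by rewrite mulVmx ?mxE //; apply: Fru; exact: UDe.
  have kj : k != j by apply/eqP => h; move: jk; rewrite h ltnn.
  apply: (@frame_step e j U jr _ UDe _ C k (ltW C0) Ke) => //.
  + by move=> l a b; apply: Ck_subset (Us l a b).
  + by move=> y' y'e a; apply: dU'; exact: sub.
  + move=> y' y'e a b; have [] := hC (U y').
      by rewrite -U00; apply: hc; rewrite subr0; exact: lt_le_trans y'e ec.
    by move=> _ h; exact: (h (a, b)).
  + move=> y' y'e y'j p kp; have y'2 := sub _ y'e.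
    rewrite -(G1S y' (sub21 _ y'2) k p) ?rij // -U0 //.
    rewrite !mxE; apply: eq_bigr => a _; congr (_ * _); rewrite !mxE hpart //.
Qed.

(** P inverts the chart F of [frame_chart]. At corresponding points [jacobian_mx P *m Fr] is the
    inverse of [invmx Fr *m jacobian_mx F], and a matrix whose first r columns are upper
    unitriangular has an inverse of the same kind. *)
Theorem straightening : exists (c d : R) (P : 'cV[R]_N -> 'cV[R]_N),
  [/\ 0 < c, 0 < d,
    forall x : 'cV[R]_N, `|x - z0| < c -> D x,
    (forall k, Ckmx k [set x | `|x - z0| < c] P) /\ jacobian_mx P z0 = invmx (Fr z0) &
    (forall x : 'cV[R]_N, `|x - z0| < c -> forall k q : 'I_N, (k < r)%N -> (k <= q)%N ->
       (jacobian_mx P x *m Fr x) q k = (q == k)%:R) /\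
    (forall y : 'cV[R]_N, `|y| < d -> slice y -> `|Fr z0 *m y| < c /\ P (z0 + Fr z0 *m y) = y)].
Proof.
have [e [F [e0 Fs FD Fslice [Fjac FS]]]] := frame_chart (leqnn r).
rewrite subnn in Fjac FS.
have cube0 : cube e (0 : 'cV[R]_N) by rewrite /cube /= normr0.
have F0 : F 0 = z0 by rewrite Fslice ?mulmx0 ?addr0 // => k _; rewrite mxE.
have J0 : jacobian_mx F 0 = Fr z0.
  apply/matrixP => a k; have := congr1 (fun A : 'cV[R]_N => A a ord0) (Fjac k (leq0n _)).
  by rewrite !mxE.
have [d1 [c1 [P [d10 c10 hd1 [PF FP] Ps]]]] := @inverse_function R N (cube e) F 0 (@open_cube R N e)
   ((smooth_mxE _ _).2 Fs) cube0 (eq_ind_r (fun A => A \in unitmx) (Fru Dz) J0).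
move: PF FP Ps; rewrite F0 => PF FP /smooth_mxE Ps.
pose B : set 'cV[R]_N := [set x | `|x - z0| < c1].
have oB : open B by exact: open_norm_ball.
have Bz : B z0 by rewrite /B /= subrr normr0.
have Pc x : B x -> cube e (P x) by move=> /FP[/hd1[]].
have JP x : B x -> jacobian_mx P x = invmx (jacobian_mx F (P x)).
  move=> Bx; have [Pd FPx] := FP x Bx; have [Px uJ] := hd1 _ Pd.
  suff E : jacobian_mx F (P x) *m jacobian_mx P x = 1%:M.
    by rewrite -[LHS]mul1mx -(mulVmx uJ) -mulmxA E mulmx1.
  apply/matrixP => a k; rewrite !mxE.
  transitivity (partial k (fun x => F (P x) a ord0) x).
    rewrite (chain_partial _ oB (@open_cube R N e) (Fs 1%N a ord0) (Ps 1%N) Bx Px).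
    by apply: eq_bigr => l _; rewrite !mxE.
  rewrite eq_sym -(partial_coord k a x); apply: partial_ext oB Bx _ => z; rewrite inE => Bz'.
  by have [_ ->] := FP z Bz'.
have P0 : P z0 = 0.
  by have := PF 0; rewrite F0 !subrr !normr0 => ->.
have [b b0 hb] := mulmx_bound (Fr z0).
exists c1, (Num.min (Num.min e d1) (c1 / b)), P; split=> //.
- by rewrite !lt_min e0 d10 divr_gt0.
- by move=> x /FP[/hd1[Px _] <-]; exact: FD.
- by split=> //; rewrite JP // P0 J0.
- split=> [x Bx k q kr kq|y yd ys].
    have [Pd FPx] := FP x Bx; have [Px uJ] := hd1 _ Pd.
    have uF : Fr x \in unitmx by rewrite -FPx; apply: Fru; exact: FD.
    pose T := invmx (Fr x) *m jacobian_mx F (P x).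
    have uT : T \in unitmx by rewrite unitmx_mul unitmx_inv uF.
    have TE : jacobian_mx P x *m Fr x *m T = 1%:M.
      by rewrite /T -mulmxA mulKVmx // JP // mulVmx.
    have TS (k' q' : 'I_N) : (k' < r)%N -> (k' <= q')%N -> T q' k' = (q' == k')%:R.
      by move=> k'r k'q'; have := FS _ Px k' q' (leq0n _) k'r k'q'; rewrite FPx.
    set A := jacobian_mx P x *m Fr x in TE *.
    clearbody A T.
    (* Column k of A T = 1 reads A_qk + sum_(i < k) A_qi T_ik = delta_qk; for q >= k the terms with
       i < k vanish by induction on the column. *)
    have cols : forall l, (l < r)%N -> forall k : 'I_N, (k <= l)%N -> forall q : 'I_N, (k <= q)%N ->
         A q k = (q == k)%:R.
      elim=> [|l IHl] lr k' k'l q' k'q'.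
        have k'0 : (k' = 0 :> nat)%N by move: k'l; case: (nat_of_ord k').
        have k'r : (k' < r)%N by rewrite k'0.
        have := congr1 (fun M : 'M[R]_N => M q' k') TE; rewrite !mxE (bigD1 k') //= big1 => [|i ik'].
          by rewrite addr0 (TS k' k' k'r (leqnn _)) eqxx mulr1.
        by rewrite (TS k' i k'r) ?k'0 // (negbTE ik') mulr0.
      have := k'l; rewrite leq_eqVlt => /orP[/eqP k'E|k'l']; last by apply: IHl => //; exact: ltnW.
      have k'r : (k' < r)%N by rewrite k'E.
      have := congr1 (fun M : 'M[R]_N => M q' k') TE; rewrite !mxE (bigD1 k') //= big1 => [|i ik'].
        by rewrite addr0 (TS k' k' k'r (leqnn _)) eqxx mulr1.
      have [k'i|ik] := leqP k' i.
        by rewrite (TS k' i k'r k'i) (negbTE ik') mulr0.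
      rewrite (IHl (ltnW lr) i) ?mul0r //.
      - by rewrite gt_eqF ?mul0r //; exact: leq_trans k'q'.
      - by rewrite -ltnS -k'E.
      - exact: ltnW (leq_trans ik k'q').
    exact: (cols k kr k (leqnn _) q kq).
  move: yd; rewrite !lt_min => /andP[/andP[ye yd1] yc].
  have byc : `|Fr z0 *m y| < c1.
    by apply: le_lt_trans (hb y) _; rewrite mulrC -ltr_pdivlMr.
  split=> //; rewrite -Fslice //; apply: PF; first by rewrite subr0.
  by rewrite Fslice // addrC addKr.
Qed.

End Straightening.

(** * Solvable algebras of infinitesimal transformations *)

Section Flag.
Context {F : fieldType} {vT : vectType F} (br : vT -> vT -> vT).
Hypotheses (br_suml : forall v I (s : seq I) (c : I -> F) (u : I -> vT),
    br (\sum_(i <- s) c i *: u i) v = \sum_(i <- s) c i *: br (u i) v)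
  (br_sumr : forall v I (s : seq I) (c : I -> F) (u : I -> vT),
    br v (\sum_(i <- s) c i *: u i) = \sum_(i <- s) c i *: br v (u i)).

Definition brv (S : {vspace vT}) : {vspace vT} :=
  <<[seq br u v | u <- vbasis S, v <- vbasis S]>>%VS.

Definition derv (k : nat) : {vspace vT} := iter k brv fullv.

Lemma mem_brv (S : {vspace vT}) u v : u \in S -> v \in S -> br u v \in brv S.
Proof.
move=> uS vS; rewrite (coord_vbasis uS) (coord_vbasis vS).
rewrite br_suml memv_suml // => i _; rewrite memvZ // br_sumr memv_suml // => j _.
by rewrite memvZ // memv_span //; apply/allpairsP; exists ((vbasis S)`_i, (vbasis S)`_j); split=> //=;
  rewrite mem_nth // size_tuple.
Qed.

Lemma brvS S T : (S <= T)%VS -> (brv S <= brv T)%VS.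
Proof.
move=> ST; apply/span_subvP => w /allpairsP[[u v] [/= uS vS ->]].
by apply: mem_brv; apply: (subvP ST); exact: vbasis_mem.
Qed.

Lemma dervS k : (derv k.+1 <= derv k)%VS.
Proof. by elim: k => [|k IH]; [exact: subvf|exact: brvS]. Qed.

(** The basis is built from the last term of the derived series upwards, each term contributing a
    complement of its derived subspace. The brackets of a term fall into the span of the vectors
    chosen before it, with no eigenvector of any operator involved. *)
Lemma flag_basis K : derv K = 0%VS ->
  exists X : seq vT, basis_of fullv X /\
    forall i l, (i < size X)%N -> (l < size X)%N -> br X`_i X`_l \in <<take (maxn i l) X>>%VS.
Proof.
move=> dK.
suff : forall k, (k <= K)%N -> exists X : seq vT, basis_of (derv (K - k)) X /\
    forall i l, (i < size X)%N -> (l < size X)%N -> br X`_i X`_l \in <<take (maxn i l) X>>%VS.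
  by move=> /(_ K (leqnn _)); rewrite subnn.
elim=> [_|k IH kK].
  by exists nil; rewrite subn0 dK /basis_of span_nil eqxx nil_free.
have [X [bX hX]] := IH (ltnW kK).
pose S := derv (K - k.+1); have SE : derv (K - k) = brv S by rewrite /S -subnSK.
rewrite SE in bX.
have sub : (brv S <= S)%VS by exact: dervS.
exists (X ++ vbasis (S :\: brv S)%VS); split.
  have -> : derv (K - k.+1) = (brv S + (S :\: brv S))%VS.
    by have := addv_diff_cap S (brv S); rewrite (capv_idPr sub) addvC => ->.
  by apply: cat_basis; [apply/directv_addP; rewrite capvC capv_diff|exact: bX|exact: vbasisP].
move=> i l.
set Y := _ ++ _ => iY lY.
have YS j : (j < size Y)%N -> Y`_j \in S.
  rewrite /Y size_cat nth_cat; case: (ltnP j (size X)) => [jX _|Xj jY].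
    by apply: (subvP sub); apply: basis_mem bX _; exact: mem_nth.
  have : (vbasis (S :\: brv S))`_(j - size X) \in (S :\: brv S)%VS.
    by apply: vbasis_mem; rewrite mem_nth // -(ltn_add2l (size X)) subnKC.
  by apply: (subvP _); exact: diffvSl.
have [iX|Xi] := ltnP (maxn i l) (size X).
  move: (iX); rewrite gtn_max => /andP[iX1 iX2].
  rewrite /Y !nth_cat iX1 iX2 take_cat iX; exact: hX.
(* A pair containing a new vector has its bracket in [brv S], which is spanned by [X], and [X]
   precedes position max(i, l). *)
have := mem_brv (YS _ iY) (YS _ lY); rewrite -(span_basis bX).
by apply: (subvP _); apply: sub_span => x xX; rewrite /Y take_cat ltnNge Xi /= mem_cat xX.
Qed.

End Flag.

(** * Infinitesimal transformations through their matrices *)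

Section Algebra.
Context {R : realType} {n m : nat}.
Implicit Types (M : set 'cV[R]_n) (V W : inf_transf R n m).

(* The linear part, at [z = 0], of the action of (C, tau, H) on R^(m+1); the bracket of infinitesimal
   transformations becomes the one of the vector fields (Y(x), it_mx(x) z). *)
Definition it_mx V (x : 'cV[R]_n) : 'M[R]_(m + 1) :=
  block_mx (it_C V x) (- it_H V x) 0 (it_tau V x / 2)%:M.

Lemma it_eq_onP M V W : it_eq_on M V W <->
  forall x, M x -> it_Y V x = it_Y W x /\ it_mx V x = it_mx W x.
Proof.
split=> [h x /h[-> eC et eH]|h x /h[-> /eq_block_mx[-> /oppr_inj -> _]]].
  by rewrite /it_mx eC et eH.
move=> /(congr1 (fun A : 'M[R]_1 => A ord0 ord0)); rewrite !mxE eqxx !mulr1n => t.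
by split=> //; apply: (mulIf _ t); rewrite invr_eq0 pnatr_eq0.
Qed.

Lemma it_mx_lincomb k (c : 'I_k -> R) (V : 'I_k -> inf_transf R n m) x :
  it_mx (it_lincomb c V) x = \sum_i c i *: it_mx (V i) x.
Proof.
rewrite /it_mx /=.
apply/matrixP => i j; rewrite summxE.
rewrite -[i]splitK -[j]splitK; case: (fintype.split i) => i'; case: (fintype.split j) => j' /=.
- rewrite block_mxEul summxE; apply: eq_bigr => l _; by rewrite [in RHS]mxE block_mxEul mxE.
- rewrite block_mxEur mxE summxE -sumrN; apply: eq_bigr => l _.
  by rewrite [in RHS]mxE block_mxEur !mxE mulrN.
- by rewrite block_mxEdl mxE big1 // => l _; rewrite mxE block_mxEdl mxE mulr0.
- rewrite block_mxEdr mxE mulr_suml -sumrMnl; apply: eq_bigr => l _.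
  by rewrite [in RHS]mxE block_mxEdr !mxE mulrnAr mulrA.
Qed.

Definition derivable_mx p q (A : 'cV[R]_n -> 'M[R]_(p, q)) x :=
  forall i j k, derivable (fun x => A x i j) x (delta_mx k ord0).

Lemma smooth_derivable_mx M p q (A : 'cV[R]_n -> 'M[R]_(p, q)) x :
  smooth_mx M A -> M x -> derivable_mx A x.
Proof. by move=> sA Mx i j k; exact: Ck_derivable (sA i j 1%N) Mx. Qed.

Lemma smooth_it_mx M V : open M -> is_inf_transf M V -> smooth_mx M (it_mx V).
Proof.
move=> oM [_ [sC _] st sH] i j k.
rewrite -[i]splitK -[j]splitK; case: (fintype.split i) => i'; case: (fintype.split j) => j' /=.
- apply: (@Ck_ext _ _ _ _ (fun x => it_C V x i' j')) => //; last exact: sC.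
  by move=> x _; rewrite block_mxEul.
- apply: (@Ck_ext _ _ _ _ (fun x => - it_H V x i' j')) => //; last by apply: Ck_opp => //; exact: sH.
  by move=> x _; rewrite block_mxEur mxE.
- apply: (@Ck_ext _ _ _ _ (fun x => 0)) => //; last exact: Ck_cst.
  by move=> x _; rewrite block_mxEdl mxE.
- apply: (@Ck_ext _ _ _ _ (fun x => it_tau V x * 2^-1)) => //; last first.
    by apply: Ck_mul => //; exact: Ck_cst.
  by move=> x _; rewrite block_mxEdr !ord1 mxE eqxx.
Qed.

(** The sign of the commutator is that of linear vector fields: z -> A z and z -> B z have bracket
    (B A - A B) z. The factors - tau / 2 + C in the H component come from the upper right block of
    this commutator. *)
Lemma it_mx_bracket M V W x : open M -> is_inf_transf M V -> is_inf_transf M W -> M x ->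
  it_mx (it_bracket V W) x =
  vf_app_mx (it_Y V) (it_mx W) x - vf_app_mx (it_Y W) (it_mx V) x
  - (it_mx V x *m it_mx W x - it_mx W x *m it_mx V x).
Proof.
move=> oM; suff E Z (Y : 'cV[R]_n -> 'cV[R]_n) : is_inf_transf M Z -> M x ->
    vf_app_mx Y (it_mx Z) x = block_mx (vf_app_mx Y (it_C Z) x) (- vf_app_mx Y (it_H Z) x) 0
       (vf_app Y (it_tau Z) x / 2)%:M.
  move=> sV sW Mx; rewrite !E // /it_mx /= !mulmx_block.
  rewrite !(mul0mx, mulmx0, addr0, add0r) !opp_block_mx !add_block_mx.
  rewrite !opp_block_mx !add_block_mx; congr block_mx.
  - rewrite !mulmxN !mul_mx_scalar !mulmxDl !mul_scalar_mx.
    apply/matrixP => i j; rewrite !mxE; ring.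
  - by rewrite !subr0.
  - by apply/matrixP => i j; rewrite !ord1 !mxE !big_ord1 !mxE eqxx !mulr1n; ring.
move=> sZ Mx; have [_ [sC _] st sH] := sZ.
apply/matrixP => i j; rewrite [LHS]mxE.
rewrite -[i]splitK -[j]splitK; case: (fintype.split i) => i'; case: (fintype.split j) => j' /=.
- rewrite block_mxEul mxE; apply: eq_bigr => k _; congr (_ * _).
  by congr (partial k _ x); apply/funext => y; rewrite block_mxEul.
- rewrite block_mxEur !mxE -sumrN; apply: eq_bigr => k _; rewrite -mulrN; congr (_ * _).
  rewrite -mulN1r -partialZ; last exact: Ck_derivable (sH _ _ 1%N) Mx.
  by congr (partial k _ x); apply/funext => y; rewrite block_mxEur mxE mulN1r.
- rewrite block_mxEdl mxE; apply: big1 => k _.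
  rewrite (_ : (fun y => _) = fun=> 0) ?partial_cst ?mulr0 //.
  by apply/funext => y; rewrite block_mxEdl mxE.
- rewrite block_mxEdr !ord1 mxE eqxx mulr1n mulr_suml; apply: eq_bigr => k _.
  rewrite -mulrA; congr (_ * _); rewrite mulrC -partialZ; last exact: Ck_derivable (st 1%N) Mx.
  by congr (partial k _ x); apply/funext => y; rewrite block_mxEdr mxE eqxx mulrC.
Qed.

Lemma vf_app_mx_bilin p q k l (c : 'I_k -> R) (d : 'I_l -> R) (Y : 'I_k -> 'cV[R]_n -> 'cV[R]_n)
    (A : 'I_l -> 'cV[R]_n -> 'M[R]_(p, q)) x : (forall j, derivable_mx (A j) x) ->
  vf_app_mx (fun x => \sum_i c i *: Y i x) (fun x => \sum_j d j *: A j x) x =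
  \sum_i \sum_j (c i * d j) *: vf_app_mx (Y i) (A j) x.
Proof.
move=> dA; apply/matrixP => a b; rewrite [LHS]mxE summxE.
transitivity (\sum_k0 (\sum_i c i * Y i x k0 ord0) * \sum_j d j * partial k0 (fun y => A j y a b) x).
  apply: eq_bigr => k0 _; rewrite summxE; congr (_ * _).
    by apply: eq_bigr => i _; rewrite mxE.
  have dj j : derivable (fun y => d j * A j y a b) x (delta_mx k0 ord0).
    by apply: derivableM; [exact: derivable_cst|exact: dA].
  have [_ E] := partial_sum (index_enum 'I_l) (P := xpredT) (fun j _ => dj j).
  transitivity (partial k0 (fun y => \sum_j d j * A j y a b) x).
    by congr (partial k0 _ x); apply/funext => y; rewrite summxE; apply: eq_bigr => j _; rewrite mxE.
  rewrite E; apply: eq_bigr => j _; rewrite partialZ //; exact: dA.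
under eq_bigr do rewrite mulr_suml.
rewrite exchange_big /=; apply: eq_bigr => i _.
under eq_bigr do rewrite mulr_sumr.
rewrite exchange_big /= summxE; apply: eq_bigr => j _.
rewrite !mxE mulr_sumr; apply: eq_bigr => k0 _; ring.
Qed.

Lemma lincomb_inf_transf M k (c : 'I_k -> R) (V : 'I_k -> inf_transf R n m) :
  open M -> (forall i, is_inf_transf M (V i)) -> is_inf_transf M (it_lincomb c V).
Proof.
move=> oM sV.
have H p q (A : 'I_k -> 'cV[R]_n -> 'M[R]_(p, q)) : (forall i, smooth_mx M (A i)) ->
   smooth_mx M (fun x => \sum_i c i *: A i x).
  move=> sA a b l; apply: (@Ck_ext _ _ _ _ (fun x => \sum_i c i * A i x a b)) => //.
    by move=> x _; rewrite summxE; apply: eq_bigr => i _; rewrite mxE.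
  by apply: Ck_sum => // i _; apply: Ck_mul => //; [exact: Ck_cst|exact: sA].
split=> /=.
- by apply: H => i; have [] := sV i.
- split; first by apply: H => i; have [_ []] := sV i.
  move=> x Mx; rewrite linear_sum -sumrN; apply: eq_bigr => i _.
  by have [_ [_ h] _ _] := sV i; rewrite linearZ /= h // scalerN.
- move=> l; apply: Ck_sum => // i _; apply: Ck_mul => //; first exact: Ck_cst.
  by have [_ _ h _] := sV i; exact: h.
- by apply: H => i; have [] := sV i.
Qed.

Lemma it_bracket_bilin M k l (c : 'I_k -> R) (d : 'I_l -> R)
    (V : 'I_k -> inf_transf R n m) (W : 'I_l -> inf_transf R n m) x :
  open M -> (forall i, is_inf_transf M (V i)) -> (forall i, is_inf_transf M (W i)) -> M x ->
  it_Y (it_bracket (it_lincomb c V) (it_lincomb d W)) x =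
    \sum_i \sum_j (c i * d j) *: it_Y (it_bracket (V i) (W j)) x /\
  it_mx (it_bracket (it_lincomb c V) (it_lincomb d W)) x =
    \sum_i \sum_j (c i * d j) *: it_mx (it_bracket (V i) (W j)) x.
Proof.
move=> oM sV sW Mx.
have dY Z : is_inf_transf M Z -> derivable_mx (it_Y Z) x.
  by case=> sY _ _ _; exact: smooth_derivable_mx sY Mx.
have dA Z : is_inf_transf M Z -> derivable_mx (it_mx Z) x.
  by move=> sZ; exact: smooth_derivable_mx (smooth_it_mx oM sZ) Mx.
have sVl := lincomb_inf_transf c oM sV; have sWl := lincomb_inf_transf d oM sW.
split.
  rewrite /= /vf_bracket vf_app_mx_bilin; last by move=> j; exact: dY.
  rewrite vf_app_mx_bilin; last by move=> j; exact: dY.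
  rewrite [X in _ - X]exchange_big -sumrB; apply: eq_bigr => i _; rewrite -sumrB.
  by apply: eq_bigr => j _; rewrite scalerBr [d j * _]mulrC.
rewrite (it_mx_bracket oM) //.
have -> : it_mx (it_lincomb c V) = fun x => \sum_i c i *: it_mx (V i) x.
  by apply/funext => y; exact: it_mx_lincomb.
have -> : it_mx (it_lincomb d W) = fun x => \sum_i d i *: it_mx (W i) x.
  by apply/funext => y; exact: it_mx_lincomb.
rewrite /= !vf_app_mx_bilin; try by move=> j; exact: dA.
rewrite [X in _ - X - _]exchange_big -sumrB.
have mulE (p q : nat) (c1 : 'I_p -> R) (d1 : 'I_q -> R) (A : 'I_p -> 'M[R]_(m + 1)) (B : 'I_q -> 'M[R]_(m + 1)) :
   (\sum_i c1 i *: A i) *m (\sum_j d1 j *: B j) = \sum_i \sum_j (c1 i * d1 j) *: (A i *m B j).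
  rewrite mulmx_suml; apply: eq_bigr => i _; rewrite mulmx_sumr; apply: eq_bigr => j _.
  by rewrite -scalemxAl -scalemxAr scalerA.
rewrite !mulE [X in _ - (_ - X)]exchange_big -!sumrB; apply: eq_bigr => i _; rewrite -!sumrB.
apply: eq_bigr => j _; rewrite (it_mx_bracket oM) // !scalerBr [d j * _]mulrC //.
Qed.

Lemma it_span_coord r M (V : 'I_r -> inf_transf R n m) Z : it_span M (range V) Z ->
  exists d : 'rV[R]_r, it_eq_on M Z (it_lincomb (d ord0) V).
Proof.
move=> [k [c [W [WV ZW]]]].
have /choice[f Vf] i : exists j, V j = W i by have [j _ <-] := WV i; exists j.
(* A generator may be repeated in the combination; its coefficients are collected. *)
exists (\row_j \sum_(i < k | f i == j) c i) => x Mx.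
have E (T : lmodType R) (e : inf_transf R n m -> T) :
    \sum_i c i *: e (W i) = \sum_j (\row_j \sum_(i < k | f i == j) c i) ord0 j *: e (V j).
  rewrite (partition_big f xpredT) //=; apply: eq_bigr => j _.
  rewrite mxE scaler_suml; apply: eq_bigr => i /eqP <-.
  by rewrite -Vf.
have [-> -> -> ->] := ZW x Mx; split.
- exact: (E _ (fun V => it_Y V x)).
- exact: (E _ (fun V => it_C V x)).
- exact: (E R^o (fun V => it_tau V x)).
- exact: (E _ (fun V => it_H V x)).
Qed.

(** The problem is moved to vectors of coefficients, where [flag_basis] applies. Solvability can be
    transported there because the independent vectors Y_i(x0) detect every nonzero coefficient
    vector. *)
Lemma solvable_flag r M (V : 'I_r -> inf_transf R n m) x0 : open M -> M x0 ->
  (forall i, is_inf_transf M (V i)) -> lie_subalgebra (it_span M (range V)) ->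
  solvable_lie M (it_span M (range V)) -> regular_vf M (fun i => it_Y (V i)) ->
  exists A : 'M[R]_r, A \in unitmx /\
    forall i l : 'I_r, exists c : 'I_r -> R, (forall p : 'I_r, (maxn i l <= p)%N -> c p = 0) /\
      it_eq_on M (it_bracket (it_lincomb (A i) V) (it_lincomb (A l) V))
         (it_lincomb c (fun p => it_lincomb (A p) V)).
Proof.
move=> oM Mx0 sV algV [K solV] regV.
pose lc (u : 'rV[R]_r) := it_lincomb (u ord0) V.
have lcs u : is_inf_transf M (lc u) by exact: lincomb_inf_transf.
have spanV u : it_span M (range V) (lc u).
  exists r, (u ord0), V; split=> [i|x _]; [by exists i|by []].
have lcV i x : it_Y (V i) x = it_Y (lc (delta_mx ord0 i)) x /\ it_mx (V i) x = it_mx (lc (delta_mx ord0 i)) x.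
  have E (T : lmodType R) (e : 'I_r -> T) : e i = \sum_j (delta_mx ord0 i : 'rV[R]_r) ord0 j *: e j.
    rewrite (bigD1 i) //= big1 => [|j ji]; first by rewrite mxE !eqxx scale1r addr0.
    by rewrite mxE (negbTE ji) andbF scale0r.
  by rewrite it_mx_lincomb; split; [exact: E _ (fun i => it_Y (V i) x)|exact: E _ (fun i => it_mx (V i) x)].
have /choice[cc ccP] (ij : 'I_r * 'I_r) : exists d : 'rV[R]_r,
    it_eq_on M (it_bracket (V ij.1) (V ij.2)) (lc d).
  apply: it_span_coord; apply: algV.
  - exists 1%N, (fun=> 1), (fun=> V ij.1); split=> [_|x _]; first by exists ij.1.
    by split; rewrite /= big_ord1 ?scale1r ?mul1r.
  - exists 1%N, (fun=> 1), (fun=> V ij.2); split=> [_|x _]; first by exists ij.2.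
    by split; rewrite /= big_ord1 ?scale1r ?mul1r.
(* The bracket of coefficient vectors given by the structure constants [cc], bilinear by
   definition. *)
pose br (u v : 'rV[R]_r) := \sum_i \sum_j (u ord0 i * v ord0 j) *: cc (i, j).
have linE (T : lmodType R) (e : 'I_r -> T) I (s : seq I) (a : I -> R) (u : I -> 'rV[R]_r) :
    \sum_k (\sum_(i <- s) a i *: u i) ord0 k *: e k = \sum_(i <- s) a i *: \sum_k u i ord0 k *: e k.
  under [RHS]eq_bigr do rewrite scaler_sumr.
  rewrite exchange_big /=; apply: eq_bigr => k _; rewrite summxE scaler_suml.
  by apply: eq_bigr => i _; rewrite mxE scalerA.
have br_suml (v : 'rV[R]_r) I (s : seq I) (c : I -> R) (u : I -> 'rV[R]_r) :
    br (\sum_(i <- s) c i *: u i) v = \sum_(i <- s) c i *: br (u i) v.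
  rewrite /br; under eq_bigr do (under eq_bigr do rewrite -scalerA; rewrite -scaler_sumr).
  rewrite linE; apply: eq_bigr => i _; congr (_ *: _); apply: eq_bigr => k _.
  by rewrite scaler_sumr; apply: eq_bigr => l _; rewrite scalerA.
have br_sumr (v : 'rV[R]_r) I (s : seq I) (c : I -> R) (u : I -> 'rV[R]_r) :
    br v (\sum_(i <- s) c i *: u i) = \sum_(i <- s) c i *: br v (u i).
  have brE (w : 'rV[R]_r) : br v w = \sum_j w ord0 j *: \sum_i v ord0 i *: cc (i, j).
    rewrite /br exchange_big; apply: eq_bigr => j _; rewrite scaler_sumr.
    by apply: eq_bigr => i _; rewrite scalerA mulrC.
  by rewrite brE linE; apply: eq_bigr => i _; rewrite brE.
have lc_br u v : it_eq_on M (it_bracket (lc u) (lc v)) (lc (br u v)).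
  have linS (T : lmodType R) (e : 'I_r -> T) (f : 'I_r -> 'rV[R]_r) :
      \sum_k (\sum_i f i) ord0 k *: e k = \sum_i \sum_k f i ord0 k *: e k.
    by rewrite exchange_big; apply: eq_bigr => k _; rewrite summxE scaler_suml.
  apply/it_eq_onP => x Mx; have [-> ->] := it_bracket_bilin (u ord0) (v ord0) oM sV sV Mx.
  rewrite [in X in _ /\ X]it_mx_lincomb [it_Y (lc _) x]/= /br !linS.
  split; apply: eq_bigr => i _; rewrite linE; apply: eq_bigr => j _; congr (_ *: _).
    by have [h _] := (it_eq_onP _ _ _).1 (ccP (i, j)) x Mx; exact: h.
  by have [_ h] := (it_eq_onP _ _ _).1 (ccP (i, j)) x Mx; rewrite h it_mx_lincomb.
(* Through this inclusion the vanishing of the derived series passes to [derv]. *)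
have derP k : forall w, w \in derv br k -> derived_series M (it_span M (range V)) k (lc w).
  elim: k => [w _|k IH w]; first exact: spanV.
  rewrite [derv br k.+1]/(brv br (derv br k)) /brv.
  set X := [seq _ | u <- _, v <- _] => wX.
  have XE (i : 'I_(size X)) : exists uv : 'rV[R]_r * 'rV[R]_r,
      [/\ uv.1 \in derv br k, uv.2 \in derv br k & X`_i = br uv.1 uv.2].
    have : X`_i \in X by exact: mem_nth.
    move=> /allpairsP[[u v] [/= uS vS E]]; exists (u, v); split=> //; exact: vbasis_mem.
  have /choice[uv uvP] := XE.
  have [a wE] : exists a : 'I_(size X) -> R, w = \sum_i a i *: br (uv i).1 (uv i).2.
    exists (fun i => coord (in_tuple X) i w); rewrite {1}(coord_span (X := in_tuple X) wX).
    by apply: eq_bigr => i _; have [_ _ <-] := uvP i.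
  exists (size X), a, (fun i => it_bracket (lc (uv i).1) (lc (uv i).2)).
  split=> [i|].
    exists (lc (uv i).1), (lc (uv i).2); have [u v _] := uvP i.
    by split=> //; exact: IH.
  apply/it_eq_onP => x Mx; rewrite wE !it_mx_lincomb /= !linE.
  split; apply: eq_bigr => i _; congr (_ *: _).
    by have [h _] := (it_eq_onP _ _ _).1 (lc_br (uv i).1 (uv i).2) x Mx.
  rewrite -it_mx_lincomb.
  by have [_ h] := (it_eq_onP _ _ _).1 (lc_br (uv i).1 (uv i).2) x Mx.
have dK : derv br K = 0%VS.
  apply/eqP; rewrite -subv0; apply/subvP => w wK; rewrite memv0; apply/eqP/rowP => j; rewrite mxE.
  have [h _ _ _] := solV _ (derP K w wK) x0 Mx0.
  have /freeP/(_ (fun i => w ord0 i)) := regV x0 Mx0; apply.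
  by rewrite -[RHS]h /=; apply: eq_bigr => i _; rewrite nth_mktuple.
have [X [bX hX]] : exists X : r.-tuple 'rV[R]_r, basis_of fullv X /\
    forall i l, (i < r)%N -> (l < r)%N -> br X`_i X`_l \in <<take (maxn i l) X>>%VS.
  have [X [bX hX]] := flag_basis br_suml br_sumr dK.
  have sX : size X == r.
    have /= <- := size_basis (X := in_tuple X) bX; rewrite dimvf dim_matrix; lia.
  by exists (Tuple sX); split=> // i l ir lr; apply: hX; rewrite (eqP sX).
have fX : free X by exact: basis_free bX.
pose A : 'M[R]_r := \matrix_(i < r) X`_i.
have lcA (i : 'I_r) : it_lincomb (A i) V = lc X`_i.
  by rewrite /lc; congr it_lincomb; apply/funext => j; rewrite mxE.
exists A; split.
  rewrite -row_free_unit; apply: inj_row_free => v.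
  rewrite mulmx_sum_row => v0; apply/rowP => j; rewrite [RHS]mxE.
  have /freeP/(_ (fun i => v ord0 i)) := fX; apply.
  by rewrite -[RHS]v0; apply: eq_bigr => i _; rewrite rowK.
move=> i l; have bM := hX i l (ltn_ord i) (ltn_ord l).
have [c [c0 wE]] : exists c : 'I_r -> R, (forall p : 'I_r, (maxn i l <= p)%N -> c p = 0) /\
    br X`_i X`_l = \sum_p c p *: X`_p.
  exists (fun p => coord X p (br X`_i X`_l)); split; last exact: coord_basis bX (memvf _).
  (* An element of the span of a prefix of a free family has no coordinate beyond that prefix. *)
  move=> p ilp; rewrite (coord_span (X := in_tuple (take (maxn i l) X)) bM).
  rewrite linear_sum big1 // => k _; rewrite linearZ /=.
  have ilr : (maxn i l < r)%N by rewrite gtn_max !ltn_ord.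
  have km : (k < maxn i l)%N by have := ltn_ord k; rewrite {2}size_takel // size_tuple ltnW.
  rewrite nth_take // (coord_free (Ordinal (ltn_trans km ilr)) p fX) -val_eqE /=.
  by rewrite ltn_eqF ?mulr0 //; exact: leq_trans km ilp.
exists c; split=> //; rewrite !lcA; apply/it_eq_onP => x Mx.
have [-> ->] := (it_eq_onP _ _ _).1 (lc_br X`_i X`_l) x Mx.
rewrite wE !it_mx_lincomb /= !linE.
by split; apply: eq_bigr => p _; congr (_ *: _); rewrite ?it_mx_lincomb; apply: eq_bigr => k _; rewrite mxE.
Qed.

End Algebra.

(** * Symmetries and the generator *)

Section Derivations.
Context {R : realType} {n : nat}.
Implicit Types (D : set 'cV[R]_n) (f g : 'cV[R]_n -> R) (Y : 'cV[R]_n -> 'cV[R]_n) (x : 'cV[R]_n).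

Definition pderivable f x := forall k : 'I_n, derivable f x (delta_mx k ord0).

Lemma Ck_pderivable k D f x : Ck k.+1 D f -> D x -> pderivable f x.
Proof. by move=> fk Dx i; exact: Ck_derivable fk Dx. Qed.

Lemma Ckmx_derivable_mx k D p q (A : 'cV[R]_n -> 'M[R]_(p, q)) x :
  Ckmx k.+1 D A -> D x -> derivable_mx A x.
Proof. by move=> Ak Dx i j l; exact: Ck_derivable (Ak i j) Dx. Qed.

Lemma vf_app_ext D Y f g x : open D -> D x -> {in D, f =1 g} -> vf_app Y f x = vf_app Y g x.
Proof. by move=> oD Dx fg; apply: eq_bigr => k _; rewrite (partial_ext k oD Dx fg). Qed.

Lemma vf_app_cst Y (c : R) x : vf_app Y (fun=> c) x = 0.
Proof. by rewrite /vf_app big1 // => k _; rewrite partial_cst mulr0. Qed.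

Lemma vf_appM Y f g x : pderivable f x -> pderivable g x ->
  vf_app Y (fun y => f y * g y) x = f x * vf_app Y g x + g x * vf_app Y f x.
Proof.
move=> df dg; rewrite !mulr_sumr -big_split; apply: eq_bigr => k _ /=.
rewrite partialM //; ring.
Qed.

Lemma vf_app_sum Y I (s : seq I) (P : pred I) (F : I -> 'cV[R]_n -> R) x :
  (forall i, P i -> pderivable (F i) x) ->
  vf_app Y (fun y => \sum_(i <- s | P i) F i y) x = \sum_(i <- s | P i) vf_app Y (F i) x.
Proof.
move=> dF; rewrite exchange_big /=; apply: eq_bigr => k _.
by have [_ ->] := partial_sum s (fun i Pi => dF i Pi k); rewrite mulr_sumr.
Qed.

Lemma vf_app_mx_mul Y p q s (A : 'cV[R]_n -> 'M[R]_(p, q)) (B : 'cV[R]_n -> 'M[R]_(q, s)) x :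
  derivable_mx A x -> derivable_mx B x ->
  vf_app_mx Y (fun y => A y *m B y) x = vf_app_mx Y A x *m B x + A x *m vf_app_mx Y B x.
Proof.
move=> dA dB; apply/matrixP => i j; rewrite [LHS]mxE.
transitivity (vf_app Y (fun y => \sum_k A y i k * B y k j) x).
  by apply: eq_bigr => k _; congr (_ * partial k _ x); apply/funext => y; rewrite mxE.
rewrite vf_app_sum => [|k _ l]; last by apply: derivableM; [exact: dA|exact: dB].
rewrite !mxE -big_split; apply: eq_bigr => k _ /=.
rewrite vf_appM => [|l|l]; [|exact: dA|exact: dB].
by rewrite !mxE; ring.
Qed.

Lemma vf_app_mx_tr Y p q (A : 'cV[R]_n -> 'M[R]_(p, q)) x :
  vf_app_mx Y (fun y => (A y)^T) x = (vf_app_mx Y A x)^T.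
Proof.
apply/matrixP => i j; rewrite !mxE; apply: eq_bigr => k _.
by congr (_ * partial k _ x); apply/funext => y; rewrite mxE.
Qed.

Lemma vf_app_mx_opp Y p q (A : 'cV[R]_n -> 'M[R]_(p, q)) x : derivable_mx A x ->
  vf_app_mx Y (fun y => - A y) x = - vf_app_mx Y A x.
Proof.
move=> dA; apply/matrixP => i j; rewrite !mxE -sumrN; apply: eq_bigr => k _.
rewrite -mulrN; congr (_ * _); rewrite -mulN1r -partialZ; last exact: dA.
by congr (partial k _ x); apply/funext => y; rewrite mxE mulN1r.
Qed.

Lemma vf_app_mx_scale Y p q f (A : 'cV[R]_n -> 'M[R]_(p, q)) x : pderivable f x -> derivable_mx A x ->
  vf_app_mx Y (fun y => f y *: A y) x = vf_app Y f x *: A x + f x *: vf_app_mx Y A x.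
Proof.
move=> df dA; apply/matrixP => i j; rewrite [LHS]mxE.
transitivity (vf_app Y (fun y => f y * A y i j) x).
  by apply: eq_bigr => k _; congr (_ * partial k _ x); apply/funext => y; rewrite mxE.
rewrite (vf_appM _ df); last by move=> k; exact: dA.
by rewrite !mxE; ring.
Qed.

Lemma vf_app_tr Y p (A : 'cV[R]_n -> 'M[R]_p) x : derivable_mx A x ->
  vf_app Y (fun y => \tr (A y)) x = \tr (vf_app_mx Y A x).
Proof.
move=> dA; rewrite vf_app_sum => [|i _ k]; last exact: dA.
by apply: eq_bigr => i _; rewrite mxE.
Qed.

Lemma vf_appD Y f g x : pderivable f x -> pderivable g x ->
  vf_app Y (fun y => f y + g y) x = vf_app Y f x + vf_app Y g x.
Proof.
move=> df dg; rewrite -big_split; apply: eq_bigr => k _ /=.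
by rewrite partialD // mulrDr.
Qed.

Lemma vf_appZ Y (c : R) f x : pderivable f x ->
  vf_app Y (fun y => c * f y) x = c * vf_app Y f x.
Proof. by move=> df; rewrite mulr_sumr; apply: eq_bigr => k _; rewrite partialZ // mulrCA. Qed.

Lemma vf_appV D Y f x : open D -> D x -> Ck 1 D f -> (forall y, D y -> f y != 0) ->
  vf_app Y (fun y => (f y)^-1) x = - (f x)^-1 ^+ 2 * vf_app Y f x.
Proof.
move=> oD Dx f1 f0; have V1 := Ck_inv oD f0 f1.
have : vf_app Y (fun y => f y * (f y)^-1) x = 0.
  rewrite -(vf_app_cst Y 1 x); apply: vf_app_ext oD Dx _ => y; rewrite inE => Dy.
  by rewrite divff // f0.
rewrite vf_appM; [|exact: Ck_pderivable f1 Dx|exact: Ck_pderivable V1 Dx].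
move/eqP; rewrite addr_eq0 => /eqP E; apply: (mulfI (f0 _ Dx)); rewrite E.
by field; exact: f0.
Qed.

Definition grad f x : 'rV[R]_n := \row_k partial k f x.
Definition hess f x : 'M[R]_n := \matrix_(i, j) partial i (partial j f) x.

Lemma Ckmx_grad k D f : Ck k.+1 D f -> Ckmx k D (grad f).
Proof.
move=> fk i j; rewrite (_ : (fun _ => _) = partial j f); first exact: Ck_partial.
by apply/funext => x; rewrite mxE.
Qed.

Lemma Ckmx_hess k D f : Ck k.+2 D f -> Ckmx k D (hess f).
Proof.
move=> fk i j; rewrite (_ : (fun _ => _) = partial i (partial j f)).
  by apply: Ck_partial; exact: Ck_partial.
by apply/funext => x; rewrite mxE.
Qed.

Lemma partial_vf_app D Y f x j : open D -> D x -> Ckmx 1 D Y -> Ck 2 D f ->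
  partial j (vf_app Y f) x = (grad f x *m jacobian_mx Y x) ord0 j
   + \sum_k Y x k ord0 * partial j (partial k f) x.
Proof.
move=> oD Dx Y1 f2.
have d1 k : pderivable (fun y => Y y k ord0) x by exact: Ck_pderivable (Y1 k ord0) Dx.
have d2 k : pderivable (partial k f) x by exact: Ck_pderivable (Ck_partial k f2) Dx.
have dd k : derivable (fun y => Y y k ord0 * partial k f y) x (delta_mx j ord0).
  by apply: derivableM; [exact: d1|exact: d2].
have [_ ->] := partial_sum (index_enum 'I_n) (P := xpredT) (fun k _ => dd k).
rewrite mxE -big_split; apply: eq_bigr => k _; rewrite partialM //; [|exact: d1|exact: d2].
by rewrite !mxE /= addrC.
Qed.

Lemma vf_app_grad D Y f x : open D -> D x -> Ckmx 1 D Y -> Ck 2 D f ->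
  vf_app_mx Y (grad f) x = grad (vf_app Y f) x - grad f x *m jacobian_mx Y x.
Proof.
move=> oD Dx Y1 f2; apply/rowP => j; rewrite [LHS]mxE [RHS]mxE [grad _ _ _ _]mxE.
rewrite (partial_vf_app j oD Dx Y1 f2) [X in _ + X]mxE [X in X - _]addrC addrK.
apply: eq_bigr => k _; rewrite (schwarz j k oD f2 Dx); congr (_ * partial k _ x).
by apply/funext => y; rewrite mxE.
Qed.

(** Product rule twice: the second derivatives of Y give the sum over k, the two cross terms the
    final pair of transposes. *)
Lemma vf_app_hess D Y f x : open D -> D x -> Ckmx 2 D Y -> Ck 3 D f ->
  vf_app_mx Y (hess f) x = hess (vf_app Y f) x
   - \sum_k partial k f x *: hess (fun y => Y y k ord0) x
   - hess f x *m jacobian_mx Y x - (hess f x *m jacobian_mx Y x)^T.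
Proof.
move=> oD Dx Y2 f3; apply/matrixP => i j.
have Y1 : Ckmx 1 D Y by move=> a b; exact: Ck_le (Y2 a b).
have f2 : Ck 2 D f by exact: Ck_le f3.
have E : partial i (partial j (vf_app Y f)) x =
   \sum_k (partial i (partial j (fun y => Y y k ord0)) x * partial k f x
     + partial j (fun y => Y y k ord0) x * partial i (partial k f) x
     + partial i (fun y => Y y k ord0) x * partial j (partial k f) x
     + Y x k ord0 * partial i (partial j (partial k f)) x).
  have dk1 k : Ck 1 D (fun y => partial j (fun y => Y y k ord0) y * partial k f y).
    by apply: Ck_mul => //; apply: Ck_partial; [exact: Y2|exact: f2].
  have dk2 k : Ck 1 D (fun y => Y y k ord0 * partial j (partial k f) y).
    by apply: Ck_mul => //; apply: Ck_partial; exact: Ck_partial.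
  transitivity (partial i (fun y => \sum_k (partial j (fun y => Y y k ord0) y * partial k f y
        + Y y k ord0 * partial j (partial k f) y)) x).
    apply: (partial_ext _ oD Dx) => y; rewrite inE => Dy.
    rewrite (partial_vf_app j oD Dy Y1 f2) mxE -big_split; apply: eq_bigr => k _.
    by rewrite !mxE /= mulrC.
  have dd k : derivable (fun y => partial j (fun y => Y y k ord0) y * partial k f y
        + Y y k ord0 * partial j (partial k f) y) x (delta_mx i ord0).
    by apply: Ck_derivable (Ck_add oD (dk1 k) (dk2 k)) Dx.
  have [_ ->] := partial_sum (index_enum 'I_n) (P := xpredT) (fun k _ => dd k).
  apply: eq_bigr => k _.
  rewrite partialD; [|exact: Ck_derivable (dk1 k) Dx|exact: Ck_derivable (dk2 k) Dx].
  rewrite (partialM (Ck_derivable (i := i) (Ck_partial j (Y2 k ord0)) Dx) (Ck_derivable (i := i)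
      (Ck_partial k f2) Dx)).
  rewrite (partialM (Ck_derivable (i := i) (Y1 k ord0) Dx) (Ck_derivable (i := i) (Ck_partial j
      (Ck_partial k f3)) Dx)).
  have alg (a b c d e u g h : R) : a * b + c * d + (e * u + g * h) = d * c + a * b + h * g + e * u by ring.
  exact: alg.
have ent (A B C : 'M[R]_n) : (A - B - C - C^T) i j = A i j - B i j - C i j - C j i by rewrite !mxE.
rewrite ent [hess (vf_app Y f) x _ _]mxE E summxE.
have -> : vf_app_mx Y (hess f) x i j = \sum_k Y x k ord0 * partial i (partial j (partial k f)) x.
  rewrite mxE; apply: eq_bigr => k _; congr (_ * _).
  transitivity (partial k (partial i (partial j f)) x).
    by congr (partial k _ x); apply/funext => y; rewrite mxE.
  rewrite (schwarz k i oD (Ck_partial j f3) Dx); apply: (partial_ext _ oD Dx) => y; rewrite inE => Dy.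
  exact: schwarz oD f2 Dy.
rewrite [(hess f x *m _) i j]mxE [(hess f x *m _) j i]mxE -!sumrB; apply: eq_bigr => k _.
have alg (a b c d e u g : R) : d = a * e + b * u + c * g + d - e * a - u * b - g * c by ring.
apply: (etrans (alg (partial i (partial j (fun y => Y y k ord0)) x) (partial j (fun y => Y y k ord0) x)
  (partial i (fun y => Y y k ord0) x) _ (partial k f x) (partial i (partial k f) x) (partial j (partial k f) x))).
by congr (_ - _ - _ - _); [rewrite 2!mxE|rewrite 2!mxE|rewrite 2!mxE].
Qed.

End Derivations.

(** * Commutation of a symmetry with the generator *)

Section Generator.
Context {R : realType} {n m : nat}.
Implicit Types (D M : set 'cV[R]_n) (E : sde R n m) (V : inf_transf R n m).

(** The derivatives of f along the columns of the diffusion: the coefficients of dW in the Ito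
    formula for f(X). *)
Definition sgrad E (f : 'cV[R]_n -> R) x : 'rV[R]_m := grad f x *m diffusion E x.

(** In trace form the later cancellations become cyclic permutations and transpositions. *)
Lemma generatorE E f x : generator E f x =
  2^-1 * \tr (diffusion E x *m (diffusion E x)^T *m (hess f x)^T) + \tr (grad f x *m drift E x).
Proof.
rewrite /generator; congr (_ * _ + _).
  apply: eq_bigr => i _; rewrite mxE; apply: eq_bigr => j _.
  by rewrite [((hess f x)^T) _ _]mxE [hess _ _ _ _]mxE.
rewrite /mxtrace big_ord1 mxE; apply: eq_bigr => i _; by rewrite mxE mulrC.
Qed.

(** The second determining equation, read as [Y, sigma] = - tau / 2 sigma - sigma C and applied to
    f. *)
Lemma vf_app_sgrad D E V f x : open D -> D x -> smooth_sde D E -> is_inf_transf D V -> smooth D f ->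
  determining_equations D E V ->
  vf_app_mx (it_Y V) (sgrad E f) x = sgrad E (vf_app (it_Y V) f) x
   - (2^-1 * it_tau V x) *: sgrad E f x - sgrad E f x *m it_C V x.
Proof.
move=> oD Dx [_ sS] [sY _ _ _] sf /(_ x Dx)[_ e].
have Y1 : Ckmx 1 D (it_Y V) by move=> a b; exact: sY.
have S1 : Ckmx 1 D (diffusion E) by move=> a b; exact: sS.
rewrite vf_app_mx_mul; last 2 first.
- exact: Ckmx_derivable_mx (Ckmx_grad (sf 2%N)) Dx.
- exact: Ckmx_derivable_mx S1 Dx.
rewrite (vf_app_grad oD Dx Y1 (sf 2%N)) mulmxBl -mulmxA -addrA [- _ + _]addrC -mulmxBr.
have -> : vf_app_mx (it_Y V) (diffusion E) x - jacobian_mx (it_Y V) x *m diffusion E x =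
   vf_diffusion_bracket (it_Y V) (diffusion E) x.
  apply/matrixP => k a; rewrite !mxE; congr (_ - _); apply: eq_bigr => i _.
  by rewrite mxE mulrC.
rewrite -(addrA (sgrad _ _ _)) -opprD /sgrad; congr (_ + _).
rewrite scalemxAr -mulmxA -mulmxDr -mulmxN; congr (_ *m _).
by apply/eqP; rewrite -addr_eq0 addrA; apply/eqP.
Qed.

(** Both determining equations combine to [Y, L] = - tau L + H . sigma. The factor tau / 2 occurs
    twice in sigma sigma^T, and L(Y) in the equation for the drift absorbs the second derivatives of
    Y. *)
Lemma vf_app_generator D E V f x : open D -> D x -> smooth_sde D E -> is_inf_transf D V -> smooth D f ->
  determining_equations D E V ->
  vf_app (it_Y V) (generator E f) x = generator E (vf_app (it_Y V) f) x
   - it_tau V x * generator E f x + \tr (sgrad E f x *m it_H V x).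
Proof.
move=> oD Dx [sM sS] [sY [_ skC] _ _] sf /(_ x Dx)[e1 e2].
have Yk k : Ckmx k D (it_Y V) by move=> a b; exact: sY.
have Sk k : Ckmx k D (diffusion E) by move=> a b; exact: sS.
have Mk k : Ckmx k D (drift E) by move=> a b; exact: sM.
set Y := it_Y V in Yk *; set s := diffusion E in Sk *.
pose J := jacobian_mx Y x.
have Ys : vf_app_mx Y s x = J *m s x - (2^-1 * it_tau V x) *: s x - s x *m it_C V x.
  have e : vf_diffusion_bracket Y s x = vf_app_mx Y s x - J *m s x.
    apply/matrixP => k a; rewrite !mxE; congr (_ - _); apply: eq_bigr => i _.
    by rewrite mxE mulrC.
  move: e2; rewrite e => /eqP; rewrite addr_eq0 => /eqP/(canRL (addrK _))/(canRL (subrK _)) ->.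
  by rewrite addrC [- _ - _]addrC addrA.
have Ym : vf_app_mx Y (drift E) x = generator_cv E Y x + s x *m it_H V x - it_tau V x *: drift E x.
  move: e1 => /eqP; rewrite addr_eq0 => /eqP/(canRL (subrK _))/(canRL (subrK _)) ->.
  by rewrite addrC [- _ + _]addrC addrA.
pose a := s x *m (s x)^T; pose Q := hess f x.
have aT : a^T = a by rewrite trmx_mul trmxK.
have QT : Q^T = Q by apply/matrixP => i j; rewrite !mxE; exact: schwarz oD (sf 2%N) Dx.
pose N := \sum_k partial k f x *: hess (fun y => Y y k ord0) x.
(* The term in N cancels the one produced by [vf_app_hess], the term in J the one produced by
   [vf_app_grad]. *)
have LY : \tr (grad f x *m generator_cv E Y x) = 2^-1 * \tr (a *m N^T) + \tr (grad f x *m (J *m drift E x)).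
  have trE (g : 'cV[R]_n -> R) (v : 'cV[R]_n) : \tr (grad g x *m v) = \sum_k partial k g x * v k ord0.
    by rewrite /mxtrace big_ord1 mxE; apply: eq_bigr => i _; rewrite mxE.
  rewrite !trE /N linear_sum mulmx_sumr linear_sum mulr_sumr -big_split; apply: eq_bigr => k _.
  rewrite [generator_cv _ _ _ _ _]mxE generatorE /= linearZ -scalemxAr mxtraceZ trE mulrDr mulrCA.
  by congr (_ + _ * _); rewrite mxE; apply: eq_bigr => i _; rewrite !mxE.
have dg : derivable_mx (grad f) x by exact: Ckmx_derivable_mx (Ckmx_grad (sf 2%N)) Dx.
have dh : derivable_mx (hess f) x by exact: Ckmx_derivable_mx (Ckmx_hess (sf 3%N)) Dx.
have dht : derivable_mx (fun y => (hess f y)^T) x.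
  by apply: Ckmx_derivable_mx Dx; apply: Ckmx_tr => //; exact: Ckmx_hess (sf 3%N).
have ds : derivable_mx s x by exact: Ckmx_derivable_mx (Sk 1%N) Dx.
have dst : derivable_mx (fun y => (s y)^T) x by exact: Ckmx_derivable_mx (Ckmx_tr oD (Sk 1%N)) Dx.
have da : derivable_mx (fun y => s y *m (s y)^T) x.
  exact: Ckmx_derivable_mx (Ckmx_mul oD (Sk 1%N) (Ckmx_tr oD (Sk 1%N))) Dx.
have dm : derivable_mx (drift E) x by exact: Ckmx_derivable_mx (Mk 1%N) Dx.
have dah : derivable_mx (fun y => s y *m (s y)^T *m (hess f y)^T) x.
  have h := Ckmx_mul oD (Ckmx_mul oD (Sk 1%N) (Ckmx_tr oD (Sk 1%N))) (Ckmx_tr oD (Ckmx_hess (sf 3%N))).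
  exact: Ckmx_derivable_mx h Dx.
have dgm : derivable_mx (fun y => grad f y *m drift E y) x.
  exact: Ckmx_derivable_mx (Ckmx_mul oD (Ckmx_grad (sf 2%N)) (Mk 1%N)) Dx.
have dtr p (A : 'cV[R]_n -> 'M[R]_p) : derivable_mx A x -> pderivable (fun y => \tr (A y)) x.
  move=> dA k; have [h _] := partial_sum (index_enum 'I_p) (P := xpredT) (fun i _ => dA i i k).
  exact: h.
transitivity (vf_app Y (fun y => 2^-1 * \tr (s y *m (s y)^T *m (hess f y)^T) + \tr (grad f y *m drift E y)) x).
  by congr (vf_app _ _ x); apply/funext => y; exact: generatorE.
rewrite vf_appD; [|by move=> k; apply: derivableM; [exact: derivable_cst|exact: dtr dah _]|exact: dtr dgm].
rewrite vf_appZ; last exact: dtr.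
rewrite !vf_app_tr // vf_app_mx_mul // vf_app_mx_mul // vf_app_mx_mul // !vf_app_mx_tr.
have Y2 := Yk 2%N; have Y1 := Yk 1%N.
rewrite (vf_app_hess oD Dx Y2 (sf 3%N)) (vf_app_grad oD Dx Y1 (sf 2%N)) Ym.
rewrite !generatorE -/s -/a -/J -/N -/Q; clearbody Q N.
have tB p (A B : 'M[R]_p) : \tr (A - B) = \tr A - \tr B by rewrite linearB.
have E1 : \tr ((vf_app_mx Y s x *m (s x)^T + s x *m (vf_app_mx Y s x)^T) *m Q^T) =
   2 * \tr (J *m a *m Q) - it_tau V x * \tr (a *m Q).
  have -> : s x *m (vf_app_mx Y s x)^T = (vf_app_mx Y s x *m (s x)^T)^T by rewrite trmx_mul trmxK.
  set X := vf_app_mx Y s x *m (s x)^T.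
  have -> : \tr ((X + X^T) *m Q^T) = 2 * \tr (X *m Q).
    rewrite mulmxDl linearD /= -(mxtrace_tr (X^T *m _)) trmx_mul !trmxK QT (mxtrace_mulC Q); ring.
  rewrite /X Ys !mulmxBl -!scalemxAl -(mulmxA J (s x)) -/a !tB mxtraceZ.
  (* C drops out of the generator: sigma C sigma^T is skew while the Hessian is symmetric. *)
  have -> : \tr (s x *m it_C V x *m (s x)^T *m Q) = 0.
    set Z := s x *m _ *m _.
    have ZT : Z^T = - Z by rewrite /Z !trmx_mul trmxK skC // mulNmx mulmxN mulmxA.
    have : \tr (Z *m Q) = - \tr (Z *m Q).
      by rewrite -{1}mxtrace_tr trmx_mul QT ZT mulmxN linearN /= mxtrace_mulC.
    by move=> h; lra.
  by field.
have E2 : \tr (a *m (Q *m J)^T) = \tr (J *m a *m Q).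
  by rewrite -mxtrace_tr trmx_mul trmxK aT mxtrace_mulC mulmxA mxtrace_mulC mulmxA.
have E3 : \tr (a *m (Q *m J)) = \tr (J *m a *m Q).
  by rewrite mulmxA mxtrace_mulC mulmxA.
have E4 (A B C : 'M[R]_n) : \tr (a *m (A - B - C - C^T)^T) =
    \tr (a *m A^T) - \tr (a *m B^T) - \tr (a *m C^T) - \tr (a *m C).
  have trB (X Z : 'M[R]_n) : \tr (a *m (X - Z)^T) = \tr (a *m X^T) - \tr (a *m Z^T).
    by rewrite linearB /= mulmxBr linearB.
  by rewrite !trB trmxK.
have E5 (g1 g2 : 'rV[R]_n) (c : R) (u v w : 'cV[R]_n) : \tr ((g1 - g2 *m J) *m u + g2 *m (v + w - c *: u)) =
    \tr (g1 *m u) - \tr (g2 *m (J *m u)) + \tr (g2 *m v) + \tr (g2 *m w) - c * \tr (g2 *m u).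
  rewrite mulmxBl mulmxBr mulmxDr -mulmxA -scalemxAr mxtraceD !tB mxtraceD mxtraceZ; ring.
have E6 : \tr (sgrad E f x *m it_H V x) = \tr (grad f x *m (s x *m it_H V x)) by rewrite mulmxA.
rewrite QT in E1 *.
rewrite E6 (mxtraceD (_ *m Q)) (E4 (hess (vf_app Y f) x) N (Q *m J)) E1 E2 E3 (E5 (grad (vf_app Y f) x)) LY.
move: (\tr (J *m a *m Q)) (\tr (a *m Q)) (\tr (a *m _)) (\tr (a *m N^T)) => t1 t2 t3 t4.
move: (\tr (grad (vf_app Y f) x *m _)) (\tr (grad f x *m drift E x)) (\tr (grad f x *m (J *m _))) => t5 t6 t7.
by field.
Qed.

End Generator.

(** * The extended vector fields *)

Section Product.
Context {R : realType}.

(** Applied to the projection onto the first block and to its embedding, both of which carry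
    coordinate lines to coordinate lines. *)
Lemma partial_affine n p (g : 'cV[R]_p -> R) (a : 'cV[R]_n -> 'cV[R]_p) x k l :
  (forall h : R, a (h *: delta_mx k ord0 + x) = h *: delta_mx l ord0 + a x) ->
  partial k (fun y => g (a y)) x = partial l g (a x).
Proof.
move=> H; rewrite /partial /derive.
rewrite (_ : (fun h : R => _) = (fun h : R => h^-1 *: ((g \o shift (a x)) (h *: delta_mx l ord0) - g (a x)))) //.
by apply/funext => h /=; rewrite H.
Qed.

Lemma partial_affine0 n p (g : 'cV[R]_p -> R) (a : 'cV[R]_n -> 'cV[R]_p) x k :
  (forall h : R, a (h *: delta_mx k ord0 + x) = a x) ->
  partial k (fun y => g (a y)) x = 0.
Proof.
move=> H; rewrite /partial /derive.
rewrite (_ : (fun h : R => _) = (fun=> 0)); first exact: lim_cst.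
by apply/funext => h /=; rewrite H subrr scaler0.
Qed.

(** Agreement on a segment suffices; it is applied where the chart is explicit only on a slice,
    which is not a neighborhood. *)
Lemma partial_line_ext n (f g : 'cV[R]_n -> R) x k (e : R) : 0 < e ->
  (forall h : R, `|h| < e -> f (x + h *: delta_mx k ord0) = g (x + h *: delta_mx k ord0)) ->
  derivable g x (delta_mx k ord0) -> partial k f x = partial k g x.
Proof.
move=> e0 fg /derivableP/is_derive_edP dg.
suff [_] : is_derive x (delta_mx k ord0 : 'cV[R]_n) f (partial k g x) by [].
apply/is_derive_edP => a /dg[d d0 hd].
exists (Num.min d e); first by rewrite lt_min d0.
move=> h; rewrite lt_min => /andP[/hd hh he].
by have := fg 0; rewrite normr0 scale0r addr0 (fg _ he) => ->.
Qed.

Context {n q : nat}.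
Implicit Types (D : set 'cV[R]_n) (z : 'cV[R]_(n + q)).

Definition emb (x : 'cV[R]_n) : 'cV[R]_(n + q) := col_mx x 0.

Lemma usubmx_norm z : `|usubmx z| <= `|z|.
Proof. by apply/cv_norm_leP => // i; rewrite mxE; exact: cv_coord_le. Qed.

Lemma col_mx_norm (x : 'cV[R]_n) (y : 'cV[R]_q) (c : R) : `|x| < c -> `|y| < c -> `|col_mx x y| < c.
Proof.
move=> xc yc; have c0 : 0 < c by exact: le_lt_trans (normr_ge0 x) xc.
apply/cv_norm_ltP => // i; rewrite -[i]splitK; case: (fintype.split i) => j /=.
  by rewrite col_mxEu; apply: le_lt_trans xc; exact: cv_coord_le.
by rewrite col_mxEd; apply: le_lt_trans yc; exact: cv_coord_le.
Qed.

Lemma emb_ball (x x0 : 'cV[R]_n) (c : R) : `|x - x0| < c -> `|emb x - emb x0| < c.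
Proof.
move=> xc; rewrite /emb opp_col_mx add_col_mx subr0; apply: col_mx_norm => //.
by rewrite normr0; exact: le_lt_trans (normr_ge0 _) xc.
Qed.

Lemma open_usubmx D : open D -> open [set z : 'cV[R]_(n + q) | D (usubmx z)].
Proof.
move=> /open_edP oD; apply/open_edP => z /oD[d d0 hd]; exists d => // y yz; apply: hd.
by rewrite -linearB /=; exact: le_lt_trans (usubmx_norm _) yz.
Qed.

Lemma Ck_usubmx k D f : open D -> Ck k D f ->
  Ck k [set z : 'cV[R]_(n + q) | D (usubmx z)] (fun z => f (usubmx z)).
Proof.
move=> oD fk; apply: (Ck_comp (D' := D)) => //; first exact: open_usubmx.
move=> i; rewrite (_ : (fun _ => _) = fun z : 'cV[R]_(n + q) => z (lshift q i) ord0); first exact: Ck_coord.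
by apply/funext => z; rewrite mxE.
Qed.

Lemma partial_usubmxl f z k : partial (lshift q k) (fun z => f (usubmx z)) z = partial k f (usubmx z).
Proof.
apply: partial_affine => h; apply/colP => i; rewrite !mxE.
by rewrite (inj_eq (@lshift_inj _ _)).
Qed.

Lemma partial_usubmxr f z k : partial (rshift n k) (fun z => f (usubmx z)) z = 0.
Proof.
apply: partial_affine0 => h; apply/colP => i; rewrite !mxE.
by rewrite eq_lrshift /= mulr0 add0r.
Qed.

Lemma partial_emb f x k : partial k (fun x => f (emb x)) x = partial (lshift q k) f (emb x).
Proof.
apply: partial_affine => h; rewrite /emb -[delta_mx (lshift q k) ord0]vsubmxK.
rewrite scale_col_mx add_col_mx addr0; congr col_mx.
  by congr (_ *: _ + _); apply/colP => i; rewrite !mxE (inj_eq (@lshift_inj _ _)).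
by apply/colP => i; rewrite !mxE eq_rlshift /= mulr0.
Qed.

Lemma Ck_emb k (D' : set 'cV[R]_(n + q)) D f : open D -> open D' -> (forall x, D x -> D' (emb x)) ->
  Ck k D' f -> Ck k D (fun x => f (emb x)).
Proof.
move=> oD oD' DD fk; apply: (Ck_comp (D' := D')) => // i.
rewrite -[i]splitK; case: (fintype.split i) => j /=.
  rewrite (_ : (fun _ => _) = fun x : 'cV[R]_n => x j ord0); first exact: Ck_coord.
  by apply/funext => x; rewrite /emb col_mxEu.
rewrite (_ : (fun _ => _) = fun=> 0); first exact: Ck_cst.
by apply/funext => x; rewrite /emb col_mxEd mxE.
Qed.

Lemma vf_app_prod (X1 : 'cV[R]_(n + q) -> 'cV[R]_n) (X2 : 'cV[R]_(n + q) -> 'cV[R]_q) f z :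
  vf_app (fun z => col_mx (X1 z) (X2 z)) f z =
  \sum_k X1 z k ord0 * partial (lshift q k) f z + \sum_k X2 z k ord0 * partial (rshift n k) f z.
Proof.
rewrite /vf_app big_split_ord; congr (_ + _); apply: eq_bigr => k _.
  by rewrite col_mxEu.
by rewrite col_mxEd.
Qed.

End Product.

Section Extension.
Context {R : realType} {n m : nat}.
Implicit Types (M : set 'cV[R]_n) (V W : inf_transf R n m) (z : 'cV[R]_(n + (m + 1))).

Definition it_ext V z : 'cV[R]_(n + (m + 1)) :=
  col_mx (it_Y V (usubmx z)) (it_mx V (usubmx z) *m dsubmx z).

Lemma it_extl V i : (fun z => it_ext V z (lshift _ i) ord0) = fun z => it_Y V (usubmx z) i ord0.
Proof. by apply/funext => z; rewrite /it_ext col_mxEu. Qed.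

Lemma it_extr V i : (fun z => it_ext V z (rshift _ i) ord0) =
  fun z => \sum_j it_mx V (usubmx z) i j * z (rshift n j) ord0.
Proof.
by apply/funext => z; rewrite /it_ext col_mxEd mxE; apply: eq_bigr => j _; rewrite [dsubmx _ _ _]mxE.
Qed.

Lemma Ckmx_it_ext k M V : open M -> is_inf_transf M V -> Ckmx k [set z | M (usubmx z)] (it_ext V).
Proof.
move=> oM sV i j; rewrite (ord1 j) -[i]splitK; case: (fintype.split i) => l /=.
  by rewrite it_extl; apply: (Ck_usubmx (f := fun x => it_Y V x l ord0)) => //; have [sY _ _ _] := sV; exact: sY.
rewrite it_extr; have oM' := open_usubmx (q := m + 1) oM.
apply: Ck_sum => // p _; apply: Ck_mul => //; last exact: Ck_coord.
by apply: (Ck_usubmx (f := fun x => it_mx V x l p)) => //; exact: smooth_it_mx.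
Qed.

Lemma partial_it_extr M V z i l : open M -> is_inf_transf M V -> M (usubmx z) ->
  partial l (fun z => it_ext V z (rshift _ i) ord0) z =
  \sum_j (it_mx V (usubmx z) i j * (l == rshift n j)%:R +
          z (rshift n j) ord0 * partial l (fun z => it_mx V (usubmx z) i j) z).
Proof.
move=> oM sV Mz; rewrite it_extr; have oM' := open_usubmx (q := m + 1) oM.
have d1 j : Ck 1 [set z | M (usubmx z)] (fun z => it_mx V (usubmx z) i j).
  by apply: (Ck_usubmx (f := fun x => it_mx V x i j)) => //; exact: smooth_it_mx.
have d2 j : Ck 1 [set z | M (usubmx z)] (fun z => z (rshift n j) ord0) by exact: Ck_coord.
have [_ ->] := partial_sum (index_enum 'I_(m + 1)) (P := xpredT)
   (fun j _ => Ck_derivable (i := l) (Ck_mul oM' (d1 j) (d2 j)) Mz).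
apply: eq_bigr => j _.
by rewrite (partialM (Ck_derivable (i := l) (d1 j) Mz) (Ck_derivable (i := l) (d2 j) Mz)) partial_coord.
Qed.

Lemma vf_app_it_extl V W z i :
  vf_app (it_ext V) (fun z => it_ext W z (lshift _ i) ord0) z =
  vf_app_mx (it_Y V) (it_Y W) (usubmx z) i ord0.
Proof.
rewrite it_extl vf_app_prod mxE [X in _ + X]big1 ?addr0; last first.
  by move=> k _; rewrite (partial_usubmxr (fun x => it_Y W x i ord0)) mulr0.
by apply: eq_bigr => k _; rewrite (partial_usubmxl (fun x => it_Y W x i ord0)).
Qed.

Lemma vf_app_it_extr M V W z i : open M -> is_inf_transf M W -> M (usubmx z) ->
  vf_app (it_ext V) (fun z => it_ext W z (rshift _ i) ord0) z =
  ((vf_app_mx (it_Y V) (it_mx W) (usubmx z) + it_mx W (usubmx z) *m it_mx V (usubmx z))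
   *m dsubmx z) i ord0.
Proof.
move=> oM sW Mz; rewrite vf_app_prod mulmxDl [RHS]mxE -mulmxA; congr (_ + _).
  rewrite mxE.
  under eq_bigr do rewrite (partial_it_extr _ _ oM sW Mz) mulr_sumr.
  rewrite exchange_big; apply: eq_bigr => j _ /=; rewrite [dsubmx _ _ _]mxE [vf_app_mx _ _ _ _ _]mxE mulr_suml.
  apply: eq_bigr => k _; rewrite eq_lrshift mulr0 add0r (partial_usubmxl (fun x => it_mx W x i j)).
  by rewrite [z _ _ * _]mulrC mulrA.
rewrite [RHS]mxE; apply: eq_bigr => k _; rewrite mulrC; congr (_ * _).
rewrite (partial_it_extr _ _ oM sW Mz) (bigD1 k) //= eqxx mulr1 (partial_usubmxr (fun x => it_mx W x i k)).
rewrite mulr0 addr0 big1 ?addr0 // => j jk; rewrite (inj_eq (@rshift_inj _ _)) eq_sym (negbTE jk).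
by rewrite (partial_usubmxr (fun x => it_mx W x i j)) !mulr0 addr0.
Qed.

(** The last components of both sides are linear in z, and the comparison of their matrices is
    [it_mx_bracket]. *)
Lemma it_ext_bracket M V W z : open M -> is_inf_transf M V -> is_inf_transf M W -> M (usubmx z) ->
  vf_bracket (it_ext V) (it_ext W) z = it_ext (it_bracket V W) z.
Proof.
move=> oM sV sW Mz; apply/colP => i; rewrite -[i]splitK; case: (fintype.split i) => l /=.
  rewrite [RHS]col_mxEu /= !mxE !vf_app_it_extl /=; by rewrite !mxE.
rewrite [RHS]col_mxEd (it_mx_bracket oM) //.
rewrite [LHS]mxE [X in _ + X]mxE [X in X - _]mxE [X in _ - X]mxE.
rewrite (vf_app_it_extr _ _ oM sW) // (vf_app_it_extr _ _ oM sV) //.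
have mE (A B : 'M[R]_(m + 1)) (v : 'cV[R]_(m + 1)) : (A *m v) l ord0 - (B *m v) l ord0 = ((A - B) *m v) l ord0.
  by rewrite mulmxBl [RHS]mxE [X in _ = _ + X]mxE.
rewrite mE; congr ((_ *m _) _ _); apply/matrixP => a b.
move: (it_mx W _ *m it_mx V _) (it_mx V _ *m it_mx W _) => X1 X2; rewrite !mxE; ring.
Qed.

End Extension.

(** * The rectifying chart *)

Section Chart.
Context {R : realType}.

Lemma open_gt0 n (D : set 'cV[R]_n) (f : 'cV[R]_n -> R) : open D -> Ck 0 D f ->
  open [set x | D x /\ 0 < f x].
Proof.
move=> oD fc; apply/open_edP => x [Dx fx].
have [d d0 hd] := (open_edP _).1 oD x Dx.
have [e e0 he] := (cont_edP _ _).1 (Ck_cont fc Dx) _ fx.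
exists (Num.min d e); first by rewrite lt_min d0.
move=> y; rewrite lt_min => /andP[/hd Dy /he fy]; split=> //.
by move: fy; rewrite ltr_norml => /andP[h _]; move: h; lra.
Qed.

Lemma Ckmx_block n k (D : set 'cV[R]_n) p1 p2 q1 q2 (A : 'cV[R]_n -> 'M[R]_(p1, q1))
    (B : 'cV[R]_n -> 'M[R]_(p1, q2)) (C : 'cV[R]_n -> 'M[R]_(p2, q1)) (E : 'cV[R]_n -> 'M[R]_(p2, q2)) :
  Ckmx k D A -> Ckmx k D B -> Ckmx k D C -> Ckmx k D E ->
  Ckmx k D (fun x => block_mx (A x) (B x) (C x) (E x)).
Proof.
move=> kA kB kC kE i j.
rewrite -[i]splitK -[j]splitK; case: (fintype.split i) => i'; case: (fintype.split j) => j' /=.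
- by rewrite (_ : (fun _ => _) = fun x => A x i' j') //; apply/funext => x; rewrite block_mxEul.
- by rewrite (_ : (fun _ => _) = fun x => B x i' j') //; apply/funext => x; rewrite block_mxEur.
- by rewrite (_ : (fun _ => _) = fun x => C x i' j') //; apply/funext => x; rewrite block_mxEdl.
- by rewrite (_ : (fun _ => _) = fun x => E x i' j') //; apply/funext => x; rewrite block_mxEdr.
Qed.

Lemma invmx_lblock p q (A : 'M[R]_p) (C : 'M[R]_(q, p)) : A \in unitmx ->
  invmx (block_mx A 0 C 1%:M) = block_mx (invmx A) 0 (- (C *m invmx A)) 1%:M.
Proof.
move=> uA; have u : block_mx A 0 C (1%:M : 'M[R]_q) \in unitmx.
  by rewrite unitmxE det_lblock det1 mulr1 -unitmxE.
have K : block_mx A 0 C 1%:M *m block_mx (invmx A) 0 (- (C *m invmx A)) (1%:M : 'M[R]_q) = 1%:M.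
  rewrite mulmx_block !mulmx0 !mul0mx !mulmx1 !mul1mx !addr0 !add0r mulmxV // addrN.
  by rewrite -scalar_mx_block.
by rewrite -[LHS]mulmx1 -K mulKmx.
Qed.

Context {n m r : nat}.
Let q := (m + 1)%N.
Variables (M : set 'cV[R]_n) (W : 'I_r -> inf_transf R n m) (x0 : 'cV[R]_n).
Hypotheses (oM : open M) (Mx0 : M x0) (sW : forall i, is_inf_transf M (W i))
  (freeW : free [tuple it_Y (W i) x0 | i < r])
  (flagW : forall i l : 'I_r, exists c : 'I_r -> R,
     (forall p : 'I_r, (maxn i l <= p)%N -> c p = 0) /\
     it_eq_on M (it_bracket (W i) (W l)) (it_lincomb c W)).

Let Ym x : 'M[R]_(n, r) := \matrix_(a, k) it_Y (W k) x a ord0.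

Let rkY : \rank (Ym x0)^T = r.
Proof.
apply/eqP; rewrite -[_ == _]/(row_free _); apply: inj_row_free => v v0; apply/rowP => j; rewrite [RHS]mxE.
have /freeP/(_ (fun i => v ord0 i)) := freeW; apply.
apply/colP => a; have := congr1 (fun A : 'rV[R]_n => A ord0 a) v0; rewrite !mxE => <-.
by rewrite summxE; apply: eq_bigr => k _; rewrite nth_mktuple !mxE.
Qed.

Lemma rank_le : (r <= n)%N.
Proof. by rewrite -rkY; exact: rank_leq_col. Qed.

Let U := row_ebase (Ym x0)^T.
(* At x0 the rows of U complete the r vectors Y_i(x0) to a basis. *)
Let Fx x : 'M[R]_n := Ym x *m (pid_mx r : 'M[R]_(r, n)) + U^T *m copid_mx r.

(** The rank factorization of Y(x0) writes Fx x0 as U^T times the block diagonal matrix diag(L, 1),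
    with L invertible of size r; [K1] is this matrix and [K2] its inverse. *)
Let Fx_unit : Fx x0 \in unitmx.
Proof.
have rn := rank_le.
pose L := (col_ebase (Ym x0)^T)^T.
have uL : L \in unitmx by rewrite unitmx_tr col_ebase_unit.
have YE : Ym x0 = U^T *m (pid_mx r : 'M[R]_(n, r)) *m L.
  rewrite -[LHS]trmxK -[(Ym x0)^T]mulmx_ebase rkY !trmx_mul tr_pid_mx mulmxA //.
have [c [cE cp pc cc c1]] : exists c : 'M[R]_n, [/\ copid_mx r = c, c *m (pid_mx r : 'M[R]_(n, r)) = 0,
    (pid_mx r : 'M[R]_(r, n)) *m c = 0, c *m c = c & (pid_mx r : 'M[R]_n) + c = 1%:M].
  exists (copid_mx r); split=> //; first exact: mul_copid_mx_pid.
  - exact: mul_pid_mx_copid.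
  - exact: copid_mx_id.
  - by rewrite /copid_mx addrC subrK.
pose K1 := (pid_mx r : 'M[R]_(n, r)) *m L *m (pid_mx r : 'M[R]_(r, n)) + c.
pose K2 := (pid_mx r : 'M[R]_(n, r)) *m invmx L *m (pid_mx r : 'M[R]_(r, n)) + c.
have FE : Fx x0 = U^T *m K1.
  by rewrite /Fx YE cE /K1 mulmxDr -!mulmxA.
have pp : (pid_mx r : 'M[R]_(r, n)) *m (pid_mx r : 'M[R]_(n, r)) = 1%:M.
  by rewrite mul_pid_mx minnn (minn_idPr rn) pid_mx_1.
have KK : K1 *m K2 = 1%:M.
  rewrite /K1 /K2 mulmxDl !mulmxDr -!mulmxA pc !mulmx0 addr0 cc.
  rewrite (mulmxA c) cp mul0mx add0r (mulmxA (pid_mx r : 'M[R]_(r, n))) pp mul1mx (mulmxA L) mulmxV // mul1mx.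
  by rewrite mul_pid_mx !minnn c1.
by rewrite FE unitmx_mul unitmx_tr row_ebase_unit /=; case: (mulmx1_unit KK).
Qed.

Let FxE x (k : 'I_r) a : Fx x a (widen_ord rank_le k) = it_Y (W k) x a ord0.
Proof.
rewrite mxE [X in X + _]mxE [X in _ + X]mxE [X in _ + X]big1 ?addr0 => [|l _]; last first.
  rewrite !mxE; case: eqP => [->|/eqP lk] /=.
    by rewrite eqxx /= ltn_ord subrr mulr0.
  by rewrite (_ : (l == widen_ord rank_le k :> nat) = false) ?subr0 ?mulr0 //; apply/negbTE.
rewrite (bigD1 k) //= big1 ?addr0 => [|l lk]; first by rewrite !mxE eqxx ltn_ord mulr1.
by rewrite !mxE /= (_ : (l == k :> nat) = false) ?mulr0 //; apply/negbTE.
Qed.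

Let Lo z : 'M[R]_(q, n) :=
  (\matrix_(c, k) (it_mx (W k) (usubmx z) *m dsubmx z) c ord0) *m (pid_mx r : 'M[R]_(r, n)).

(** The first r columns are the extended fields, the following ones constant fields completing them
    in R^n, the last ones the coordinate fields in z. Only [Fx] decides invertibility. *)
Let Fr z : 'M[R]_(n + q) := block_mx (Fx (usubmx z)) 0 (Lo z) 1%:M.

Let ki (k : 'I_r) : 'I_(n + q) := lshift q (widen_ord rank_le k).

Let FrE z k i : Fr z i (ki k) = it_ext (W k) z i ord0.
Proof.
rewrite -[i]splitK; case: (fintype.split i) => l /=.
  by rewrite /Fr block_mxEul /it_ext col_mxEu FxE.
rewrite /Fr block_mxEdl /it_ext col_mxEd mxE (bigD1 k) //= big1 ?addr0 => [|j jk].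
  by rewrite !mxE eqxx ltn_ord mulr1; apply: eq_bigr => j _; rewrite !mxE.
by rewrite !mxE /= (_ : (j == k :> nat) = false) ?mulr0 //; apply/negbTE.
Qed.

Let ki_lt (j : 'I_(n + q)) : (j < r)%N -> exists k : 'I_r, j = ki k.
Proof. by move=> jr; exists (Ordinal jr); apply: val_inj. Qed.

(** The square turns a nonvanishing determinant into a strict inequality, to which [open_gt0]
    applies. *)
Let D : set 'cV[R]_n := [set x | M x /\ 0 < \det (Fx x) ^+ 2].
Let D' : set 'cV[R]_(n + q) := [set z | D (usubmx z)].

Let FxCk k : Ckmx k M Fx.
Proof.
have Yk : Ckmx k M Ym.
  move=> a l; rewrite (_ : (fun _ => _) = fun x => it_Y (W l) x a ord0).
    by have [h _ _ _] := sW l; exact: h.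
  by apply/funext => x; rewrite mxE.
by apply: Ckmx_add => //; [apply: Ckmx_mul => //; exact: Ckmx_cst|exact: Ckmx_cst].
Qed.

Let oD : open D.
Proof.
apply: open_gt0 => //; apply: (Ck_mul (f := fun x => \det (Fx x)) (g := fun x => \det (Fx x))) => //.
all: exact: Ck_det (FxCk 0).
Qed.

Let oD' : open D'. Proof. exact: open_usubmx. Qed.

Let DM z : D' z -> M (usubmx z). Proof. by case. Qed.

Let Dx0 : D x0.
Proof. by split=> //; rewrite exprn_even_gt0 //=; have := Fx_unit; rewrite unitmxE unitfE. Qed.

Let Fr_unit z : D' z -> Fr z \in unitmx.
Proof.
case=> _; rewrite exprn_even_gt0 //= => h.
by rewrite unitmxE det_lblock det1 mulr1 unitfE.
Qed.

Let FrCk k : Ckmx k D' Fr.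
Proof.
apply: Ckmx_block; try exact: Ckmx_cst.
  move=> a b; apply: (Ck_usubmx (f := fun x => Fx x a b)) => //.
  by apply: Ck_subset (FxCk k a b) => x [].
apply: Ckmx_mul => //; last exact: Ckmx_cst.
move=> c l; rewrite (_ : (fun _ => _) = fun z => it_ext (W l) z (rshift n c) ord0).
  by apply: Ck_subset (Ckmx_it_ext k oM (sW l) _ _) => z [].
by apply/funext => z; rewrite mxE /it_ext col_mxEd.
Qed.

Let colFr k : (fun z => col (ki k) (Fr z)) = it_ext (W k).
Proof. by apply/funext => z; apply/colP => i; rewrite mxE FrE. Qed.

(** [invmx (Fr z)] sends a combination of the extended fields to its coefficients, and those given
    by [flagW] vanish from max(j, l) on. *)
Let FrB z : D' z -> forall j l p : 'I_(n + q), (j < r)%N -> (l < r)%N ->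
  (j <= p)%N -> (l <= p)%N ->
  (invmx (Fr z) *m vf_bracket (fun z => col j (Fr z)) (fun z => col l (Fr z)) z) p ord0 = 0.
Proof.
move=> Dz j l p /ki_lt[j' ->] /ki_lt[l' ->] jp lp; rewrite !colFr.
have Mz := DM Dz; rewrite (it_ext_bracket oM) //.
have [c [c0 ce]] := flagW j' l'; have [eY eA] := (it_eq_onP _ _ _).1 ce _ Mz.
have -> : it_ext (it_bracket (W j') (W l')) z = Fr z *m \sum_k c k *: (delta_mx (ki k) ord0 : 'cV[R]_(n + q)).
  rewrite mulmx_sumr /it_ext eY eA it_mx_lincomb.
  apply/colP => i; rewrite summxE.
  have E k : (Fr z *m (c k *: (delta_mx (ki k) ord0 : 'cV[R]_(n + q)))) i ord0 = c k * it_ext (W k) z i ord0.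
    by rewrite -scalemxAr mxE -colE mxE FrE.
  rewrite (eq_bigr _ (fun k _ => E k)) -[i]splitK; case: (fintype.split i) => a /=.
    by rewrite col_mxEu /= summxE; apply: eq_bigr => k _; rewrite /it_ext col_mxEu mxE.
  rewrite col_mxEd mulmx_suml summxE; apply: eq_bigr => k _.
  by rewrite /it_ext col_mxEd -scalemxAl mxE.
rewrite mulKmx ?Fr_unit // summxE big1 // => k _; rewrite !mxE andbT.
case: eqP => [pk|]; last by rewrite mulr0.
by rewrite c0 ?mul0r // geq_max; move: jp lp; rewrite pk => -> ->.
Qed.

(* Q is the derivative of the last m + 1 components of the extended chart in the direction of the last
   m + 1 variables, at z = 0. *)
Theorem rectifying_chart : exists (c d : R) (Phi : 'cV[R]_n -> 'cV[R]_n) (Q : 'cV[R]_n -> 'M[R]_q) (F : 'M[R]_n),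
  let B := [set x : 'cV[R]_n | `|x - x0| < c] in
  [/\ 0 < c, 0 < d & B `<=` M] /\
  [/\ forall k, Ckmx k B Phi, forall k, Ckmx k B Q, jacobian_mx Phi x0 \in unitmx,
    forall x, B x -> forall (k : 'I_r) (a : 'I_n), (k <= a)%N ->
      vf_app (it_Y (W k)) (fun x => Phi x a ord0) x = (a == k :> nat)%:R /\
      vf_app_mx (it_Y (W k)) Q x = - (Q x *m it_mx (W k) x) &
    forall s : 'cV[R]_n, `|s| < d -> (forall k : 'I_n, (k < r)%N -> s k ord0 = 0) ->
      [/\ B (x0 + F *m s), Phi (x0 + F *m s) = s & Q (x0 + F *m s) = 1%:M]].
Proof.
pose z0 : 'cV[R]_(n + q) := emb x0.
have D'z0 : D' z0 by rewrite /D' /= /z0 /emb col_mxKu.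
have [c [d [P [c0 d0 cD [Ps Pj] [PY Pslice]]]]] :=
  straightening oD' D'z0 FrCk Fr_unit (leq_trans rank_le (leq_addr _ _)) FrB.
pose B := [set x : 'cV[R]_n | `|x - x0| < c].
pose B' := [set z : 'cV[R]_(n + q) | `|z - z0| < c].
have oB : open B by exact: open_norm_ball.
have oB' : open B' by exact: open_norm_ball.
have BB x : B x -> B' (emb x) by exact: emb_ball.
have BM x : B x -> M x.
  by move=> /BB/cD[]; rewrite /emb col_mxKu.
(* This holds near z = 0 and not only at z = 0, so it may be differentiated in z. *)
have H1 z (k : 'I_r) (p : 'I_(n + q)) : B' z -> (k <= p)%N ->
    vf_app (it_ext (W k)) (fun z => P z p ord0) z = (p == ki k)%:R.
  move=> Bz kp; rewrite -(PY z Bz (ki k) p (ltn_ord k) kp) mxE.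
  by apply: eq_bigr => l _; rewrite FrE mulrC !mxE.
have embu x : usubmx (emb x : 'cV[R]_(n + q)) = x by rewrite /emb col_mxKu.
have embd x : dsubmx (emb x : 'cV[R]_(n + q)) = 0 by rewrite /emb col_mxKd.
have embr x j : (emb x : 'cV[R]_(n + q)) (rshift n j) ord0 = 0 by rewrite /emb col_mxEd mxE.
pose Phi (x : 'cV[R]_n) : 'cV[R]_n := usubmx (P (emb x)).
pose Q (x : 'cV[R]_n) : 'M[R]_q :=
  \matrix_(a, b) partial (rshift n b) (fun z => P z (rshift n a) ord0) (emb x).
have PhiE a : (fun x => Phi x a ord0) = fun x => P (emb x) (lshift q a) ord0.
  by apply/funext => x; rewrite mxE.
have QE a b : (fun x => Q x a b) = fun x => partial (rshift n b) (fun z => P z (rshift n a) ord0) (emb x).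
  by apply/funext => x; rewrite mxE.
exists c, d, Phi, Q, (Fx x0); split; [by split|split].
- move=> k a b; rewrite (ord1 b) PhiE.
  by apply: (Ck_emb (f := fun z => P z (lshift q a) ord0) oB oB') => //; exact: Ps.
- move=> k a b; rewrite QE.
  apply: (Ck_emb (f := partial (rshift n b) (fun z => P z (rshift n a) ord0)) oB oB') => //.
  by apply: Ck_partial; exact: Ps.
(* The frame is block lower triangular, so the upper left block of its inverse is the inverse of
   [Fx x0]. *)
- have -> : jacobian_mx Phi x0 = invmx (Fx x0); last by rewrite unitmx_inv; exact: Fx_unit.
  have := congr1 ulsubmx Pj; rewrite /Fr embu (invmx_lblock _ Fx_unit) block_mxKul => <-.
  by apply/matrixP => a b; rewrite !mxE PhiE (partial_emb (q := q) (fun z => P z (lshift q a) ord0)).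
- move=> x Bx k a ka; have Bz := BB x Bx; have Mx := BM x Bx; split.
    have := H1 (emb x) k (lshift q a) Bz ka.
    rewrite vf_app_prod embu embd mulmx0 [X in _ + X]big1 ?addr0 => [|l _]; last by rewrite mxE mul0r.
    rewrite (inj_eq (@lshift_inj _ _)) -val_eqE /= => <-.
    by apply: eq_bigr => l _; rewrite PhiE (partial_emb (q := q) (fun z => P z (lshift q a) ord0)).
  apply/matrixP => i j; rewrite [LHS]mxE QE [RHS]mxE mxE.
  pose f z := P z (rshift n i) ord0.
  have f2 : Ck 2 B' f by exact: Ps.
  have Xk : Ckmx 1 B' (it_ext (W k)).
    by move=> a' b'; apply: Ck_subset (Ckmx_it_ext 1 oM (sW k) a' b') => z /cD[].
  (* The extended field annihilates the last components of P. The z_j-derivative of this identity at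
     z = 0, where the z-part of the field vanishes, is the equation for Q. *)
  have : partial (rshift n j) (vf_app (it_ext (W k)) f) (emb x) = 0.
    rewrite -(partial_cst (rshift n j) (0 : R) (emb x)); apply: (partial_ext _ oB' Bz) => z; rewrite inE => zB.
    rewrite (H1 z k _ zB); last by apply: leq_trans (leq_addr _ _); exact: ltnW (leq_trans (ltn_ord k) rank_le).
    by rewrite eq_rlshift.
  rewrite (partial_vf_app _ oB' Bz Xk f2) mxE big_split_ord /=.
  rewrite [X in X + _ + _]big1 ?add0r => [|l _]; last first.
    by rewrite [jacobian_mx _ _ _ _]mxE it_extl (partial_usubmxr (fun x => it_Y (W k) x l ord0)) mulr0.
  move/eqP; rewrite addrC addr_eq0 => /eqP E.
  transitivity (\sum_l it_ext (W k) (emb x) l ord0 * partial (rshift n j) (partial l f) (emb x)).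
    rewrite big_split_ord /= [X in _ + X]big1 ?addr0 => [|l _]; last first.
      by rewrite /it_ext col_mxEd embd mulmx0 mxE mul0r.
    apply: eq_bigr => l _.
    have e1 : it_Y (W k) x l ord0 = it_ext (W k) (emb x) (lshift q l) ord0.
      by rewrite /it_ext col_mxEu embu.
    have e2 := etrans (partial_emb (q := q) (partial (rshift n j) f) x l)
       (schwarz (lshift q l) (rshift n j) oB' f2 Bz).
    exact: (f_equal2 (fun a b : R => a * b) e1 e2).
  rewrite E; congr (- _); apply: eq_bigr => l _; rewrite [grad _ _ _ _]mxE [Q _ _ _]mxE; congr (_ * _).
  rewrite mxE (partial_it_extr _ _ oM (sW k)) ?embu // (bigD1 j) //= eqxx mulr1 big1 => [|p pj].
    by rewrite embr mul0r !addr0.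
  by rewrite (inj_eq (@rshift_inj _ _)) eq_sym (negbTE pj) mulr0 embr mul0r add0r.
- move=> s sd s0.
  have Lo0 : Lo z0 = 0.
    rewrite /Lo embd (_ : \matrix_(_, _) _ = 0) ?mul0mx //.
    by apply/matrixP => a b; rewrite [LHS]mxE mulmx0 !mxE.
  (* The frame at z0 is block diagonal, so over the slice P is explicit for all small z; its
     z-derivative there is the identity. *)
  have PE (t : 'cV[R]_q) : `|t| < d -> `|col_mx (Fx x0 *m s) t| < c /\
      P (col_mx (x0 + Fx x0 *m s) t) = col_mx s t.
    move=> td; have [] := Pslice (col_mx s t).
    - exact: col_mx_norm.
    - move=> k kr; have [k' ->] := ki_lt kr; rewrite col_mxEu; apply: s0; exact: (ltn_ord k').
    - rewrite /Fr embu Lo0 mul_block_col !mul0mx mul1mx addr0 add0r.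
      by rewrite /z0 /emb add_col_mx add0r.
  have [nF P0] := PE 0 (eq_ind_r (fun x => x < d) d0 (normr0 _)).
  split.
  + rewrite /B /= addrC addKr; apply: le_lt_trans nF.
    by rewrite -{1}[Fx x0 *m s](col_mxKu _ (0 : 'cV[R]_q)); exact: usubmx_norm.
  + by rewrite /Phi /emb P0 col_mxKu.
  + apply/matrixP => a b; rewrite [LHS]mxE.
    rewrite (@partial_line_ext R _ _ (fun z => z (rshift n a) ord0) _ _ d d0).
    * by rewrite partial_coord mxE (inj_eq (@rshift_inj _ _)) eq_sym.
    * move=> h hd.
      have hE : emb (x0 + Fx x0 *m s) + h *: delta_mx (rshift n b) ord0 =
          col_mx (x0 + Fx x0 *m s) (h *: delta_mx b ord0) :> 'cV[R]_(n + q).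
        rewrite /emb -[delta_mx (rshift n b) ord0]vsubmxK scale_col_mx add_col_mx add0r; congr col_mx.
          by rewrite -[RHS]addr0; congr (_ + _); apply/colP => i; rewrite !mxE eq_lrshift mulr0.
        by congr (_ *: _); apply/colP => i; rewrite !mxE (inj_eq (@rshift_inj _ _)).
      have hn : `|h *: (delta_mx b ord0 : 'cV[R]_q)| < d.
        rewrite normrZ; apply: le_lt_trans hd; rewrite -[leRHS]mulr1 ler_wpM2l //.
        by apply/cv_norm_leP => // i; rewrite mxE andbT; case: eqP; rewrite ?normr1 ?normr0.
      have [_ PE'] := PE _ hn.
      by rewrite hE PE' !col_mxEd.
    * by apply: (Ck_derivable (k := 0) (D := setT)) => //; apply: Ck_coord; exact: openT.
Qed.

End Chart.

(** * Invariance of the transformed coefficients *)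

Section Invariance.
Context {R : realType} {n m : nat}.
Implicit Types (D M : set 'cV[R]_n) (E : sde R n m) (V : inf_transf R n m).

Lemma is_inf_transf_sub M D V : D `<=` M -> is_inf_transf M V -> is_inf_transf D V.
Proof.
move=> DM [sY [sC skC] st sH]; split.
- by move=> i j k; apply: Ck_subset (sY i j k).
- by split=> [i j k|x /DM]; [apply: Ck_subset (sC i j k)|exact: skC].
- by move=> k; apply: Ck_subset (st k).
- by move=> i j k; apply: Ck_subset (sH i j k).
Qed.

Lemma hess_ext D f g (x : 'cV[R]_n) : open D -> D x -> {in D, f =1 g} -> hess f x = hess g x.
Proof.
move=> oD Dx fg; apply/matrixP => i j; rewrite [LHS]mxE [RHS]mxE; apply: (partial_ext _ oD Dx) => y.
by rewrite inE => Dy; exact: (partial_ext _ oD Dy).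
Qed.

Lemma grad_ext D f g (x : 'cV[R]_n) : open D -> D x -> {in D, f =1 g} -> grad f x = grad g x.
Proof. by move=> oD Dx fg; apply/matrixP => i j; rewrite [LHS]mxE [RHS]mxE; exact: (partial_ext _ oD Dx). Qed.

Lemma grad_cst (c : R) (x : 'cV[R]_n) : grad (fun=> c) x = 0.
Proof. by apply/matrixP => i j; rewrite !mxE partial_cst. Qed.

Lemma hess_cst (c : R) (x : 'cV[R]_n) : hess (fun=> c) x = 0.
Proof.
apply/matrixP => i j; rewrite !mxE (_ : partial j (fun=> c) = fun=> 0) ?partial_cst //.
by apply/funext => y; rewrite partial_cst.
Qed.

Lemma generator_cst_on D E f (c : R) x : open D -> D x -> {in D, f =1 fun=> c} -> generator E f x = 0.
Proof.
move=> oD Dx fc; rewrite generatorE (hess_ext oD Dx fc) (grad_ext oD Dx fc) grad_cst hess_cst.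
by rewrite trmx0 mulmx0 mul0mx !mxtrace0 mulr0 addr0.
Qed.

Lemma sgrad_cst_on D E f (c : R) x : open D -> D x -> {in D, f =1 fun=> c} -> sgrad E f x = 0.
Proof. by move=> oD Dx fc; rewrite /sgrad (grad_ext oD Dx fc) grad_cst mul0mx. Qed.

Lemma generator_sum D E k (c : 'I_k -> R) (f : 'I_k -> 'cV[R]_n -> R) x : open D -> D x ->
  (forall i, Ck 2 D (f i)) ->
  generator E (fun y => \sum_i c i * f i y) x = \sum_i c i * generator E (f i) x.
Proof.
move=> oD Dx f2.
have d1 y i l : D y -> derivable (fun y => c i * f i y) y (delta_mx l ord0).
  move=> Dy; apply: derivableM; first exact: derivable_cst.
  exact: Ck_derivable (f2 i) Dy.
have p1 y l : D y -> partial l (fun y => \sum_i c i * f i y) y = \sum_i c i * partial l (f i) y.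
  move=> Dy; have [_ ->] := partial_sum (index_enum 'I_k) (P := xpredT) (fun i _ => d1 y i l Dy).
  apply: eq_bigr => i _; rewrite partialZ //; exact: Ck_derivable (f2 i) Dy.
have d2 y i l l' : D y -> derivable (fun y => c i * partial l' (f i) y) y (delta_mx l ord0).
  move=> Dy; apply: derivableM; first exact: derivable_cst.
  exact: Ck_derivable (Ck_partial l' (f2 i)) Dy.
have p2 l l' : partial l (partial l' (fun y => \sum_i c i * f i y)) x = \sum_i c i * partial l (partial l' (f i)) x.
  transitivity (partial l (fun y => \sum_i c i * partial l' (f i) y) x).
    by apply: (partial_ext _ oD Dx) => y; rewrite inE => Dy; exact: p1.
  have [_ ->] := partial_sum (index_enum 'I_k) (P := xpredT) (fun i _ => d2 x i l l' Dx).
  apply: eq_bigr => i _; rewrite partialZ //; exact: Ck_derivable (Ck_partial l' (f2 i)) Dx.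
have gE : grad (fun y => \sum_i c i * f i y) x = \sum_i c i *: grad (f i) x.
  by apply/rowP => l; rewrite summxE mxE p1 //; apply: eq_bigr => i _; rewrite !mxE.
have hE : hess (fun y => \sum_i c i * f i y) x = \sum_i c i *: hess (f i) x.
  by apply/matrixP => l l'; rewrite summxE mxE p2; apply: eq_bigr => i _; rewrite !mxE.
rewrite generatorE gE hE linear_sum mulmx_sumr mulmx_suml !linear_sum mulr_sumr -big_split.
apply: eq_bigr => i _; rewrite generatorE /= linearZ -scalemxAr -scalemxAl !mxtraceZ.
by rewrite mulrDr mulrCA.
Qed.

(** The equations are linear in V over the constants; the adapted fields W_i are such combinations
    of the given symmetries. *)
Lemma determining_lincomb M E k (c : 'I_k -> R) (V : 'I_k -> inf_transf R n m) : open M ->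
  (forall i, is_inf_transf M (V i)) -> (forall i, determining_equations M E (V i)) ->
  determining_equations M E (it_lincomb c V).
Proof.
move=> oM sV dV x Mx.
have sY i a : Ck 2 M (fun y => it_Y (V i) y a ord0) by have [h _ _ _] := sV i; exact: h.
split.
  transitivity (\sum_i c i *: (vf_app_mx (it_Y (V i)) (drift E) x - generator_cv E (it_Y (V i)) x
    - diffusion E x *m it_H (V i) x + it_tau (V i) x *: drift E x)); last first.
    by rewrite big1 // => i _; have [-> _] := dV i x Mx; rewrite scaler0.
  under [RHS]eq_bigr do rewrite scalerDr !scalerBr.
  rewrite big_split !sumrB /=; congr (_ - _ - _ + _).
  - apply/matrixP => a b; rewrite summxE [LHS]mxE.
    transitivity (\sum_i c i * \sum_l it_Y (V i) x l ord0 * partial l (fun y => drift E y a b) x); last first.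
      by apply: eq_bigr => i _; rewrite [RHS]mxE [vf_app_mx _ _ _ _ _]mxE.
    under [RHS]eq_bigr do rewrite mulr_sumr.
    rewrite [RHS]exchange_big; apply: eq_bigr => l _ /=; rewrite summxE mulr_suml.
    by apply: eq_bigr => i _; rewrite mxE mulrA.
  - apply/matrixP => a b; rewrite summxE [LHS]mxE.
    have -> : (fun y => (\sum_i c i *: it_Y (V i) y) a ord0) = fun y => \sum_i c i * it_Y (V i) y a ord0.
      by apply/funext => y; rewrite summxE; apply: eq_bigr => i _; rewrite mxE.
    rewrite (generator_sum E c oM Mx (fun i => sY i a)); apply: eq_bigr => i _; by rewrite !mxE.
  - by rewrite mulmx_sumr; apply: eq_bigr => i _; rewrite scalemxAr.
  - by rewrite scaler_suml; apply: eq_bigr => i _; rewrite scalerA.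
transitivity (\sum_i c i *: (vf_diffusion_bracket (it_Y (V i)) (diffusion E) x
    + (2^-1 * it_tau (V i) x) *: diffusion E x + diffusion E x *m it_C (V i) x)); last first.
  by rewrite big1 // => i _; have [_ ->] := dV i x Mx; rewrite scaler0.
under [RHS]eq_bigr do rewrite !scalerDr.
rewrite !big_split /=; congr (_ + _ + _).
- apply/matrixP => a b; rewrite summxE [LHS]mxE.
  transitivity (\sum_i c i * (\sum_l it_Y (V i) x l ord0 * partial l (fun y => diffusion E y a b) x -
     \sum_l diffusion E x l b * partial l (fun y => it_Y (V i) y a ord0) x)); last first.
    by apply: eq_bigr => i _; rewrite [RHS]mxE [in RHS]mxE.
  under [RHS]eq_bigr do rewrite mulrBr !mulr_sumr.
  rewrite sumrB; congr (_ - _); rewrite [RHS]exchange_big; apply: eq_bigr => l _ /=.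
    by rewrite summxE mulr_suml; apply: eq_bigr => i _; rewrite mxE mulrA.
  have -> : partial l (fun y => (\sum_i c i *: it_Y (V i) y) a ord0) x = \sum_i c i * partial l (fun y =>
      it_Y (V i) y a ord0) x.
    transitivity (partial l (fun y => \sum_i c i * it_Y (V i) y a ord0) x).
      by congr (partial l _ x); apply/funext => y; rewrite summxE; apply: eq_bigr => i _; rewrite mxE.
    have dd i : derivable (fun y => c i * it_Y (V i) y a ord0) x (delta_mx l ord0).
      by apply: derivableM; [exact: derivable_cst|exact: Ck_derivable (sY i a) Mx].
    have [_ ->] := partial_sum (index_enum 'I_k) (P := xpredT) (fun i _ => dd i).
    by apply: eq_bigr => i _; rewrite partialZ //; exact: Ck_derivable (sY i a) Mx.
  by rewrite mulr_sumr; apply: eq_bigr => i _; rewrite mulrCA.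
- rewrite mulr_sumr scaler_suml; apply: eq_bigr => i _; rewrite scalerA; congr (_ *: _); ring.
- by rewrite mulmx_sumr; apply: eq_bigr => i _; rewrite scalemxAr.
Qed.

Lemma Ckmx_sgrad l D E f : open D -> smooth_sde D E -> smooth D f -> Ckmx l D (sgrad E f).
Proof.
move=> oD [_ sS] sf; apply: Ckmx_mul => //; first exact: Ckmx_grad (sf l.+1).
by move=> a b; exact: sS.
Qed.

Lemma Ck_generator l D E f : open D -> smooth_sde D E -> smooth D f -> Ck l D (generator E f).
Proof.
move=> oD [sM sS] sf; apply: Ck_add => //.
  apply: Ck_mul => //; first exact: Ck_cst.
  apply: Ck_sum => // i _; apply: Ck_sum => // j _; apply: Ck_mul => //.
    have Sl : Ckmx l D (diffusion E) by move=> a b; exact: sS.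
    exact: (Ckmx_mul oD Sl (Ckmx_tr oD Sl)).
  by apply: Ck_partial; apply: Ck_partial; exact: sf.
apply: Ck_sum => // i _; apply: Ck_mul => //; first exact: sM.
by apply: Ck_partial; exact: sf.
Qed.

(* k plays the role of sqrt(eta), and h = - S^T s. *)
Section Invariants.
Variables (D : set 'cV[R]_n) (E : sde R n m) (V : inf_transf R n m).
Variables (S : 'cV[R]_n -> 'M[R]_m) (s : 'cV[R]_n -> 'cV[R]_m) (k : 'cV[R]_n -> R).
Hypotheses (oD : open D) (sE : smooth_sde D E) (sV : is_inf_transf D V)
  (dV : determining_equations D E V).
Hypotheses (Ss : forall l, Ckmx l D S) (ss : forall l, Ckmx l D s) (ks : forall l, Ck l D k)
  (k0 : forall x, D x -> k x != 0) (SS : forall x, D x -> S x *m (S x)^T = 1%:M).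
Hypotheses (YS : forall x, D x -> vf_app_mx (it_Y V) S x = - (S x *m it_C V x))
  (Ys : forall x, D x -> vf_app_mx (it_Y V) s x = S x *m it_H V x - (it_tau V x / 2) *: s x)
  (Yk : forall x, D x -> vf_app (it_Y V) k x = - (it_tau V x / 2) * k x).
Variables (f : 'cV[R]_n -> R) (c : R).
Hypotheses (sf : smooth D f) (Yf : {in D, vf_app (it_Y V) f =1 fun=> c}).

Let h x : 'cV[R]_m := - ((S x)^T *m s x).

Let hs l : Ckmx l D h.
Proof. by apply: Ckmx_opp => //; apply: Ckmx_mul => //; exact: Ckmx_tr. Qed.

Let Ykinv x : D x -> vf_app (it_Y V) (fun x => (k x)^-1) x = it_tau V x / 2 * (k x)^-1.
Proof.
move=> Dx; rewrite (vf_appV _ oD Dx (ks 1%N) k0) Yk //; field; exact: k0.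
Qed.

Let kinvs l : Ck l D (fun x => (k x)^-1). Proof. exact: Ck_inv. Qed.

Let sgs l : Ckmx l D (sgrad E f). Proof. exact: Ckmx_sgrad. Qed.

Let skC x : D x -> (it_C V x)^T = - it_C V x.
Proof. by have [_ [_ h'] _ _] := sV; exact: h'. Qed.

Let Ysg x : D x -> vf_app_mx (it_Y V) (sgrad E f) x =
  - (it_tau V x / 2) *: sgrad E f x - sgrad E f x *m it_C V x.
Proof.
move=> Dx; rewrite (vf_app_sgrad oD Dx sE sV sf dV) (sgrad_cst_on E oD Dx Yf) sub0r.
by rewrite scaleNr mulrC.
Qed.

Let YST x : D x -> vf_app_mx (it_Y V) (fun x => (S x)^T) x = it_C V x *m (S x)^T.
Proof. by move=> Dx; rewrite vf_app_mx_tr YS // linearN /= trmx_mul skC // mulNmx opprK. Qed.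

(** The term in C comes from the equation for S^T, and - H from S^T S = 1. *)
Let Yh x : D x -> vf_app_mx (it_Y V) h x = - (it_tau V x / 2) *: h x + it_C V x *m h x - it_H V x.
Proof.
move=> Dx.
have d1 : derivable_mx (fun x => (S x)^T) x by exact: Ckmx_derivable_mx (Ckmx_tr oD (Ss 1%N)) Dx.
have d2 : derivable_mx s x by exact: Ckmx_derivable_mx (ss 1%N) Dx.
have d3 : derivable_mx (fun x => (S x)^T *m s x) x.
  exact: Ckmx_derivable_mx (Ckmx_mul oD (Ckmx_tr oD (Ss 1%N)) (ss 1%N)) Dx.
rewrite vf_app_mx_opp // vf_app_mx_mul // YST // Ys // mulmxBr mulmxA (mulmx1C (SS Dx)) mul1mx.
rewrite /h -scalemxAr scalerN scaleNr opprK mulmxN mulmxA opprD opprB addrA [RHS]addrAC.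
by rewrite -addrA addrC.
Qed.

(** C cancels between [sgrad] and h, and H between h and the commutator with the generator, so that
    the bracketed expression is multiplied by - tau under Y; two factors k^-1 of weight tau / 2
    compensate this. *)
Lemma drift_invariant x : D x ->
  vf_app (it_Y V) (fun x => (k x ^+ 2)^-1 * (generator E f x + \tr (sgrad E f x *m h x))) x = 0.
Proof.
move=> Dx.
pose g x := generator E f x + \tr (sgrad E f x *m h x).
have sgh l : Ckmx l D (fun x => sgrad E f x *m h x) by exact: Ckmx_mul.
have trs l : Ck l D (fun x => \tr (sgrad E f x *m h x)).
  by apply: Ck_sum => // i _; exact: sgh.
have gens l : Ck l D (generator E f) by exact: Ck_generator.
have Yg : vf_app (it_Y V) g x = - it_tau V x * g x.
  rewrite vf_appD; [|exact: Ck_pderivable (gens 1%N) Dx|exact: Ck_pderivable (trs 1%N) Dx].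
  rewrite (vf_app_generator oD Dx sE sV sf dV) (generator_cst_on E oD Dx Yf) sub0r.
  rewrite vf_app_tr; last exact: Ckmx_derivable_mx (sgh 1%N) Dx.
  rewrite vf_app_mx_mul; [|exact: Ckmx_derivable_mx (sgs 1%N) Dx|exact: Ckmx_derivable_mx (hs 1%N) Dx].
  rewrite Ysg // Yh // mulmxBl mulmxBr mulmxDr -!scalemxAl -scalemxAr -(mulmxA (sgrad E f x)).
  rewrite mxtraceD.
  have tB (A B : 'M[R]_1) : \tr (A - B) = \tr A - \tr B by rewrite linearB.
  rewrite !tB mxtraceD !mxtraceZ /g; by field.
have -> : (fun x => (k x ^+ 2)^-1 * (generator E f x + \tr (sgrad E f x *m h x))) =
   fun x => (k x)^-1 * ((k x)^-1 * g x).
  by apply/funext => y; rewrite mulrA -expr2 exprVn.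
have gs : Ck 1 D g by exact: Ck_add.
rewrite vf_appM; [|exact: Ck_pderivable (kinvs 1%N) Dx|exact: Ck_pderivable (Ck_mul oD (kinvs 1%N) gs) Dx].
rewrite vf_appM; [|exact: Ck_pderivable (kinvs 1%N) Dx|exact: Ck_pderivable gs Dx].
by rewrite Yg Ykinv //; field; exact: k0.
Qed.

(** C cancels between [sgrad] and S^T, and the weight - tau / 2 of [sgrad] against that of k^-1. *)
Lemma diffusion_invariant x : D x ->
  vf_app_mx (it_Y V) (fun x => (k x)^-1 *: (sgrad E f x *m (S x)^T)) x = 0.
Proof.
move=> Dx; have sgS := Ckmx_mul oD (sgs 1%N) (Ckmx_tr oD (Ss 1%N)).
rewrite vf_app_mx_scale; [|exact: Ck_pderivable (kinvs 1%N) Dx|exact: Ckmx_derivable_mx sgS Dx].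
rewrite vf_app_mx_mul; last 2 first.
- exact: Ckmx_derivable_mx (sgs 1%N) Dx.
- exact: Ckmx_derivable_mx (Ckmx_tr oD (Ss 1%N)) Dx.
rewrite Ykinv // Ysg // YST // mulmxBl mulmxA subrK -scalemxAl scalerA -scalerDl.
by rewrite mulrN mulrC subrr scale0r.
Qed.

End Invariants.
End Invariance.

(** * Independence of leading coordinates *)

Section Box.
Context {R : realType} {n : nat}.

(** The cube is convex and f has zero derivative along the segment from y to y': for each coordinate
    either the partial derivative or the increment vanishes. *)
Lemma box_const (e : R) (f : 'cV[R]_n -> R) (K : pred 'I_n) (y y' : 'cV[R]_n) :
  Ck 1 (cube e) f -> (forall k z, K k -> cube e z -> partial k f z = 0) ->
  cube e y -> cube e y' -> (forall k, ~~ K k -> y k ord0 = y' k ord0) -> f y = f y'.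
Proof.
move=> f1 fK ye ye' yy'; pose v := y' - y.
have oc : open (cube e : set 'cV[R]_n) by exact: open_cube.
have seg (t : R) : 0 <= t <= 1 -> cube e (y + t *: v).
  move=> /andP[t0 t1]; rewrite /cube /=.
  have -> : y + t *: v = (1 - t) *: y + t *: y'.
    by rewrite /v scalerBr scalerBl scale1r addrA [_ + t *: y']addrC -addrA [_ - _ *: y + _]addrC.
  apply: le_lt_trans (ler_normD _ _) _; rewrite !normrZ ger0_norm ?subr_ge0 // ger0_norm //.
  have := ye; have := ye'; rewrite /cube /= => h1 h2.
  have [t0'|t0'] := eqVneq t 0; first by rewrite t0' mul0r addr0 subr0 mul1r.
  have tp : 0 < t by rewrite lt_neqAle eq_sym t0'.
  have : t * `|y'| < t * e by rewrite ltr_pM2l.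
  have : (1 - t) * `|y| <= (1 - t) * e by rewrite ler_wpM2l ?subr_ge0 // ltW.
  by move=> a b; have := ler_ltD a b; rewrite -mulrDl subrK mul1r.
have der (t : R) : 0 <= t <= 1 -> is_derive t (1 : R) (fun t => f (y + t *: v)) 0.
  move=> /seg tv; have [ex eD] := frechet_derive v (C1_frechet oc f1 tv).
  have E : 'D_v f (y + t *: v) = 0.
    rewrite eD big1 // => k _; have [Kk|nK] := boolP (K k); first by rewrite fK ?mul0r.
    by rewrite /v !mxE yy' // subrr mulr0.
  by rewrite -E; exact: line_is_derive.
have [|s _] := @mvt0 R (fun t => f (y + t *: v)) (fun=> 0) 1.
  by move=> s; rewrite min_l // max_r //; exact: der.
by rewrite mul0r scale0r scale1r addr0 /v (addrC y) subrK => /eqP; rewrite subr_eq0 => /eqP.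
Qed.

End Box.

(** Expand Y_k f as the sum over q of d_q(f o G) times Y_k Phi^q. The second factor is delta_qk for
    q >= k, and the first vanishes for q < k by strong induction; the uncontrolled Y_k Phi^q with q
    < k thus never matter. *)
Lemma partial_pushforward (R : realType) n r (U U' : set 'cV[R]_n) (Phi G : 'cV[R]_n -> 'cV[R]_n)
    (Y : 'I_r -> 'cV[R]_n -> 'cV[R]_n) (f : 'cV[R]_n -> R) (K : nat) :
  open U -> open U' -> Ckmx 1 U Phi -> Ckmx 1 U' G ->
  (forall x, U x -> U' (Phi x) /\ G (Phi x) = x) -> (forall y, U' y -> U (G y) /\ Phi (G y) = y) ->
  (forall x, U x -> forall (k : 'I_r) (a : 'I_n), (k <= a)%N ->
     vf_app (Y k) (fun x => Phi x a ord0) x = (a == k :> nat)%:R) ->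
  Ck 1 U f -> (K <= r)%N -> (forall x, U x -> forall k : 'I_r, (k < K)%N -> vf_app (Y k) f x = 0) ->
  forall (k : 'I_n), (k < K)%N -> forall y, U' y -> partial k (fun y => f (G y)) y = 0.
Proof.
move=> oU oU' Phi1 G1 GPhi PhiG YPhi f1 Kr Yf.
have fG : Ck 1 U' (fun y => f (G y)).
  exact: Ck_comp oU' oU f1 (fun a => G1 a ord0) (fun y Uy => (PhiG y Uy).1).
move=> k; have [i] := ubnP (k : nat); elim: i k => // i IH k ki kK y U'y.
have [Ux Phix] := PhiG y U'y; set x := G y in Ux Phix.
have kr : (k < r)%N by exact: leq_trans kK Kr.
have := Yf x Ux (Ordinal kr) kK.
have -> : vf_app (Y (Ordinal kr)) f x =
    \sum_q partial q (fun y => f (G y)) y * vf_app (Y (Ordinal kr)) (fun x => Phi x q ord0) x.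
  transitivity (vf_app (Y (Ordinal kr)) (fun x => f (G (Phi x))) x).
    by apply: (vf_app_ext _ oU Ux) => z; rewrite inE => /GPhi[_ ->].
  transitivity (\sum_l Y (Ordinal kr) x l ord0 *
      \sum_q partial q (fun y => f (G y)) y * partial l (fun x => Phi x q ord0) x).
    apply: eq_bigr => l _; congr (_ * _).
    have Uphi : U' (Phi x) by rewrite Phix.
    by rewrite (chain_partial l oU oU' fG Phi1 Ux Uphi) Phix.
  under eq_bigr do rewrite mulr_sumr.
  rewrite exchange_big; apply: eq_bigr => q _ /=.
  by rewrite mulr_sumr; apply: eq_bigr => l _; rewrite mulrCA.
rewrite (bigD1 k) //= (YPhi x Ux (Ordinal kr) k (leqnn _)) eqxx mulr1 big1 ?addr0 // => q qk.
have [kq|qk'] := leqP k q.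
  by rewrite (YPhi x Ux (Ordinal kr) q kq) (_ : (q == k :> nat) = false) ?mulr0 //; exact/negbTE.
by rewrite IH ?mul0r //; [exact: leq_trans qk' ki|exact: ltn_trans qk' kK].
Qed.

(** * Construction of the transformation *)

Theorem corollary39 (R : realType) (n m r : nat) (M : set 'cV[R]_n)
    (E : sde R n m) (V : 'I_r -> inf_transf R n m)
    (openM : open M) (smoothE : smooth_sde M E)
    (non_explosiveE : non_explosive M E)
    (symmetryV : forall i, inf_symmetry M E (V i))
    (algebraV : lie_subalgebra (it_span M (range V)))
    (solvableV : solvable_lie M (it_span M (range V)))
    (regularV : regular_vf M (fun i => it_Y (V i))) :
  forall x0, M x0 ->
  exists (U U' : set 'cV[R]_n) (T : stoch_transf R n m),
    [/\ U x0, U `<=` M, is_stoch_transf U U' T &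
        triangular U' r (transformed_sde U T E)].
Proof.
move=> x0 Mx0.
have sV i : is_inf_transf M (V i) by have [] := symmetryV i.
have dV i : determining_equations M E (V i) by have [] := symmetryV i.
have [A [uA flagA]] := solvable_flag openM Mx0 sV algebraV solvableV regularV.
pose W i := it_lincomb (A i) V.
have sW i : is_inf_transf M (W i) by exact: lincomb_inf_transf.
have dW i : determining_equations M E (W i) by exact: determining_lincomb.
(* A is invertible, so independence at x0 passes from the given fields to the adapted ones. *)
have freeW : free [tuple it_Y (W i) x0 | i < r].
  apply/freeP => k k0 i.
  have : (\row_j k j) *m A = 0.
    apply/rowP => j; rewrite [LHS]mxE [RHS]mxE.
    have /freeP/(_ (fun j => \sum_i k i * A i j)) H := regularV x0 Mx0.
    transitivity (\sum_i k i * A i j); first by apply: eq_bigr => l _; rewrite mxE.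
    apply: H.
    rewrite -[RHS]k0; under eq_bigr do rewrite nth_mktuple scaler_suml.
    rewrite exchange_big; apply: eq_bigr => l _ /=; rewrite nth_mktuple scaler_sumr.
    by apply: eq_bigr => p _; rewrite scalerA.
  move/(congr1 (mulmx^~ (invmx A))); rewrite mulmxK // mul0mx => /rowP/(_ i).
  by rewrite !mxE.
have [c [d [Phi [Q [F [[c0 d0 BM] [Phis Qs uJ YPQ slice]]]]]]] := rectifying_chart openM Mx0 sW freeW flagA.
set B := [set x : 'cV[R]_n | `|x - x0| < c] in BM Phis Qs YPQ slice.
have oB : open B by exact: open_norm_ball.
pose S x := ulsubmx (Q x); pose s x := ursubmx (Q x); pose rho x := dlsubmx (Q x).
pose k x := Q x (rshift m ord0) (rshift m ord0).
have QE x : Q x = block_mx (S x) (s x) (rho x) (k x)%:M.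
  rewrite -[LHS]submxK; congr block_mx; apply/matrixP => i j; rewrite !ord1 !mxE eqxx mulr1n.
  by rewrite /k.
have entS : forall l, Ckmx l B S.
  move=> l i j; rewrite (_ : (fun _ => _) = fun x => Q x (lshift 1 i) (lshift 1 j)); first exact: Qs.
  by apply/funext => x; rewrite !mxE.
have ents : forall l, Ckmx l B s.
  move=> l i j; rewrite (_ : (fun _ => _) = fun x => Q x (lshift 1 i) (rshift m j)); first exact: Qs.
  by apply/funext => x; rewrite !mxE.
have entr : forall l, Ckmx l B rho.
  move=> l i j; rewrite (_ : (fun _ => _) = fun x => Q x (rshift m i) (lshift 1 j)); first exact: Qs.
  by apply/funext => x; rewrite !mxE.
have entk : forall l, Ck l B k by move=> l; exact: Qs.
have x0E : x0 = x0 + F *m 0 by rewrite mulmx0 addr0.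
have [Bx0 Phi0 Q0] : [/\ B x0, Phi x0 = 0 & Q x0 = 1%:M].
  by rewrite [x0 in B x0]x0E [x0 in Phi x0]x0E [x0 in Q x0]x0E; apply: slice => [|i _]; rewrite ?normr0 ?mxE.
have Q1 x : Q x = 1%:M -> [/\ S x = 1%:M, s x = 0, rho x = 0 & k x = 1].
  rewrite QE -[1%:M in RHS]/(1%:M : 'M[R]_(m + 1)) scalar_mx_block => /eq_block_mx[-> -> -> /matrixP/(_ ord0 ord0)].
  by rewrite !mxE !mulr1n.
(* Both signs hold at x0, where Q = 1. They exclude det S = -1 and make k the positive square root
   of eta. *)
pose D1 := [set x | B x /\ 0 < k x]; pose D := [set x | D1 x /\ 0 < \det (S x)].
have oD1 : open D1 by exact: open_gt0 (entk 0%N).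
have oD : open D.
  apply: open_gt0 => //; apply: Ck_det => // i j; apply: Ck_subset (entS 0%N i j) => x [] //.
have DB x : D x -> B x by case=> [[]].
have [S0 _ _ k0] := Q1 x0 Q0.
have Dx0 : D x0 by split; [split=> //; rewrite k0|rewrite S0 det1].
have PhiD : smooth_mx D Phi.
  by apply/smooth_mxE => l i j; apply: Ck_subset (Phis l i j) => x /DB.
have [d1 [e1 [G [d10 e10 hd1 [GPhi PhiG] Gs]]]] := inverse_function oD PhiD Dx0 uJ.
rewrite Phi0 in GPhi PhiG Gs.
have [b b0 hb] := mulmx_bound F.
(* The bounds are the domain of G, the part of the slice where Q is known, and [d1 / b], which keeps
   x0 + F s in the ball where G inverts Phi. *)
pose e := Num.min e1 (Num.min d (d1 / b)).
have e0 : 0 < e by rewrite !lt_min e10 d0 divr_gt0.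
have ee1 : e <= e1 by rewrite ge_min lexx.
have ed : e <= d by rewrite !ge_min lexx !orbT.
have ed1 : e <= d1 / b by rewrite !ge_min lexx !orbT.
(* U is cut out so that its image is a full cube, where vanishing partial derivatives imply
   constancy in the corresponding coordinates. *)
pose U := [set x : 'cV[R]_n | `|x - x0| < d1 /\ `|Phi x| < e].
pose U' : set 'cV[R]_n := cube e.
have UD x : U x -> D x by case=> /hd1[].
have oU' : open U' by exact: open_cube.
have oU : open U.
  apply/open_edP => x [xd xe].
  have [e2 e20 he2] := (open_edP _).1 (open_norm_ball x0 d1) x xd.
  have [|e3 e30 he3] := @cv_cont_edP R 'cV[R]_n n Phi x (e - `|Phi x|) _ (fun a => Ck_cont (Phis 0%N a
      ord0) (DB _ (UD x (conj xd xe)))).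
    by rewrite subr_gt0.
  exists (Num.min e2 e3); first by rewrite lt_min e20.
  move=> y; rewrite lt_min => /andP[/he2 yd /he3 ye]; split=> //.
  rewrite -(subrK (Phi x) (Phi y)); apply: le_lt_trans (ler_normD _ _) _.
  by rewrite -ltrBrDr.
have UU' x : U x -> U' (Phi x) /\ G (Phi x) = x.
  by move=> [xd xe]; split=> //; apply: GPhi; rewrite ?subr0 //; exact: lt_le_trans xe ee1.
have U'U y : U' y -> U (G y) /\ Phi (G y) = y.
  move=> ye; have [|Gd PG] := PhiG y; first by rewrite subr0; exact: lt_le_trans ye ee1.
  by split=> //; split=> //; rewrite PG.
have UM x : U x -> M x by move=> /UD/DB/BM.
(* On the slice G is y -> x0 + F y, by uniqueness of preimages under Phi. *)
have Gslice y : U' y -> (forall l : 'I_n, (l < r)%N -> y l ord0 = 0) -> Q (G y) = 1%:M.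
  move=> ye ys; have [_ P1 <-] := slice y (lt_le_trans ye ed) ys.
  congr Q; rewrite -{1}P1; apply: GPhi; last by rewrite P1 subr0; exact: lt_le_trans ye ee1.
  rewrite addrC addKr; apply: le_lt_trans (hb y) _; rewrite mulrC -ltr_pdivlMr //.
  exact: lt_le_trans ye ed1.
have Phi1 : Ckmx 1 U Phi by move=> i j; apply: Ck_subset (Phis 1%N i j) => x /UD/DB.
have sG : forall l, Ckmx l U' G.
  move=> l i j; have /smooth_mxE/(_ l i j) := Gs; apply: Ck_subset => y ye /=; rewrite subr0.
  exact: lt_le_trans ye ee1.
have YPhi x : U x -> forall (l : 'I_r) (a : 'I_n), (l <= a)%N ->
     vf_app (it_Y (W l)) (fun x => Phi x a ord0) x = (a == l :> nat)%:R.
  by move=> /UD/DB Bx l a la; have [] := YPQ x Bx l a la.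
(* A function annihilated by the Y_i is determined by its values on the slice. *)
have inv x : U x -> exists y, [/\ U y, Q y = 1%:M & forall f, Ck 1 U f ->
    (forall x, U x -> forall l : 'I_r, vf_app (it_Y (W l)) f x = 0) -> f x = f y].
  move=> Ux; have [U'x Gx] := UU' x Ux.
  (* Projection onto the slice along the first r coordinates; it does not leave the cube. *)
  pose y : 'cV[R]_n := \col_l if (l < r)%N then 0 else Phi x l ord0.
  have U'y : U' y.
    apply: le_lt_trans U'x; apply/cv_norm_leP => // l; rewrite mxE; case: ifP => _; first by rewrite normr0.
    exact: cv_coord_le.
  exists (G y); split=> [||f f1 Yf]; first by have [] := U'U y U'y.
    by apply: Gslice => // l lr; rewrite mxE lr.
  rewrite -{1}Gx; apply: (@box_const R n e (fun y => f (G y)) (fun l => (l < r)%N)) => //.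
  - exact: Ck_comp oU' oU f1 (fun a => sG 1%N a ord0) (fun y Uy => (U'U y Uy).1).
  - move=> l z lr U'z.
    exact: (partial_pushforward oU oU' Phi1 (sG 1%N) UU' U'U YPhi f1 (leqnn r) (fun x Ux l _ => Yf x Ux l)).
  - by move=> l lr; rewrite mxE (negbTE lr).
have sU l p q' (X : 'cV[R]_n -> 'M[R]_(p, q')) : Ckmx l B X -> Ckmx l U X.
  by move=> sX i j; apply: Ck_subset (sX i j) => x /UD/DB.
have sWU l : is_inf_transf U (W l) by exact: is_inf_transf_sub (sW l).
(* The four blocks of W_l Q = - Q A_l, with the lower left block [rho] still present. *)
have YB x l : U x -> [/\ vf_app_mx (it_Y (W l)) S x = - (S x *m it_C (W l) x),
    vf_app_mx (it_Y (W l)) s x = S x *m it_H (W l) x - (it_tau (W l) x / 2) *: s x,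
    vf_app_mx (it_Y (W l)) rho x = - (rho x *m it_C (W l) x) &
    vf_app (it_Y (W l)) k x = (rho x *m it_H (W l) x) ord0 ord0 - it_tau (W l) x / 2 * k x].
  move=> Ux; have ln : (l < n)%N by exact: leq_trans (ltn_ord l) (rank_le freeW).
  have [_ YQ] := YPQ x (DB x (UD x Ux)) l (Ordinal ln) (leqnn _).
  rewrite (QE x) /it_mx mulmx_block !mulmx0 !addr0 opp_block_mx in YQ.
  have ent i j : vf_app (it_Y (W l)) (fun y => Q y i j) x = vf_app_mx (it_Y (W l)) Q x i j by rewrite mxE.
  rewrite YQ in ent.
  split.
  - apply/matrixP => i j; have := ent (lshift 1 i) (lshift 1 j); rewrite block_mxEul => <-.
    by rewrite mxE; congr (vf_app _ _ x); apply/funext => y; rewrite !mxE.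
  - apply/matrixP => i j; have := ent (lshift 1 i) (rshift m j).
    rewrite block_mxEur mulmxN mul_mx_scalar opprD opprK => <-.
    by rewrite mxE; congr (vf_app _ _ x); apply/funext => y; rewrite !mxE.
  - apply/matrixP => i j; have := ent (rshift m i) (lshift 1 j); rewrite block_mxEdl => <-.
    by rewrite mxE; congr (vf_app _ _ x); apply/funext => y; rewrite !mxE.
  - rewrite (ent (rshift m ord0) (rshift m ord0)) block_mxEdr mulmxN mul_mx_scalar opprD opprK.
    by rewrite mxE [X in _ + X]mxE [X in - X]mxE [X in _ * X]mxE eqxx mulr1n.
have CT x l : U x -> (it_C (W l) x)^T = - it_C (W l) x.
  by have [_ [_ h] _ _] := sWU l; exact: h.
(* As C is skew-symmetric, S S^T and rho rho^T are annihilated by the Y_i. *)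
have gram p (X : 'cV[R]_n -> 'M[R]_(p, m)) : Ckmx 1 U X ->
    (forall x l, U x -> vf_app_mx (it_Y (W l)) X x = - (X x *m it_C (W l) x)) ->
    forall x, U x -> exists y, [/\ U y, Q y = 1%:M & X x *m (X x)^T = X y *m (X y)^T].
  move=> X1 YX x Ux; have [y [Uy Qy xy]] := inv x Ux; exists y; split=> //.
  apply/matrixP => i j; apply: (xy (fun x => (X x *m (X x)^T) i j)).
    exact: (Ckmx_mul oU X1 (Ckmx_tr oU X1)).
  move=> z Uz l; transitivity (vf_app_mx (it_Y (W l)) (fun x => X x *m (X x)^T) z i j); first by rewrite mxE.
  rewrite vf_app_mx_mul; last 2 first.
  - exact: Ckmx_derivable_mx X1 Uz.
  - exact: Ckmx_derivable_mx (Ckmx_tr oU X1) Uz.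
  rewrite vf_app_mx_tr YX //.
  have -> : (- (X z *m it_C (W l) z))^T = it_C (W l) z *m (X z)^T.
    by rewrite linearN /= trmx_mul CT // mulNmx opprK.
  by rewrite mulNmx mulmxA addNr mxE.
have SS x : U x -> S x *m (S x)^T = 1%:M.
  move=> Ux; have [||y [Uy /Q1[Sy _ _ _] ->]] := gram m S _ _ x Ux.
  - exact: sU.
  - by move=> z l Uz; have [] := YB z l Uz.
  - by rewrite Sy trmx1 mulmx1.
(* rho rho^T, a sum of squares, takes its value from the slice, where it is 0. *)
have rho0 x : U x -> rho x = 0.
  move=> Ux; have [||y [Uy /Q1[_ _ ry _]]] := gram 1%N rho _ _ x Ux.
  - exact: sU.
  - by move=> z l Uz; have [] := YB z l Uz.
  rewrite ry mul0mx => /(congr1 (fun X : 'M[R]_1 => X ord0 ord0)); rewrite [LHS]mxE [RHS]mxE => /eqP.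
  rewrite psumr_eq0 => [/allP h|j _]; last by rewrite [(rho x)^T _ _]mxE -expr2 sqr_ge0.
  apply/matrixP => i j; rewrite (ord1 i) [RHS]mxE; have := h j (mem_index_enum _).
  by rewrite /= [(rho x)^T _ _]mxE -expr2 sqrf_eq0 => /eqP.
have kpos x : U x -> 0 < k x by move=> /UD[[]].
have kn0 x : U x -> k x != 0 by move=> /kpos; rewrite lt_neqAle eq_sym => /andP[].
have Yk x l : U x -> vf_app (it_Y (W l)) k x = - (it_tau (W l) x / 2) * k x.
  by move=> Ux; have [_ _ _ ->] := YB x l Ux; rewrite rho0 // mul0mx mxE sub0r mulNr.
have detS x : U x -> \det (S x) = 1.
  move=> Ux; have [_ dS] := UD x Ux; have := congr1 (fun X : 'M[R]_m => \det X) (SS x Ux).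
  rewrite /= det_mulmx det_tr det1 -expr2 => /eqP; rewrite sqrf_eq1 => /orP[/eqP //|/eqP h].
  by move: dS; rewrite h oppr_gt0 ltr10.
(* Read off from Q = [[B, -B h], [0, sqrt eta]] with B orthogonal. *)
pose T : stoch_transf R n m := StochTransf Phi S (fun x => k x ^+ 2) (fun x => - ((S x)^T *m s x)).
have Phiinj : {in U &, injective Phi}.
  move=> x y; rewrite !inE => Ux Uy xy.
  by have [_ <-] := UU' x Ux; have [_ <-] := UU' y Uy; rewrite xy.
have pinvE y : U' y -> 'pinv_(fun=> 0) U Phi y = G y.
  move=> /U'U[Ug {1}<-]; apply: pinvKV => //; exact: mem_set.
have sPhi : smooth_mx U Phi by apply/smooth_mxE => l; exact: sU.
exists U, U', T; split=> //.
- by split; rewrite ?subrr ?normr0 // Phi0 normr0.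
- split=> /=.
  + split=> //.
      split.
      * by move=> x /UU'[].
      * exact: Phiinj.
      * by move=> y /U'U[Ug Pg]; exists (G y).
    move=> i j l; apply: (@Ck_ext _ _ _ _ (fun y => G y i j)) => //; last exact: sG.
    by move=> y; rewrite inE => /pinvE ->.
  + split; first by apply/smooth_mxE => l; exact: sU.
    by move=> x Ux; split; [exact: SS|exact: detS].
  + split=> [l|x Ux]; last by rewrite exprn_gt0 // kpos.
    have kl : Ck l U k by apply: Ck_subset (entk l) => x /UD/DB.
    exact: (Ck_mul oU kl kl).
  + apply/smooth_mxE => l; apply: Ckmx_opp => //; apply: Ckmx_mul => //; last exact: sU.
    by apply: Ckmx_tr => //; exact: sU.
move=> j J.
have kU l : Ck l U k by apply: Ck_subset (entk l) => x /UD/DB.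
have EU : smooth_sde U E.
  by have [sM sS] := smoothE; split=> i i' l; [apply: Ck_subset (sM i i' l)|apply: Ck_subset (sS i i' l)].
have dWU l : determining_equations U E (W l) by move=> x /UM; exact: dW.
(* With coordinates counted from 0, the coefficients of index j must not depend on the coordinates
   0, ..., j, or 0, ..., r - 1 when j >= r: the first min(r, j + 1) of them. *)
have tri (f : 'cV[R]_n -> R) : Ck 1 U f ->
    (forall x, U x -> forall l : 'I_r, (l < minn r j.+1)%N -> vf_app (it_Y (W l)) f x = 0) ->
    depends_only_on U' J (fun y => f (G y)).
  move=> f1 Yf y y' U'y U'y' yy'.
  apply: (@box_const R n e (fun y => f (G y)) (fun l => (l < minn r j.+1)%N)) => //.
  - exact: Ck_comp oU' oU f1 (fun a => sG 1%N a ord0) (fun y Uy => (U'U y Uy).1).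
  - move=> l z lr U'z.
    exact: (partial_pushforward oU oU' Phi1 (sG 1%N) UU' U'U YPhi f1 (geq_minl _ _) Yf).
  - move=> l; rewrite -leqNgt => lK; apply: yy'; rewrite /J; move: lK; rewrite geq_min.
    by case: (leqP r j) => rj /orP[] //; [move=> jl; exact: leq_trans rj (ltnW jl)|move=> rl; exact: leq_trans rj rl].
pose f x := Phi x j ord0.
have sf : smooth U f by move=> l; exact: sPhi.
(* At l = j the value is 1 and not 0; a constant is enough, because the coefficients contain only
   derivatives of Phi^j, and this is how coordinate j itself drops out. *)
have Yf l : (l < minn r j.+1)%N -> forall l' : 'I_r, l = l' -> {in U, vf_app (it_Y (W l')) f =1 fun=> (j
    == l' :> nat)%:R}.
  move=> lm l' ll' x; rewrite inE => Ux; apply: YPhi => //.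
  by move: lm; rewrite leq_min ll' ltnS => /andP[].
have jE p (X : 'M[R]_(n, p)) x b' : (jacobian_mx Phi x *m X) j b' = (grad f x *m X) ord0 b'.
  by rewrite !mxE; apply: eq_bigr => l _; rewrite !mxE.
pose h x := - ((S x)^T *m s x).
have hU l : Ckmx l U h.
  apply: Ckmx_opp => //; apply: Ckmx_mul => //; last exact: sU.
  by apply: Ckmx_tr => //; exact: sU.
split=> [|a].
  pose g x := (k x ^+ 2)^-1 * (generator E f x + \tr (sgrad E f x *m h x)).
  have driftE y : U' y -> drift (transformed_sde U T E) y j ord0 = g (G y).
    move=> U'y; rewrite /= pinvE // [LHS]mxE [X in _ * X]mxE [X in _ * (X + _)]mxE -mulmxA jE mulmxA.
    by rewrite /g /mxtrace big_ord1.
  suff H : depends_only_on U' J (fun y => g (G y)).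
    by move=> y y' Uy Uy' yy'; rewrite !driftE //; exact: H.
  have k2n0 x : U x -> k x ^+ 2 != 0 by move=> Ux; rewrite expf_neq0 // kn0.
  have kinv := Ck_inv oU k2n0 (Ck_mul oU (kU 1%N) (kU 1%N)).
  have trU : Ck 1 U (fun x => \tr (sgrad E f x *m h x)).
    by apply: Ck_sum => // i _; exact: (Ckmx_mul oU (Ckmx_sgrad 1 oU EU sf) (hU 1%N)).
  apply: tri; first exact: Ck_mul oU kinv (Ck_add oU (Ck_generator 1 oU EU sf) trU).
  move=> x Ux l lm.
  apply: (drift_invariant (V := W l) oU EU (sWU l) (dWU l) (fun l => sU l _ _ _ (entS l))
     (fun l => sU l _ _ _ (ents l)) kU kn0 SS _ _ _ sf (Yf l lm l erefl) Ux).
  - by move=> z Uz; have [] := YB z l Uz.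
  - by move=> z Uz; have [] := YB z l Uz.
  - by move=> z Uz; exact: Yk.
pose g x := ((k x)^-1 *: (sgrad E f x *m (S x)^T)) ord0 a.
have diffE y : U' y -> diffusion (transformed_sde U T E) y j a = g (G y).
  move=> U'y; have [Ug _] := U'U y U'y; rewrite /= pinvE // sqrtr_sqr (gtr0_norm (kpos _ Ug)).
  have [uS _] := mulmx1_unit (SS _ Ug).
  have -> : invmx (S (G y)) = (S (G y))^T by rewrite -[LHS]mulmx1 -(SS _ Ug) mulKmx.
  by rewrite [LHS]mxE -mulmxA jE mulmxA [RHS]mxE.
suff H : depends_only_on U' J (fun y => g (G y)).
  by move=> y y' Uy Uy' yy'; rewrite !diffE //; exact: H.
apply: tri.
  have kinv : Ck 1 U (fun x => (k x)^-1) by exact: Ck_inv.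
  exact: (Ckmx_scale oU kinv (Ckmx_mul oU (Ckmx_sgrad 1 oU EU sf) (Ckmx_tr oU (sU 1%N _ _ _ (entS 1%N))))).
move=> x Ux l lm.
have YS z : U z -> vf_app_mx (it_Y (W l)) S z = - (S z *m it_C (W l) z) by move=> Uz; have [] := YB z l Uz.
have D0 := diffusion_invariant (V := W l) oU EU (sWU l) (dWU l) (fun l => sU l _ _ _ (entS l)) kU kn0 YS
  (fun z => Yk z l) sf (Yf l lm l erefl) Ux.
by have := congr1 (fun X : 'rV[R]_m => X ord0 a) D0; rewrite /= [LHS]mxE [RHS]mxE.
Qed.
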